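(* Let $g=\begin{pmatrix} a & b\\ c & d\end{pmatrix}\in \mathrm{GL}_2(\mathbb F_q)$ and set $\Delta=\det(g)=ad-bc$. Let $r\in k=\mathbb F_q(x)$ be non-zero, let $i$ be an integer with $0\le i<n$, and define $r_i^g\in k$ by $$r_i^g(x)=r\left(\frac{ax+b}{cx+d}\right)\left(\frac{\Delta}{(cx+d)^2}\right)^{1-i}.$$ Then $$\rho(r,\varepsilon,i)=\rho(r_i^g,\varepsilon,i).$$
   Context: **Setting.** Fix a positive integer $n$ and an odd prime power $q$ with $q\equiv 1 \pmod n$; let $p$ be the characteristic of $\mathbb F_q$. Put $R=\mathbb F_q[x]$, $k=\mathbb F_q(x)$, and let $k_\infty$ be the completion of $k$ at the infinite place, with uniformizer $\pi_\infty=x^{-1}$, so $k_\infty=\mathbb F_q((x^{-1}))$. Let $\mu_n(\mathbb F_q)$ be the group of $n$-th roots of $1$ in $\mathbb F_q$ and let $\varepsilon:\mu_n(\mathbb F_q)\to\mathbb C^\times$ be an embedding (injective homomorphism). **Additive character.** Let $e_o:\mathbb F_q\to\mathbb C^\times$ be the additive character $e_o(a)=e^{2\pi\sqrt{-1}\,j/p}$, where $j \bmod p$ represents $\mathrm{Tr}_{\mathbb F_q/\mathbb F_p}(a)$. Define $e:k\to\mathbb C^\times$ by $e(f)=e_o(-\mathrm{Res}_\infty(f\,dx))$; equivalently, $e(f)=e_o(f_{-1})$, where $f_{-1}$ is the coefficient of $x^{-1}$ in the Laurent expansion of $f$ in $\mathbb F_q((x^{-1}))$. **Gauss sums.** For $\xi,c\in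 R$ with $c\ne0$, let $\left(\frac{\xi}{c}\right)_n$ denote the $n$-th power residue (Legendre–Jacobi) symbol in $R$. It takes values in $\mu_n(\mathbb F_q)$ if $\gcd(\xi,c)=1$; it is multiplicative in $c$, equal to $1$ if $c$ is a unit, and for $c=\pi$ irreducible it is the element of $\mu_n(\mathbb F_q)$ congruent to $\xi^{(q^{\deg\pi}-1)/n}$ mod $\pi$. If $\gcd(\xi,c)\neq 1$ the symbol is $0$, and one sets $\varepsilon(0)=0$. For non-zero $r,c\in R$ put $$g(r,\varepsilon,c)=\sum_{\xi \bmod c}\varepsilon\left(\left(\frac{\xi}{c}\right)_n\right)e(r\xi/c).$$ **Dirichlet series.** For $\eta\in k_\infty^\times/k_\infty^{\times n}$ and non-zero $r\in R$ define, for $\mathrm{Re}(s)>3/2$, $$\psi(r,\varepsilon,\eta,s)=(1-q^{n-ns})^{-1}\sum_{c\in R\setminus\{0\},\ c\sim\eta} g(r,\varepsilon,c)\,q^{-\deg(c)s},$$ where $c\sim\eta$ means $\eta/c\in k_\infty^{\times n}$. (For $\eta=\pi_\infty^{-i}$ this says that $\deg(c)\equiv i \pmod n$ and the leading coefficient of $c$ is an $n$-th power in $\mathbb F_q^\times$.) It is known that $\psi(r,\varepsilon,\eta,s)$ has a meromorphic continuation (it is a rational function of $q^{-s}$) and that in $\mathrm{Re}(s)>1$ it has, modulo $\frac{2\pi\sqrt{-1}}{n\log q}\mathbb Z$, at most one pole, at $s=1+1/n$, which is simple if it exists. **Definition of $\rho$.** For non-zero $r\in R$, $\rho(r,\varepsilon,\eta)$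 denotes the residue of $\psi(r,\varepsilon,\eta,s)$ at $s=1+1/n$ (it is $0$ if there is no pole), and $\rho(r,\varepsilon,i)=\rho(r,\varepsilon,\pi_\infty^{-i})$ for an integer $i$. It is known that $\rho(r,\varepsilon,i)$ depends only on $r$ modulo $n$-th powers, i.e. $\rho(rm^n,\varepsilon,i)=\rho(r,\varepsilon,i)$ for non-zero $m\in R$. By this property $\rho$ is extended to all non-zero rational functions: for non-zero $r\in k$, $\rho(r,\varepsilon,i)=\rho(rm^n,\varepsilon,i)$ for any non-zero $m\in R$ with $rm^n\in R$. *)

(* Defs.v *)
From HB Require Import structures.
From mathcomp Require Import all_boot all_order all_algebra all_field.
From mathcomp Require Import generic_quotient.
From mathcomp Require Import complex.
From mathcomp Require Import all_classical all_reals all_analysis.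

Set Implicit Arguments.
Unset Strict Implicit.
Unset Printing Implicit Defensive.

Import Order.TTheory GRing.Theory Num.Theory.
Import numFieldNormedType.Exports.

Local Open Scope ring_scope.
Local Open Scope classical_set_scope.
Local Open Scope complex_scope.

Local Notation "f %:F" := (FracField.tofrac f).

Section RationalFunctions.
Context (F : finFieldType).

Definition numer (f : {fraction {poly F}}) : {poly F} := (fraction.frac (repr f)).1.
Definition denom (f : {fraction {poly F}}) : {poly F} := (fraction.frac (repr f)).2.

Definition fcst (a : F) : {fraction {poly F}} := a%:P%:F.
Definition fX : {fraction {poly F}} := 'X%:F.

(* r(t); meaningful for t outside the constants, where the denominator of r
   does not vanish at t *)
Definition fsubst (r t : {fraction {poly F}}) : {fraction {poly F}} :=
  (map_poly fcst (numer r)).[t] / (map_poly fcst (denom r)).[t].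

Definition twist (g : 'M[F]_2) (r : {fraction {poly F}}) (i : int) :
    {fraction {poly F}} :=
  let num := fcst (g 0 0) * fX + fcst (g 0 1) in
  let den := fcst (g 1 0) * fX + fcst (g 1 1) in
  fsubst r (num / den) * (fcst (\det g) / den ^+ 2) ^ (1 - i).

(* Elements of F((1/x)) are represented by their coefficient functions:
   h m is the coefficient of x^m. *)
Definition is_laurent (h : int -> F) : Prop :=
  exists M : int, forall m : int, M < m -> h m = 0.

(* The sum has finite support when both factors satisfy is_laurent. *)
Definition laurent_mul (h1 h2 : int -> F) : int -> F :=
  fun m => \sum_(j \in [set: int]) h1 j * h2 (m - j).

(* Expansion of N/D at infinity: the coefficients of x^j, j >= 0, are those of
   the Euclidean quotient of N by D, and the coefficient of x^-j in N/D is the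
   constant coefficient of the quotient of x^j N by D. *)
Definition expansion (f : {fraction {poly F}}) : int -> F := fun m =>
  match m with
  | Posz j => (numer f %/ denom f)`_j
  | Negz j => (('X^(j.+1) * numer f) %/ denom f)`_0
  end.

Definition laurent_exp (h : int -> F) (n : nat) : int -> F :=
  iter n (laurent_mul h) (expansion 1).

(* eta / c is an n-th power in the multiplicative group of F((1/x)) *)
Definition nth_power_class (n : nat) (c : {poly F}) (eta : int -> F) : Prop :=
  exists h : int -> F, [/\ is_laurent h, exists m, h m != 0
    & eta = laurent_mul (expansion c%:F) (laurent_exp h n)].

Definition residue_symbol_prime (n : nat) (xi P : {poly F}) : F :=
  odflt 0 [pick z : F | n.-unity_root z &&
    (P %| xi ^+ ((#|F| ^ (size P).-1 - 1) %/ n)%N - z%:P)].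

Definition multiplicity (P c : {poly F}) : nat :=
  \max_(k < size c | P ^+ k %| c) k.

Definition residue_symbol (n : nat) (xi c : {poly F}) : F :=
  if coprimep xi c then
    \prod_(P : {poly_(size c) F} |
        [&& (P : {poly F}) \is monic, irreducibleb (P : {poly F})
          & (P : {poly F}) %| c])
      residue_symbol_prime n xi P ^+ multiplicity P c
  else 0.

End RationalFunctions.

Section Rho.
Context (R : realType) (F : finFieldType) (p : nat) (hp : p \in [pchar F]).
Context (n : nat) (eps : F -> R[i]).

(* b^z for real b > 0 *)
Definition cpow (b : R) (z : R[i]) : R[i] :=
  (expR (complex.Re z * ln b))%:C *
  (cos (complex.Im z * ln b) +i* sin (complex.Im z * ln b)).

(* q^z, where q is the cardinality of F *)
Definition qpow (z : R[i]) : R[i] := cpow #|F|%:R z.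

(* eps matters only on the n-th roots of unity of F. *)
Definition is_mu_embedding : Prop :=
  [/\ eps 1 = 1,
      {in [pred z : F | n.-unity_root z] &, {morph eps : x y / x * y}}
    & {in [pred z : F | n.-unity_root z] &, injective eps}].

Definition eps0 (z : F) : R[i] := if z == 0 then 0 else eps z.

Definition abs_trace (a : F) : F :=
  @galTrace 'F_p (pPrimeCharType hp) 1%VS fullv a.

(* the representative in [0, p) of the trace, which lies in the prime field *)
Definition trace_rep (a : F) : nat :=
  index (abs_trace a) [seq j%:R | j <- iota 0 p].

Definition e_o (a : F) : R[i] :=
  let t : R := pi *+ 2 * (trace_rep a)%:R / p%:R in cos t +i* sin t.

Definition e_k (f : {fraction {poly F}}) : R[i] := e_o (expansion f (- 1)).

Definition gauss_sum (r c : {poly F}) : R[i] :=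
  \sum_(xi : {poly_((size c).-1) F})
    eps0 (residue_symbol n xi c) * e_k ((r * xi)%:F / c%:F).

(* The Dirichlet series is summed in the order of increasing degree, the
   finitely many c of a given degree being grouped together. *)
Definition psi_term (r : {poly F}) (eta : int -> F) (s : R[i]) (d : nat) : R[i] :=
  \sum_(c : {poly_(d.+1) F} |
      (size (c : {poly F}) == d.+1) && `[< nth_power_class n c eta >])
    gauss_sum r c * qpow (- (d%:R * s)).

Definition psi (r : {poly F}) (eta : int -> F) (s : R[i]) : R[i] :=
  (1 - qpow (n%:R - n%:R * s))^-1 *
  limn (series (psi_term r eta s) : nat -> R[i]^o).

(* f is the continuation of psi as a rational function of q^-s. Two such f
   coincide outside a discrete set, since q^-s takes infinitely many values on
   Re s > 3/2. *)
Definition psi_continuation (r : {poly F}) (eta : int -> F) (f : R[i] -> R[i]) :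
    Prop :=
  exists A B : {poly R[i]}, [/\ B != 0,
    forall s, 3%:R / 2%:R < complex.Re s ->
      B.[qpow (- s)] * psi r eta s = A.[qpow (- s)]
    & forall s, f s = A.[qpow (- s)] / B.[qpow (- s)]].

(* The residue at a point where f has at most a simple pole. *)
Definition simple_residue (f : R[i] -> R[i]) (s0 v : R[i]) : Prop :=
  ((fun s : R[i]^o => (s - s0) * f s : R[i]^o) @ (s0 : R[i]^o)^' --> (v : R[i]^o)).

Definition rho_eta (r : {poly F}) (eta : int -> F) : R[i] :=
  xget 0 [set v | exists f, psi_continuation r eta f /\
                    simple_residue f (1 + n%:R^-1) v].

(* The uniformizer at infinity is 1/x. *)
Definition rho_poly (r : {poly F}) (i : int) : R[i] :=
  rho_eta r (expansion ((fX F)^-1 ^ (- i))).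

(* rho_poly s i does not depend on the choice of m *)
Definition rho (r : {fraction {poly F}}) (i : int) : R[i] :=
  xget 0 [set v | exists m s : {poly F},
    [/\ m != 0, s%:F = r * m%:F ^+ n & v = rho_poly s i]].

End Rho.

(* Main.v *)
Require Import Defs.
From HB Require Import structures.
From mathcomp Require Import all_boot all_order all_algebra all_field.
From mathcomp Require Import complex ring lra zify fingroup cyclic generic_quotient.
From mathcomp Require Import all_classical all_reals all_analysis.

(** Write A_D(r) for the sum of the Gauss sums g(r, eps, c) over the monic c of
degree D.  A scalar factor a of c contributes eps(a^((q-1)/n))^D, which is 1 when
a is an n-th power, so the D-th term of the series psi(r, eps, x^i, s) is
a constant multiple of A_D(r) q^(-Ds) when D = i modulo n, and 0 otherwise.  The proof shows that
A_D is invariant under r |-> r_i^g for every large D in this residue class, and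
that the residue depends on these values only.

The power residue symbol (xi/c)_n is the (q-1)/n-th power of a resultant
([residue_symbolE]).  Two properties of Gauss sums follow.

Covariance.  A resultant is a covariant of pairs of binary forms, and the residue
of a differential is invariant under the Moebius substitution given by g, which
multiplies dx by the derivative of g.  Hence g(s, eps, c) = g(s', eps, c'), where c' is
the transform of c made monic and s' the twist of s, provided that
deg c = i modulo n and that the degree does not drop, i.e. that c does not vanish
at the finite point that goes to infinity ([gsum_htr]).

Reciprocity.  If xi xi' + c c' = 1 modulo c xi, then r xi'/c + r c'/xi is
r/(c xi) up to a polynomial, and its residue vanishes once
deg c > deg r + 1.  Together with the reciprocity law of the symbol this
exchanges c and xi in the double sum over c and xi, and gives, for h of degree
t <= 1, the sum of g(r, eps, c) over the monic multiples c of h of degree D + t as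
a combination of the sums M_e(h, r) of g(r, eps, c) over the monic c of degree
e < D + t prime to h, with e = D + t modulo n ([gauss_sum_reciprocity]); the
coefficients depend on neither r nor h.  For h = 1 this is a recursion, from which
A_(D+n) = q^(n+1) A_D for D > deg r + 1 ([asum_step]).  For h = x - u it expresses
A_D(r) by the M_e(x - u, r) ([asum_from_msum]), which are the sums that
covariance applies to.  So A_D(s) = A_D(s') for large D = i modulo n
([asum_mtwist]), although covariance fails for the c that vanish at u.

The pole.  Two series whose coefficients agree from some degree on differ by a
polynomial in q^(-s) times 1/(1 - q^(n-ns)), which is holomorphic at
s = 1 + 1/n, so one continues as soon as the other does and the residues agree
([residue_eq]).  The recursion makes the series converge for Re s > 3/2 when
n > 1.  For n = 1 the A_D are eventually 0 ([asum_eq0]).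

Finally r |-> r_i^g is undone by the twist by the adjugate of g ([twist_adj]), so
the polynomial representatives of r and of r_i^g give the same set of values of
rho. *)

Set Implicit Arguments.
Unset Strict Implicit.
Unset Printing Implicit Defensive.

Import Order.TTheory GRing.Theory Num.Theory.
Local Open Scope ring_scope.
Local Open Scope complex_scope.

(** * Normalized resultants over a finite field *)

Section Norm.
Variables (F : finFieldType) (K : closedFieldType) (iota : {rmorphism F -> K}).
Local Notation q := #|F|.
Local Notation lift := (map_poly iota).

Definition croots (c : {poly F}) : seq K :=
  sval (closed_field_poly_normal (lift c)).

(** This is the resultant of [c] and [xi] without its power of the leading coefficient
of [c], so that it does not see constant factors of [c]. *)
Definition resnorm (xi c : {poly F}) : K := \prod_(z <- croots c) (lift xi).[z].

Lemma lift_croots c :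
  lift c = iota (lead_coef c) *: \prod_(z <- croots c) ('X - z%:P).
Proof. by rewrite /croots; case: closed_field_poly_normal => s /= {1}->; rewrite lead_coef_map. Qed.

Lemma croots_perm c (a : K) (s : seq K) : a != 0 ->
  lift c = a *: \prod_(z <- s) ('X - z%:P) -> perm_eq (croots c) s.
Proof.
move=> a0 E; apply: prod_XsubC_eq.
have mon (t : seq K) : lead_coef (\prod_(z <- t) ('X - z%:P)) = 1.
  by apply/monicP/monic_prod => z _; apply: monicXsubC.
have E2 : iota (lead_coef c) = a.
  by have /(congr1 lead_coef) := E; rewrite lead_coefZ mon mulr1 lead_coef_map.
by move: E; rewrite lift_croots E2 => /(scalerI a0).
Qed.

Lemma resnorm_eq xi c (a : K) (s : seq K) : a != 0 ->
  lift c = a *: \prod_(z <- s) ('X - z%:P) ->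
  resnorm xi c = \prod_(z <- s) (lift xi).[z].
Proof. by move=> a0 /(croots_perm a0); apply: perm_big. Qed.

Lemma size_croots c : c != 0 -> size (croots c) = (size c).-1.
Proof.
move=> c0; rewrite -(size_map_poly iota) lift_croots size_scale.
  by rewrite size_prod_XsubC.
by rewrite fmorph_eq0 lead_coef_eq0.
Qed.

Lemma resnormM xi xi' c : resnorm (xi * xi') c = resnorm xi c * resnorm xi' c.
Proof. by rewrite -big_split; apply: eq_bigr => z _; rewrite rmorphM hornerM. Qed.

Lemma resnorm_mod xi xi' c : c != 0 -> c %| xi - xi' ->
  resnorm xi c = resnorm xi' c.
Proof.
move=> c0 /dvdpP[k /eqP]; rewrite subr_eq => /eqP ->.
apply: eq_big_seq => z zc; rewrite rmorphD rmorphM hornerD hornerM.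
suff /rootP-> : root (lift c) z by rewrite mulr0 add0r.
by rewrite lift_croots rootZ ?fmorph_eq0 ?lead_coef_eq0 // root_prod_XsubC.
Qed.

Lemma resnorm_Mr xi c c' : c != 0 -> c' != 0 ->
  resnorm xi (c * c') = resnorm xi c * resnorm xi c'.
Proof.
move=> c0 c'0; rewrite -big_cat.
apply: (@resnorm_eq _ _ (iota (lead_coef (c * c')))).
  by rewrite fmorph_eq0 lead_coef_eq0 mulf_neq0.
rewrite big_cat /= rmorphM lead_coefM rmorphM /= {1}[lift c]lift_croots.
by rewrite [lift c']lift_croots -scalerAl -scalerAr scalerA.
Qed.

Lemma resnorm_const xi (a : F) : a != 0 -> resnorm xi a%:P = 1.
Proof.
move=> a0; rewrite (@resnorm_eq _ _ (iota a) [::]) ?big_nil ?fmorph_eq0 //.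
by rewrite map_polyC /= alg_polyC.
Qed.

Lemma resnorm_scale xi (a : F) c : a != 0 -> c != 0 ->
  resnorm xi (a *: c) = resnorm xi c.
Proof.
by move=> a0 c0; rewrite -mul_polyC resnorm_Mr ?polyC_eq0 // resnorm_const ?mul1r.
Qed.

Lemma resnorm_eq0 xi c : c != 0 -> (resnorm xi c == 0) = ~~ coprimep xi c.
Proof.
move=> c0; rewrite /resnorm prodf_seq_eq0; apply/hasP/idP => [[z zc /= xiz]|].
  rewrite -(coprimep_map iota); apply/negP => /coprimep_root-/(_ z xiz).
  rewrite lift_croots -rootE rootZ ?fmorph_eq0 ?lead_coef_eq0 //.
  by rewrite root_prod_XsubC zc.
rewrite -(coprimep_map iota) => nco.
have [z] : exists z, root (gcdp (lift xi) (lift c)) z by apply/closed_rootP.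
rewrite root_gcd => /andP[xiz cz]; exists z; last by [].
move: cz; rewrite lift_croots rootZ ?fmorph_eq0 ?lead_coef_eq0 //.
by rewrite root_prod_XsubC.
Qed.

(** X^q - X has no other roots than the elements of F. *)
Lemma fixed_by_frobenius (x : K) : x ^+ q = x -> exists a, x = iota a.
Proof.
move=> xq; have : root (lift ('X^q - 'X)) x.
  by rewrite rmorphB /= map_polyXn map_polyX rootE !hornerE xq subrr.
rewrite finField_genPoly rmorph_prod /= -big_enum.
under eq_bigr do rewrite rmorphB /= map_polyX map_polyC.
have -> : \prod_(i <- enum F) ('X - (iota i)%:P) =
   \prod_(z <- map iota (enum F)) ('X - z%:P) by rewrite big_map.
by rewrite root_prod_XsubC => /mapP[a _ ->]; exists a.
Qed.

Lemma frobenius_exists : exists phi : {rmorphism K -> K}, forall x, phi x = x ^+ q.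
Proof.
have [p pr_p pF] := finPcharP F.
have pK : p \in [pchar K] by rewrite -(fmorph_pchar iota) in pF.
have Hk := card_pprimeChar pF.
pose phi (x : K) := x ^+ q.
have qp : [pchar K].-nat q.
  by rewrite Hk pnatX pnatE // pK.
have phiB : zmod_morphism phi.
  move=> x y; rewrite /phi (exprDn_pchar _ _ qp); congr (_ + _).
  by rewrite exprNn_pchar.
have phiM : monoid_morphism phi.
  by split=> [|x y]; rewrite /phi ?expr1n ?exprMn.
pose phiA := GRing.isZmodMorphism.Build _ _ phi phiB.
pose phiR := GRing.isMonoidMorphism.Build _ _ phi phiM.
pose f : {rmorphism K -> K} := HB.pack phi phiA phiR.
by exists f.
Qed.

(** The root generates a field with q^(deg P) elements. *)
Lemma irreducible_root_card (P : {poly F}) (x : K) :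
  monic_irreducible_poly P -> root (lift P) x -> x ^+ (q ^ (size P).-1) = x.
Proof.
move=> hP rx.
have : P %| 'X^(q ^ (size P).-1) - 'X.
  have h := expf_card ('qX : {poly %/ P with hP}).
  rewrite card_qfpoly in h.
  have {h} : in_qpoly P ('X^(q ^ (size P).-1) - 'X) = 0.
    by rewrite rmorphB rmorphXn; apply/eqP; rewrite subr_eq0; apply/eqP; exact: h.
  move=> /(congr1 (fun z : {poly %/ P} => (z : {poly F}))) /=.
  by rewrite -Pdiv.IdomainMonic.modpE ?mk_monicE ?hP // => /eqP.
rewrite -(dvdp_map iota) => /dvdpP[k].
rewrite rmorphB /= map_polyXn map_polyX => /(congr1 (horner^~ x)).
rewrite !hornerE (rootP rx) mulr0 => /eqP.
by rewrite subr_eq0 => /eqP.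
Qed.

(** The right-hand side is fixed by the Frobenius, so it comes from a polynomial over F.
That polynomial shares a root with the irreducible P and has the same degree. *)
Lemma irreducible_conjugates (P : {poly F}) (x : K) :
  monic_irreducible_poly P -> root (lift P) x ->
  lift P = \prod_(j < (size P).-1) ('X - (x ^+ (q ^ j))%:P).
Proof.
move=> hP rx; have [phi phiE] := frobenius_exists.
set D := (size P).-1.
have xD : x ^+ (q ^ D) = x by apply: irreducible_root_card.
have D0 : (0 < D)%N by rewrite /D; case: (size P) (hP.1.1) => [|[]].
pose M := \prod_(j < D) ('X - (x ^+ (q ^ j))%:P).
have Mphi : map_poly phi M = M.
  rewrite rmorph_prod /=.
  under eq_bigr => j _ do rewrite map_polyXsubC phiE -exprM -expnSr.
  rewrite /M -(prednK D0) big_ord_recr big_ord_recl /= mulrC.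
  by rewrite expn0 expr1 (prednK D0) xD.
have [M0 EM] : exists M0, M = lift M0.
  have Mi i : exists a, M`_i = iota a.
    by apply: fixed_by_frobenius; rewrite -phiE -coef_map Mphi.
  have [a aE] := boolp.choice Mi.
  exists (\poly_(i < size M) a i); apply/polyP => i.
  rewrite coef_map coef_poly; case: ltnP => si; first exact: aE.
  by rewrite nth_default // raddf0.
have sM : size M = D.+1.
  by rewrite /M size_prod_XsubC /index_enum -enumT size_enum_ord.
have mM : M \is monic by apply: monic_prod => j _; apply: monicXsubC.
have mM0 : M0 \is monic by rewrite -(map_monic iota) -EM.
have sM0 : size M0 = D.+1 by rewrite -sM EM size_map_poly.
have sP : size P = D.+1 by rewrite /D prednK //; case: (size P) (hP.1.1).
suff : P %= M0 by rewrite eqp_monic ?hP // => /eqP->; rewrite -EM.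
rewrite -dvdp_size_eqp ?sM0 ?sP //.
apply: contraT; rewrite -irreducible_poly_coprime ?hP //; last exact: hP.1.
rewrite -(coprimep_map iota) => /coprimep_root-/(_ x rx).
rewrite -EM horner_prod => /negP[]; apply/eqP.
rewrite -(prednK D0) big_ord_recl /= expn0 expr1.
by rewrite !hornerE subrr mul0r.
Qed.

Lemma horner_frobenius (xi : {poly F}) (x : K) j :
  (lift xi).[x ^+ (q ^ j)] = (lift xi).[x] ^+ (q ^ j).
Proof.
have [phi phiE] := frobenius_exists.
have xixq : map_poly phi (lift xi) = lift xi.
  apply/polyP => i; rewrite !coef_map /= phiE -rmorphXn; congr (iota _).
  exact: expf_card.
elim: j => [|j IH]; first by rewrite expn0 !expr1.
by rewrite expnSr !exprM -IH -!phiE -{1}xixq horner_map.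
Qed.

(** This is the norm from F(x) to F of the value of [xi] at x. *)
Lemma resnorm_irreducible xi (P : {poly F}) (x : K) :
  monic_irreducible_poly P -> root (lift P) x ->
  resnorm xi P = (lift xi).[x] ^+ (\sum_(j < (size P).-1) q ^ j).
Proof.
move=> hP rx.
rewrite (@resnorm_eq _ _ 1 [seq x ^+ (q ^ val j) | j <- index_enum 'I_(size P).-1]).
- by rewrite big_map expr_sum; apply: eq_bigr => j _; rewrite horner_frobenius.
- exact: oner_neq0.
by rewrite scale1r big_map; apply: irreducible_conjugates.
Qed.

End Norm.

(** * Unique factorization and multiplicities *)

Section Factorization.
Variable F : finFieldType.
Implicit Types (c P Q : {poly F}).

Lemma multiplicityP P c k : irreducible_poly P -> c != 0 ->
  (P ^+ k %| c) = (k <= multiplicity P c)%N.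
Proof.
move=> irrP c0; have sP : (1 < size P)%N by case: irrP.
have P0 : P != 0 by rewrite -size_poly_gt0; apply: ltnW.
have bound j : P ^+ j %| c -> (j < size c)%N.
  move=> /(dvdp_leq c0); apply: leq_trans.
  rewrite -(prednK (_ : 0 < size (P ^+ j))%N) ?size_poly_gt0 ?expf_neq0 // ltnS.
  by rewrite size_exp leq_pmull // -subn1 subn_gt0.
apply/idP/idP => [Pk|].
  by rewrite /multiplicity (bigD1 (Ordinal (bound k Pk))) //= leq_maxl.
have c_gt0 : (0 < size c)%N by rewrite size_poly_gt0.
have [|j Pj E] := @eq_bigmax_cond _ [pred k : 'I_(size c) | P ^+ k %| c] val.
  by apply/card_gt0P; exists (Ordinal c_gt0); rewrite inE /= expr0 dvd1p.
have -> : multiplicity P c = j by rewrite -[RHS]E; apply: eq_bigl.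
rewrite inE in Pj.
by move=> kj; apply: dvdp_trans Pj; apply: dvdp_exp2l.
Qed.

Lemma multiplicity_eq0 P c : irreducible_poly P -> c != 0 -> ~~ (P %| c) ->
  multiplicity P c = 0%N.
Proof.
move=> irrP c0; rewrite -[P in P %| c]expr1 multiplicityP //.
by rewrite -eqn0Ngt => /eqP.
Qed.

Lemma irreducible_monic_coprime P Q : monic_irreducible_poly P ->
  monic_irreducible_poly Q -> P != Q -> coprimep P Q.
Proof.
move=> [irrP mP] [irrQ mQ] nPQ; rewrite irreducible_poly_coprime //.
apply: contra nPQ => PQ; rewrite -eqp_monic //.
by apply: irrQ => //; rewrite gtn_eqF //; case: irrP.
Qed.

Lemma multiplicityM P Q c : monic_irreducible_poly P ->
  monic_irreducible_poly Q -> c != 0 ->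
  multiplicity P (Q * c) = ((P == Q) + multiplicity P c)%N.
Proof.
move=> hP hQ c0; have irrP := hP.1.
have Q0 : Q != 0 by apply/irredp_neq0/hQ.1.
have Qc0 : Q * c != 0 by rewrite mulf_neq0.
have leE k : (k <= multiplicity P (Q * c))%N = (k <= (P == Q) + multiplicity P c)%N.
  rewrite -multiplicityP //; have [eqPQ|nPQ] := eqVneq P Q.
    subst Q; case: k => [|k]; first by rewrite dvd1p.
    by rewrite exprS dvdp_mul2l ?irredp_neq0 // multiplicityP.
  rewrite Gauss_dvdpr ?multiplicityP //.
  by rewrite coprimep_expl // irreducible_monic_coprime.
by apply/eqP; rewrite eqn_leq -leE leqnn leE leqnn.
Qed.

Lemma monic_irreducible_factor c : (1 < size c)%N ->
  exists2 P, monic_irreducible_poly P & P %| c.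
Proof.
move: {2}(size c) (leqnn (size c)) => m; elim: m c => [|m IH] c.
  by rewrite leqn0 => /eqP->.
move=> sc c1; have c0 : c != 0 by rewrite -size_poly_gt0; apply: ltnW.
have [/irreducibleP irr|] := boolP (irreducibleb c).
  exists ((lead_coef c)^-1 *: c); last by rewrite dvdpZl ?invr_eq0 ?lead_coef_eq0.
  split; last by rewrite monicE lead_coefZ mulVf ?lead_coef_eq0.
  have lc : (lead_coef c)^-1 != 0 by rewrite invr_eq0 lead_coef_eq0.
  split=> [|d d1]; first by rewrite size_scale.
  by rewrite dvdpZr // => /irr-/(_ d1)/eqp_trans; apply; rewrite eqp_sym eqp_scale.
rewrite /irreducibleb c1 /= => /forallPn[d]; rewrite negb_imply -ltnNge.
rewrite -Pdiv.Idomain.dvdpE => /andP[dc d1].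
have [|//|P hP Pd] := IH d.
  by apply: leq_trans (size_npoly d) _; rewrite -ltnS prednK // ltnW.
by exists P => //; apply: dvdp_trans dc.
Qed.

(** The product runs over all irreducible polynomials of bounded degree and not over the
factors of [c], so that the index set stays the same in the induction on [c]. *)
Lemma prod_factorization (A : comNzRingType) (h : {poly F} -> A) c m : c != 0 ->
  (size c <= m)%N ->
  (forall a : F, a != 0 -> h a%:P = 1) ->
  (forall c c', c != 0 -> c' != 0 -> h (c * c') = h c * h c') ->
  h c = \prod_(P : {poly_m F} | ((P : {poly F}) \is monic) && irreducibleb (P : {poly F}))
          h P ^+ multiplicity P c.
Proof.
move=> + + h1 hM; move: {2}(size c) (leqnn (size c)) => k.
elim: k c => [|k IH] c.
  by rewrite leqn0 size_poly_eq0 => ->.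
move=> sc c0 scm; have [c1|c1] := leqP (size c) 1.
  rewrite (size1_polyC c1) h1; last by rewrite -polyC_eq0 -size1_polyC.
  rewrite big1 // => P /andP[mP /irreducibleP irrP].
  rewrite multiplicity_eq0 ?expr0 -?size1_polyC //.
  apply/negP => /(dvdp_leq c0) /leq_trans/(_ c1).
  by rewrite leqNgt; case: irrP => ->.
have [P hP /dvdpP[c' Ec]] := monic_irreducible_factor c1.
have P0 : P != 0 by apply/irredp_neq0/hP.1.
have c'0 : c' != 0 by apply: contraNneq c0 => c'0; rewrite Ec c'0 mul0r.
have sP : (1 < size P)%N by case: hP.1.
have sc' : (size c' < size c)%N.
  rewrite Ec size_mul // -(prednK (ltnW sP)) addnS /=.
  by rewrite -[X in (X < _)%N]addn0 ltn_add2l -subn1 subn_gt0.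
have sPm : (size P <= m)%N by apply: leq_trans scm; apply: dvdp_leq => //; rewrite Ec dvdp_mull.
rewrite Ec mulrC hM // (IH c') //; last 2 first.
- by rewrite -ltnS; apply: leq_trans sc.
- by apply: leq_trans scm; apply: ltnW.
rewrite [RHS](eq_bigr (fun P' : {poly_m F} => h P' ^+ (P' == P :> {poly F}) * h P' ^+ multiplicity P' c')).
  rewrite big_split /=; congr (_ * _).
  rewrite (bigD1 (NPoly (sPm : P \is a poly_of_size m))) /= ?eqxx; last first.
    by rewrite hP.2; apply/irreducibleP/hP.1.
  rewrite expr1 big1 ?mulr1 // => P' /andP[_ nP].
  suff /negPf-> : (P' : {poly F}) != P by rewrite expr0.
  by apply: contra nP => /eqP EP; apply/eqP/val_inj.
move=> P' /andP[mP' /irreducibleP irrP']; rewrite multiplicityM //.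
by rewrite exprD.
Qed.

End Factorization.

(** * The residue symbol as a power of a resultant *)

Section Symbol.
Variables (F : finFieldType) (K : closedFieldType) (iota : {rmorphism F -> K}).
Variable n : nat.
Hypotheses (hn : (0 < n)%N) (hq : #|F| = 1 %[mod n]).
Local Notation q := #|F|.
Local Notation lift := (map_poly iota).
Local Notation e := ((q - 1) %/ n)%N.

Lemma card_gt1 : (1 < q)%N.
Proof. exact: finNzRing_gt1. Qed.

Lemma mule_n : (e * n)%N = (q - 1)%N.
Proof.
by rewrite divnK // -eqn_mod_dvd ?(ltnW card_gt1) //; apply/eqP.
Qed.

Lemma irreducible_dvd_root (P g : {poly F}) x : irreducible_poly P ->
  root (lift P) x -> root (lift g) x -> P %| g.
Proof.
move=> irrP Px gx; apply: contraT; rewrite -irreducible_poly_coprime //.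
by rewrite -(coprimep_map iota) => /coprimep_root-/(_ x Px)/negP[]; apply/eqP/rootP.
Qed.

Lemma irreducible_root_exists (P : {poly F}) : irreducible_poly P ->
  exists x, root (lift P) x.
Proof.
by move=> [sP _]; apply/closed_rootP; rewrite size_map_poly gtn_eqF.
Qed.

Lemma resnorm_irreducible_in (xi P : {poly F}) : monic_irreducible_poly P ->
  exists a, resnorm iota xi P = iota a.
Proof.
move=> hP; have [x Px] := irreducible_root_exists hP.1.
apply: fixed_by_frobenius; rewrite (resnorm_irreducible _ hP Px).
set y := (lift xi).[x]; set D := (size P).-1.
rewrite -exprM mulnC.
have yD : y ^+ (q ^ D) = y.
  by rewrite -horner_frobenius (irreducible_root_card hP Px).
have [->|y0] := eqVneq y 0.
  have D0 : (0 < D)%N by rewrite /D -subn1 subn_gt0; case: hP.1.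
  have S0 : (0 < \sum_(j < D) q ^ j)%N by rewrite -(prednK D0) big_ord_recl expn0.
  by rewrite !expr0n muln_eq0 !gtn_eqF // ltnW ?card_gt1.
apply: (mulIf y0); rewrite -exprSr.
have -> : (q * (\sum_(j < D) q ^ j)).+1 = (\sum_(j < D) q ^ j + q ^ D)%N.
  transitivity (\sum_(j < D.+1) q ^ j)%N; last by rewrite big_ord_recr.
  rewrite big_ord_recl expn0 add1n; congr _.+1.
  by rewrite big_distrr /=; apply: eq_bigr => j _; rewrite -expnS.
by rewrite exprD yD.
Qed.

(** (q^D - 1)/n = (1 + q + ... + q^(D-1)) (q - 1)/n, and raising the value of [xi] at a
root of P to the first factor gives the norm. *)
Lemma residue_symbol_primeE (xi P : {poly F}) : monic_irreducible_poly P ->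
  coprimep xi P -> iota (residue_symbol_prime n xi P) = resnorm iota xi P ^+ e.
Proof.
move=> hP co; have [x Px] := irreducible_root_exists hP.1.
have P0 : P != 0 by apply/irredp_neq0/hP.1.
set D := (size P).-1.
have y0 : (lift xi).[x] != 0.
  have := co; rewrite -(coprimep_map iota) coprimep_sym.
  by move=> /coprimep_root-/(_ x Px).
have [a Ea] := resnorm_irreducible_in xi hP.
have a0 : a != 0.
  by rewrite -(fmorph_eq0 iota) -Ea resnorm_eq0 // co.
have expE : ((q ^ D - 1) %/ n = (\sum_(j < D) q ^ j) * e)%N.
  rewrite [(q ^ D - 1)%N]subn1 predn_exp -subn1 -[in LHS]mule_n mulnAC.
  by rewrite mulnK // mulnC.
have yE : (lift xi).[x] ^+ ((q ^ D - 1) %/ n) = resnorm iota xi P ^+ e.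
  by rewrite (resnorm_irreducible _ hP Px) -exprM expE.
rewrite /residue_symbol_prime; case: pickP => [z /andP[_ /dvdpP[k]]|] /=.
  move/(congr1 (fun g => (lift g).[x])); rewrite rmorphB rmorphM rmorphXn /=.
  rewrite map_polyC /= !hornerE (rootP Px) mulr0 yE => /eqP.
  by rewrite subr_eq0 eq_sym => /eqP.
move/(_ (a ^+ e)); rewrite unity_rootE -exprM mule_n.
have -> : a ^+ (q - 1) == 1.
  by rewrite -(inj_eq (mulfI a0)) mulr1 -exprS subn1 (ltn_predK card_gt1) expf_card.
move/negP => [] /=; apply: (irreducible_dvd_root hP.1 Px).
rewrite rmorphB /= rmorphXn /= map_polyC rootE !hornerE yE Ea /=.
by rewrite (rmorphXn iota) subrr.
Qed.

Lemma exponent_gt0 : (0 < e)%N.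
Proof. by rewrite -(ltn_pmul2r hn) mul0n mule_n subn_gt0 card_gt1. Qed.

(** The normalized resultant is multiplicative in [c], so the case of an irreducible
polynomial suffices.  Both sides vanish when [xi] and [c] have a common root. *)
Lemma residue_symbolE (xi c : {poly F}) : c != 0 ->
  iota (residue_symbol n xi c) = resnorm iota xi c ^+ e.
Proof.
move=> c0; rewrite /residue_symbol; case: ifP => co; last first.
  have /eqP-> : resnorm iota xi c == 0 by rewrite resnorm_eq0 ?co.
  by rewrite raddf0 expr0n gtn_eqF ?exponent_gt0.
rewrite (@prod_factorization _ _ (fun c => resnorm iota xi c ^+ e) c (size c)) //.
- rewrite rmorph_prod [RHS](bigID (fun P : {poly_(size c) F} => (P : {poly F}) %| c)) /=.
  rewrite [X in _ * X]big1 ?mulr1; last first.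
    move=> P /andP[/andP[_ /irreducibleP irr] nP].
    by rewrite multiplicity_eq0.
  apply: eq_big => [P|P /and3P[mP /irreducibleP irrP Pc]]; first by rewrite andbA.
  rewrite rmorphXn /= residue_symbol_primeE //.
  exact: coprimep_dvdl Pc co.
- by move=> a a0; rewrite resnorm_const // expr1n.
- by move=> c1 c2 c10 c20; rewrite resnorm_Mr // exprMn.
Qed.

End Symbol.

Lemma prod_seq_const (A : pzSemiRingType) (I : Type) (s : seq I) (a : A) :
  \prod_(z <- s) a = a ^+ size s.
Proof. by rewrite big_const_seq count_predT iter_mulr_1. Qed.

(** * Reciprocity and the formal properties of the symbol *)

Section SymbolTheory.
Variables (F : finFieldType) (n : nat).
Hypotheses (hn : (0 < n)%N) (hq : #|F| = 1 %[mod n]).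
Local Notation q := #|F|.
Local Notation e := ((q - 1) %/ n)%N.
Local Notation sym := (residue_symbol n).
Implicit Types (xi c : {poly F}).

(** The residue symbol of the constant [a] modulo a polynomial of degree 1. *)
Definition unit_symbol (a : F) : F := a ^+ e.
Local Notation chi := unit_symbol.

(** The symbol takes its values in F, but its description by a resultant involves the roots
of polynomials. *)
Lemma closure_exists : exists K : closedFieldType, inhabited {rmorphism F -> K}.
Proof.
by have [K [f _]] := countable_algebraic_closure F; exists K.
Qed.

Lemma unit_symbolM a b : chi (a * b) = chi a * chi b.
Proof. exact: exprMn. Qed.

Lemma unit_symbol1 : chi 1 = 1.
Proof. exact: expr1n. Qed.

Lemma unit_symbol_eq0 a : (chi a == 0) = (a == 0).
Proof. by rewrite expf_eq0 (exponent_gt0 hn hq). Qed.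

Lemma unit_symbol_unity a : a != 0 -> chi a ^+ n = 1.
Proof.
move=> a0; rewrite -exprM (mule_n hq); apply: (mulfI a0).
by rewrite mulr1 -exprS subn1 (ltn_predK (card_gt1 F)) expf_card.
Qed.

Lemma symbol_eq0 xi c : c != 0 -> (sym xi c == 0) = ~~ coprimep xi c.
Proof.
move=> c0; have [K [iota]] := closure_exists.
rewrite -(fmorph_eq0 iota) (residue_symbolE iota hn hq) // expf_eq0.
by rewrite (exponent_gt0 hn hq) /= resnorm_eq0.
Qed.

Lemma symbol_prime_unity xi P :
  residue_symbol_prime n xi P != 0 -> residue_symbol_prime n xi P ^+ n = 1.
Proof.
rewrite /residue_symbol_prime; case: pickP => [z /andP[/unity_rootP zn _]|_] //=.
by rewrite eqxx.
Qed.

Lemma symbol_unity xi c : sym xi c != 0 -> sym xi c ^+ n = 1.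
Proof.
rewrite /residue_symbol; case: ifP => _; last by rewrite eqxx.
move=> /prodf_neq0 nz; rewrite -prodrXl big1 // => P hP.
have := nz P hP; rewrite expf_eq0 negb_and -exprM mulnC exprM.
case: (multiplicity _ _) => [|m] //= /symbol_prime_unity ->.
by rewrite expr1n.
Qed.

Lemma symbolM xi xi' c : c != 0 -> sym (xi * xi') c = sym xi c * sym xi' c.
Proof.
move=> c0; have [K [iota]] := closure_exists; apply: (fmorph_inj iota).
by rewrite rmorphM /= !(residue_symbolE iota hn hq) // resnormM exprMn.
Qed.

Lemma symbol_mod xi xi' c : c != 0 -> c %| xi - xi' -> sym xi c = sym xi' c.
Proof.
move=> c0 h; have [K [iota]] := closure_exists; apply: (fmorph_inj iota).
by rewrite !(residue_symbolE iota hn hq) // (resnorm_mod iota c0 h).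
Qed.

Lemma symbol_const a c : c != 0 -> sym a%:P c = chi a ^+ (size c).-1.
Proof.
move=> c0; have [K [iota]] := closure_exists; apply: (fmorph_inj iota).
rewrite (residue_symbolE iota hn hq) // !rmorphXn /= exprAC; congr (_ ^+ _).
rewrite -(size_croots iota) // -prod_seq_const; apply: eq_bigr => z _.
by rewrite map_polyC hornerC.
Qed.

Lemma symbol_scaler xi a c : a != 0 -> c != 0 -> sym xi (a *: c) = sym xi c.
Proof.
move=> a0 c0; have [K [iota]] := closure_exists; apply: (fmorph_inj iota).
by rewrite !(residue_symbolE iota hn hq) ?resnorm_scale // scaler_eq0 negb_or a0.
Qed.

(** The resultant is a product of differences of roots of [xi] and of [c], hence
antisymmetric up to leading coefficients. *)
Lemma symbol_reciprocity xi c : xi != 0 -> c \is monic ->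
  sym xi c = chi (lead_coef xi) ^+ (size c).-1 *
             chi (-1) ^+ ((size c).-1 * (size xi).-1) * sym c xi.
Proof.
move=> xi0 mc; have c0 := monic_neq0 mc.
have [K [iota]] := closure_exists; apply: (fmorph_inj iota).
rewrite !rmorphM !rmorphXn /= !(residue_symbolE iota hn hq) // -![_ ^+ e ^+ _]exprAC.
rewrite -!exprMn; congr (_ ^+ _); rewrite rmorphN1.
rewrite /resnorm (lift_croots iota xi) (lift_croots iota c) (monicP mc) rmorph1 scale1r.
under eq_bigr => z _ do rewrite hornerZ horner_prod.
rewrite big_split /= -(size_croots iota c0) -(size_croots iota xi0) -mulrA.
congr (_ * _); first by rewrite prod_seq_const.
rewrite exchange_big /= exprM.
rewrite -[X in _ = X * _](_ : \prod_(w <- croots iota xi) (-1) ^+ size (croots iota c) = _).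
  rewrite -big_split /=; apply: eq_bigr => w _; rewrite horner_prod.
  rewrite -[X in X * _](_ : \prod_(w <- croots iota c) (-1) = _).
    by rewrite -big_split /=; apply: eq_bigr => z _; rewrite !hornerXsubC mulN1r opprB.
  by rewrite prod_seq_const.
by rewrite prod_seq_const.
Qed.

End SymbolTheory.

(** * Sums over polynomials of bounded degree *)

Section PolySums.
Variables (F : finFieldType) (V : nmodType).
Implicit Types (G : {poly F} -> V).

Lemma size_monic_sum D (u : {poly_D F}) : size ('X^D + (u : {poly F})) = D.+1.
Proof. by rewrite size_polyDl size_polyXn // ltnS size_npoly. Qed.

Lemma monic_monic_sum D (u : {poly_D F}) : 'X^D + (u : {poly F}) \is monic.
Proof.
by rewrite monicE lead_coefDl ?lead_coefXn // size_polyXn ltnS size_npoly.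
Qed.

Lemma sum_npoly_cast m k G : m = k ->
  \sum_(x : {poly_m F}) G x = \sum_(x : {poly_k F}) G x.
Proof. by move=> ->. Qed.

Lemma reindex_npoly m (f : {poly F} -> {poly F}) G :
  (forall x : {poly F}, (size x <= m)%N -> (size (f x) <= m)%N) ->
  (forall x y : {poly F}, (size x <= m)%N -> (size y <= m)%N -> f x = f y -> x = y) ->
  \sum_(x : {poly_m F}) G x = \sum_(x : {poly_m F}) G (f x).
Proof.
move=> sf injf; rewrite (reindex_inj (h := fun x : {poly_m F} => npolyp m (f x))).
  by apply: eq_bigr => x _; rewrite npolypK // sf // size_npoly.
move=> x y /(congr1 val) /=; rewrite !npolypK ?sf ?size_npoly // => /injf Exy.
by apply/val_inj/Exy; apply: size_npoly.
Qed.

Lemma size_addXn m (a : F) (u : {poly F}) : (size u <= m)%N ->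
  (size (a *: 'X^m + u)%R <= m.+1)%N.
Proof.
move=> su; rewrite (leq_trans (size_polyD _ _)) // geq_max.
by rewrite (leq_trans (size_scale_leq _ _)) ?size_polyXn //= leqW.
Qed.

Lemma sum_npolyS m G : \sum_(x : {poly_m.+1 F}) G x =
  \sum_(a : F) \sum_(u : {poly_m F}) G (a *: 'X^m + u).
Proof.
rewrite pair_big /=.
pose h (au : F * {poly_m F}) : {poly_m.+1 F} := npolyp m.+1 (au.1 *: 'X^m + au.2).
pose h' (x : {poly_m.+1 F}) : F * {poly_m F} := (x`_m, npolyp m x).
have hE au : h au = au.1 *: 'X^m + au.2 :> {poly F}.
  by rewrite npolypK // size_addXn // size_npoly.
rewrite (reindex h); first by apply: eq_bigr => au _; rewrite hE.
exists h' => [[a u] _|x _].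
  rewrite /h' hE; congr (_, _).
    by rewrite coefD coefZ coefXn eqxx mulr1 nth_default ?addr0 ?size_npoly.
  apply/val_inj/polyP => i; rewrite coef_npolyp coefD coefZ coefXn.
  case: ltnP => im; first by rewrite ltn_eqF // mulr0 add0r.
  by rewrite nth_default // (leq_trans (size_npoly _)).
apply/val_inj/polyP => i; rewrite [val (h _)]hE coefD coefZ coefXn coef_npolyp /=.
case: ltngtP => im; rewrite ?mulr0 ?add0r ?addr0 ?mulr1 ?im //.
by rewrite nth_default // (leq_trans (size_npoly _)).
Qed.

Lemma sum_leading_unit m (a : F) G : a != 0 ->
  \sum_(u : {poly_m F}) G (a *: 'X^m + u) = \sum_(u : {poly_m F}) G (a *: ('X^m + u)).
Proof.
move=> a0; rewrite (@reindex_npoly m (fun u => a *: u) (fun u => G (a *: 'X^m + u))).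
- by apply: eq_bigr => u _; rewrite scalerDr.
- by move=> x sx; rewrite size_scale.
- by move=> x y _ _; apply: scalerI.
Qed.

Lemma sum_npoly_by_degree D G : \sum_(x : {poly_D F} | (x : {poly F}) != 0) G x =
  \sum_(e < D) \sum_(a : F | a != 0) \sum_(v : {poly_e F}) G (a *: ('X^e + v)).
Proof.
elim: D => [|D IH].
  rewrite big_ord0 big1 // => x; rewrite -size_poly_leq0 => /negP[].
  exact: size_npoly.
rewrite big_ord_recr /= -IH big_mkcond.
rewrite (sum_npolyS _ (fun x => if x != 0 then G x else 0)) (bigD1 0) //=.
congr (_ + _).
  by rewrite [RHS]big_mkcond; apply: eq_bigr => x _; rewrite scale0r add0r.
apply: eq_bigr => a a0; rewrite (sum_leading_unit _ (fun x => if x != 0 then G x else 0) a0).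
apply: eq_bigr => u _; rewrite ifT // scaler_eq0 negb_or a0 /=.
rewrite -size_poly_eq0 size_polyDl ?size_polyXn //.
by rewrite ltnS size_npoly.
Qed.

(** Euclidean division by [xi] splits the polynomials of degree < k + e into pairs. *)
Lemma sum_npoly_divmod (xi : {poly F}) e k G : size xi = e.+1 ->
  \sum_(x : {poly_(k + e) F}) G x =
  \sum_(w : {poly_k F}) \sum_(v : {poly_e F}) G ((v : {poly F}) + xi * (w : {poly F})).
Proof.
move=> sxi; have xi0 : xi != 0 by rewrite -size_poly_eq0 sxi.
rewrite pair_big /=.
have sz (wv : {poly_k F} * {poly_e F}) : (size ((wv.2 : {poly F}) + xi * (wv.1 : {poly F}))%R <= k + e)%N.
  rewrite (leq_trans (size_polyD _ _)) // geq_max.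
  rewrite (leq_trans (size_npoly _)) ?leq_addl //=.
  have [->|w0] := eqVneq (wv.1 : {poly F}) 0; first by rewrite mulr0 size_poly0.
  by rewrite size_mul // sxi /= addnC leq_add2r size_npoly.
pose h wv : {poly_(k + e) F} := NPoly (sz wv : _ \is a poly_of_size _).
pose h' (x : {poly_(k + e) F}) := (npolyp k (x %/ xi), npolyp e (x %% xi)).
have sv (v : {poly_e F}) : (size v < size xi)%N by rewrite sxi ltnS size_npoly.
rewrite (reindex h) //; exists h' => [[w v] _|x _].
  rewrite /h' /=; congr (_, _); apply/val_inj => /=.
    by rewrite divpD mulrC mulpK // divp_small ?sv // add0r npolypK ?size_npoly.
  by rewrite modpD mulrC modp_mull addr0 modp_small ?sv // npolypK ?size_npoly.
have s1 : (size ((x : {poly F}) %/ xi)%R <= k)%N.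
  rewrite size_divp // sxi /= leq_subLR.
  by apply: leq_trans (size_npoly x) _; rewrite addnC.
have s2 : (size ((x : {poly F}) %% xi)%R <= e)%N by rewrite -ltnS -sxi ltn_modp.
by apply/val_inj => /=; rewrite !npolypK // addrC mulrC -divp_eq.
Qed.

Lemma small_congruent_eq (c x y : {poly F}) : (size x < size c)%N ->
  (size y < size c)%N -> c %| x - y -> x = y.
Proof.
move=> sx sy h; apply/eqP; rewrite -subr_eq0; apply: contraLR h => xy0.
apply/negP => /(dvdp_leq xy0); rewrite leqNgt => /negP[].
by rewrite (leq_ltn_trans (size_polyD _ _)) // size_polyN gtn_max sx.
Qed.

(** As u varies, 'X^(k + e) + u meets every class modulo [xi] q^k times, and the
multiplication by [h] permutes the classes. *)
Lemma sum_equidistributed (h xi : {poly F}) e k G : size xi = e.+1 ->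
  coprimep h xi -> (forall x y, xi %| x - y -> G x = G y) ->
  \sum_(u : {poly_(k + e) F}) G (h * ('X^(k + e) + u)) =
  (\sum_(y : {poly_e F}) G y) *+ (#|F| ^ k).
Proof.
move=> sxi co Gper; have xi0 : xi != 0 by rewrite -size_poly_eq0 sxi.
rewrite (sum_npoly_divmod k (fun u => G (h * ('X^(k + e) + u))) sxi).
rewrite -card_npoly -sumr_const; apply: eq_bigr => w _.
rewrite (@reindex_npoly _ (fun v => (h * ('X^(k + e) + v)) %% xi) G).
- apply: eq_bigr => v _; apply: Gper.
  rewrite addrA mulrDr; set A := h * _; rewrite addrAC {1}(divp_eq A xi) addrK.
  by apply: dvdp_add; [exact: dvdp_mulIr | apply/dvdp_mull/dvdp_mulIl].
- by move=> x _; rewrite -ltnS -sxi ltn_modp.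
move=> x y sx sy /eqP; rewrite -subr_eq0 -modpN -modpD => /eqP; rewrite -mulrBr.
rewrite opprD addrACA subrr add0r => /modp_eq0P.
rewrite Gauss_dvdpr; last by rewrite coprimep_sym.
by apply: small_congruent_eq; rewrite sxi ltnS.
Qed.

Lemma sum_monic_by_degree D G :
  \sum_(h : {poly_D F} | (h : {poly F}) \is monic) G h =
  \sum_(k < D) \sum_(w : {poly_k F}) G ('X^k + (w : {poly F})).
Proof.
transitivity (\sum_(h : {poly_D F} | (h : {poly F}) != 0)
    (if (h : {poly F}) \is monic then G h else 0)).
  rewrite -big_mkcondr; apply: eq_bigl => h.
  by case mh : (_ \is monic); rewrite ?andbF ?monic_neq0.
rewrite (sum_npoly_by_degree _ (fun h => if h \is monic then G h else 0)).
apply: eq_bigr => k _; rewrite (bigD1 1) ?oner_neq0 //= [X in _ + X]big1 ?addr0.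
  apply: eq_bigr => w _; rewrite scale1r ifT // monicE lead_coefDl ?lead_coefXn //.
  by rewrite size_polyXn ltnS size_npoly.
move=> a /andP[_ a1]; apply: big1 => w _; rewrite ifF //; apply: contraNF a1.
rewrite monicE lead_coefZ lead_coefDl ?lead_coefXn ?mulr1 //.
by rewrite size_polyXn ltnS size_npoly.
Qed.

Lemma size_monic_subXn k (c : {poly F}) : c \is monic -> size c = k.+1 ->
  (size (c - 'X^k)%R <= k)%N.
Proof.
move=> mc sc; apply/leq_sizeP => j; rewrite leq_eqVlt => /orP[/eqP<-|kj].
  by rewrite coefB coefXn eqxx -[k]/(k.+1.-1) -sc -lead_coefE (monicP mc) subrr.
by rewrite coefB coefXn gtn_eqF // nth_default ?subr0 // sc.
Qed.

Lemma sum_monic_multiples (h : {poly F}) k m G : h \is monic -> size h = k.+1 ->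
  \sum_(u : {poly_(k + m) F} | h %| 'X^(k + m) + (u : {poly F})) G ('X^(k + m) + (u : {poly F})) =
  \sum_(w : {poly_m F}) G (h * ('X^m + (w : {poly F}))).
Proof.
move=> mh sh.
pose f (w : {poly_m F}) : {poly_(k + m) F} := npolyp _ (h * ('X^m + (w : {poly F})) - 'X^(k + m))%R.
pose f' (u : {poly_(k + m) F}) : {poly_m F} := npolyp _ (('X^(k + m) + (u : {poly F})) %/ h - 'X^m)%R.
have fE (w : {poly_m F}) : 'X^(k + m) + (f w : {poly F}) = h * ('X^m + (w : {poly F})).
  rewrite /f npolypK; first by rewrite addrC subrK.
  apply: size_monic_subXn; first by rewrite monicMl ?monic_monic_sum.
  by rewrite size_monicM // ?monic_neq0 ?monic_monic_sum // size_monic_sum sh addSn /= addnS.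
have f'E (u : {poly_(k + m) F}) : h %| 'X^(k + m) + (u : {poly F}) ->
    h * ('X^m + (f' u : {poly F})) = 'X^(k + m) + (u : {poly F}).
  move=> hu; rewrite /f' npolypK; first by rewrite addrC subrK mulrC divpK.
  have E := divpK hu; apply: size_monic_subXn.
    by rewrite -(monicMr _ mh) E monic_monic_sum.
  by rewrite size_divp ?monic_neq0 ?monic_monic_sum // size_monic_sum sh /= -addnS addKn.
rewrite (reindex_onto f f'); last first.
  move=> u hu; apply/val_inj/(addrI 'X^(k + m)).
  by rewrite fE f'E.
apply: eq_big => [w|w _]; last by rewrite fE.
rewrite fE dvdp_mulIl /=; apply/eqP/val_inj/(addrI 'X^m)/(mulfI (monic_neq0 mh)).
by rewrite f'E fE ?dvdp_mulIl.
Qed.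

Lemma sum_small_multiples (h : {poly F}) k m G : size h = k.+1 ->
  \sum_(x : {poly_(k + m) F} | h %| (x : {poly F})) G x =
  \sum_(y : {poly_m F}) G (h * (y : {poly F})).
Proof.
move=> sh; have h0 : h != 0 by rewrite -size_poly_eq0 sh.
pose f (w : {poly_m F}) : {poly_(k + m) F} := npolyp _ (h * (w : {poly F}))%R.
pose f' (x : {poly_(k + m) F}) : {poly_m F} := npolyp _ ((x : {poly F}) %/ h)%R.
have fE (w : {poly_m F}) : f w = h * (w : {poly F}) :> {poly F}.
  rewrite /f npolypK //; have [->|w0] := eqVneq (w : {poly F}) 0.
    by rewrite mulr0 size_poly0.
  by rewrite size_mul // sh /= leq_add2l size_npoly.
have f'E (x : {poly_(k + m) F}) : f' x = (x : {poly F}) %/ h :> {poly F}.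
  by rewrite /f' npolypK // size_divp // sh /= leq_subLR size_npoly.
rewrite (reindex_onto f f'); last first.
  by move=> x hx; apply/val_inj; rewrite [val _]fE f'E mulrC divpK.
apply: eq_big => [w|w _]; last by rewrite fE.
by rewrite fE dvdp_mulIl /=; apply/eqP/val_inj; rewrite [val _]f'E fE mulrC mulpK.
Qed.

End PolySums.

(** * Residues at infinity and inverses modulo a polynomial *)

Section Residue.
Variable F : fieldType.
Implicit Types f g c d : {poly F}.

(** The coefficient of 1/x in the expansion of f/c at infinity. *)
Definition pres f c : F := (('X * f) %/ c)`_0.

Lemma presD f g c : pres (f + g) c = pres f c + pres g c.
Proof. by rewrite /pres mulrDr divpD coefD. Qed.

Lemma presN f c : pres (- f) c = - pres f c.
Proof. by rewrite /pres mulrN divpN coefN. Qed.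

Lemma presB f g c : pres (f - g) c = pres f c - pres g c.
Proof. by rewrite presD presN. Qed.

Lemma presZ a f c : pres (a *: f) c = a * pres f c.
Proof. by rewrite /pres -scalerAr divpZl coefZ. Qed.

Lemma pres_scaler a f c : a != 0 -> pres f (a *: c) = pres (a^-1 *: f) c.
Proof. by move=> a0; rewrite presZ /pres divpZr // coefZ. Qed.

Lemma pres_small f c : (size f < (size c).-1)%N -> pres f c = 0.
Proof.
move=> sf; rewrite /pres divp_small ?coef0 //; have [->|f0] := eqVneq f 0.
  by rewrite mulr0 size_poly0; case: (size c) sf.
by rewrite mulrC size_mulX //; case: (size c) sf.
Qed.

Lemma pres_frac f c d : c != 0 -> d != 0 -> pres (f * d) (c * d) = pres f c.
Proof. by move=> c0 d0; rewrite /pres mulrA divp_pmul2r. Qed.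

Lemma pres_dvd f c : c != 0 -> c %| f -> pres f c = 0.
Proof.
by move=> c0 /dvdpP[k ->]; rewrite /pres mulrA mulpK // coef0M coefX mul0r.
Qed.

Lemma pres_mod f g c : c != 0 -> c %| f - g -> pres f c = pres g c.
Proof. by move=> c0 h; apply/eqP; rewrite -subr_eq0 -presB pres_dvd. Qed.

Lemma pres_addfrac f c g d : c != 0 -> d != 0 ->
  pres f c + pres g d = pres (f * d + g * c) (c * d).
Proof. by move=> c0 d0; rewrite presD pres_frac // [c * d]mulrC pres_frac. Qed.

Lemma pres_top f c D : size c = D.+2 -> (size f <= D.+1)%N ->
  pres f c = f`_D / lead_coef c.
Proof.
move=> sc sf; have c0 : c != 0 by rewrite -size_poly_eq0 sc.
have lc0 : lead_coef c != 0 by rewrite lead_coef_eq0.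
pose t := f`_D / lead_coef c; pose z := 'X * f - t *: c.
have -> : pres f c = ((t%:P * c + z) %/ c)`_0 by rewrite mul_polyC /z addrC subrK.
rewrite divp_addl_mul_small ?coefC // sc ltnS.
apply/leq_sizeP => j; rewrite leq_eqVlt => /orP[/eqP<-|Dj].
  rewrite coefB coefXM coefZ /= -[X in t * c`_X]/(D.+2.-1) -sc -lead_coefE.
  by rewrite /t divfK // subrr.
rewrite coefB coefXM coefZ; case: j Dj => // j Dj /=.
by rewrite !nth_default ?mulr0 ?subr0 ?sc // (leq_trans sf).
Qed.

End Residue.

Section ModInverse.
Variable F : finFieldType.
Implicit Types x y c : {poly F}.

(** The inverse of [x] modulo [c] of degree less than that of [c].  Taking the reduced
representative makes it an involution of the reduced units. *)
Definition pinv c x : {poly F} :=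
  if [pick y : {poly_(size c).-1 F} | c %| x * y - 1] is Some y then y else 0.

Lemma size_pinv c x : (size (pinv c x) <= (size c).-1)%N.
Proof. by rewrite /pinv; case: pickP => [y _|_]; rewrite ?size_npoly ?size_poly0. Qed.

Lemma pinvP c x : c != 0 -> coprimep x c -> c %| x * pinv c x - 1.
Proof.
move=> c0 /Bezout_eq1_coprimepP[[u v] /= uv]; rewrite /pinv; case: pickP => //.
have sy : (size (u %% c)%R <= (size c).-1)%N.
  by rewrite -ltnS prednK ?size_poly_gt0 // ltn_modp.
move/(_ (NPoly (sy : _ \is a poly_of_size _))) => /=/negP[].
have := divp_eq u c; set d := u %/ c; set r := u %% c => Eu.
apply/dvdpP; exists (- (d * x + v)); rewrite -uv [in LHS]Eu; ring.
Qed.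

Lemma coprimep_pinv c x : c != 0 -> coprimep x c -> coprimep (pinv c x) c.
Proof.
move=> c0 /(pinvP c0) /dvdpP[k E]; apply/Bezout_eq1_coprimepP.
by exists (x, - k); rewrite mulNr -E opprB addrC subrK.
Qed.

Lemma coprimep_congr c x y : c %| x - y -> coprimep x c = coprimep y c.
Proof.
move=> xy; rewrite -(coprimep_modl x) -(coprimep_modl y).
suff -> : x %% c = y %% c by [].
apply/eqP; rewrite -subr_eq0 -modpN -modpD; exact/eqP/modp_eq0P.
Qed.

Lemma pinv_unique c x y : c != 0 -> (size y <= (size c).-1)%N ->
  c %| x * y - 1 -> pinv c x = y.
Proof.
move=> c0 sy xy; have lt1 z : (size z <= (size c).-1)%N -> (size z < size c)%N.
  by rewrite -ltnS prednK // size_poly_gt0.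
have co : coprimep x c.
  case/dvdpP: xy => k E; apply/Bezout_eq1_coprimepP.
  by exists (y, - k); rewrite mulNr -E opprB mulrC addrC subrK.
have coc : coprimep c x by rewrite coprimep_sym.
apply: (@small_congruent_eq F c); rewrite ?lt1 ?size_pinv //.
rewrite -(Gauss_dvdpr _ coc) mulrBr.
have -> : x * pinv c x - x * y = (x * pinv c x - 1) - (x * y - 1) by ring.
by rewrite dvdp_sub ?pinvP.
Qed.

Lemma pinvK c x : c != 0 -> coprimep x c -> (size x <= (size c).-1)%N ->
  pinv c (pinv c x) = x.
Proof. by move=> c0 co sx; apply: pinv_unique; rewrite // mulrC pinvP. Qed.

Lemma pinv_mod c x y : c != 0 -> coprimep y c -> c %| x - y ->
  pinv c x = pinv c y.
Proof.
move=> c0 co xy; apply: pinv_unique; rewrite ?size_pinv //.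
have -> : x * pinv c y - 1 = (x - y) * pinv c y + (y * pinv c y - 1) by ring.
by rewrite dvdp_add ?pinvP ?dvdp_mulr.
Qed.

Lemma sum_pinv (V : nmodType) c (G : {poly F} -> V) : c != 0 ->
  \sum_(x : {poly_(size c).-1 F} | coprimep x c) G (pinv c x) =
  \sum_(x : {poly_(size c).-1 F} | coprimep x c) G x.
Proof.
move=> c0; pose h (x : {poly_(size c).-1 F}) : {poly_(size c).-1 F} :=
  npolyp _ (pinv c x).
have hE (x : {poly_(size c).-1 F}) : h x = pinv c x :> {poly F} by rewrite npolypK // size_pinv.
rewrite [RHS](reindex_onto h h) => [|x co].
  apply: eq_big => [x|x _]; last by rewrite hE.
  rewrite hE; apply/idP/andP => [co|[co /eqP hx]].
    split; first exact: coprimep_pinv.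
    by apply/eqP/val_inj; rewrite [val _]hE hE pinvK // size_npoly.
  by rewrite -hx hE coprimep_pinv // hE.
by apply/val_inj; rewrite [val _]hE hE pinvK // size_npoly.
Qed.

End ModInverse.

(** * Moebius transformations of polynomials *)

Section Moebius.
Variable F : fieldType.
Variables al be ga de : F.
Local Notation "f %:F" := (FracField.tofrac f).
Implicit Types (f h : {poly F}).

Definition mnum : {poly F} := al *: 'X + be%:P.
Definition mden : {poly F} := ga *: 'X + de%:P.

(** The value at (mnum, mden) of the binary form of degree N with dehomogenization f;
that is, mden^N f(mnum / mden) when deg f <= N. *)
Definition htr N f : {poly F} :=
  \sum_(j < N.+1) f`_j *: (mnum ^+ j * mden ^+ (N - j)).

Lemma htrD N f h : htr N (f + h) = htr N f + htr N h.
Proof. by rewrite /htr -big_split; apply: eq_bigr => j _; rewrite coefD scalerDl. Qed.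

Lemma htrZ N a f : htr N (a *: f) = a *: htr N f.
Proof. by rewrite /htr scaler_sumr; apply: eq_bigr => j _; rewrite coefZ scalerA. Qed.

Lemma htrB N f h : htr N (f - h) = htr N f - htr N h.
Proof. by rewrite htrD -scaleN1r htrZ scaleN1r. Qed.

Lemma size_mden : (size mden <= 2)%N.
Proof.
rewrite (leq_trans (size_polyD _ _)) // geq_max (leq_trans (size_scale_leq _ _)) ?size_polyX //.
by rewrite (leq_trans (size_polyC_leq1 _)).
Qed.

(** The leading coefficients multiply even when some of them are 0, as the degree is counted
formally. *)
Lemma coef_linear_prod (s : seq (F * F)) :
  (\prod_(z <- s) (z.1 *: 'X + z.2%:P))`_(size s) = \prod_(z <- s) z.1 /\
  (size (\prod_(z <- s) (z.1 *: 'X + z.2%:P))%R <= (size s).+1)%N.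
Proof.
elim: s => [|[a b] s [IH1 IH2]] /=; first by rewrite !big_nil coef1 size_poly1.
rewrite !big_cons /=; split.
  by rewrite mulrDl coefD -scalerAl coefZ coefXM /= IH1 coefCM [_`_(size s).+1]nth_default // mulr0 addr0.
rewrite mulrDl (leq_trans (size_polyD _ _)) // geq_max; apply/andP; split.
  rewrite -scalerAl (leq_trans (size_scale_leq _ _)) // (leq_trans (size_polyMleq _ _)) //.
  by rewrite size_polyX.
rewrite mul_polyC (leq_trans (size_scale_leq _ _)) //; exact: leqW.
Qed.

Lemma htr_term N (j : 'I_N.+1) :
  mnum ^+ j * mden ^+ (N - j) =
  \prod_(z <- nseq j (al, be) ++ nseq (N - j) (ga, de)) (z.1 *: 'X + z.2%:P).
Proof. by rewrite big_cat !big_nseq !iter_mulr_1. Qed.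

Lemma size_htr N f : (size (htr N f) <= N.+1)%N.
Proof.
rewrite /htr; apply: (leq_trans (size_sum _ _ _)); apply/bigmax_leqP => j _.
rewrite (leq_trans (size_scale_leq _ _)) // htr_term.
apply: leq_trans (coef_linear_prod _).2 _.
by rewrite size_cat !size_nseq subnKC // -ltnS.
Qed.

Lemma coef_htr_top N f : (htr N f)`_N = \sum_(j < N.+1) f`_j * (al ^+ j * ga ^+ (N - j)).
Proof.
rewrite /htr coef_sum; apply: eq_bigr => j _; rewrite coefZ; congr (_ * _).
have := (coef_linear_prod (nseq j (al, be) ++ nseq (N - j) (ga, de))).1.
rewrite -htr_term size_cat !size_nseq subnKC; last by rewrite -ltnS.
by move=> ->; rewrite big_cat !big_nseq !iter_mulr_1.
Qed.

Lemma coef_htr_top_affine N f : ga = 0 -> (htr N f)`_N = f`_N * al ^+ N.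
Proof.
move=> ga0; rewrite coef_htr_top big_ord_recr /= subnn mulr1 big1 ?add0r // => j _.
by rewrite ga0 expr0n subn_eq0 leqNgt ltn_ord !mulr0.
Qed.

(** Stated for an arbitrary morphism into a field, because it is used both for the fractions
and for compositions of substitutions. *)
Lemma htr_morph (A : fieldType) (phi : {rmorphism {poly F} -> A}) N f :
  phi mden != 0 -> (size f <= N.+1)%N ->
  phi (htr N f) = phi mden ^+ N * (map_poly (phi \o polyC) f).[phi mnum / phi mden].
Proof.
move=> J0 sf; rewrite (horner_coef_wide _ (leq_trans (size_poly _ _) sf)).
rewrite rmorph_sum mulr_sumr; apply: eq_bigr => j _.
rewrite coef_map_id0 /=; last by rewrite polyC0 rmorph0.
rewrite -mul_polyC !rmorphM !rmorphXn /= expr_div_n.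
have jN : (j <= N)%N by rewrite -ltnS.
have J0' := expf_neq0 j J0.
have -> : phi mden ^+ N = phi mden ^+ (N - j) * phi mden ^+ j by rewrite -exprD subnK.
move: (phi mden ^+ j) J0' (phi mden ^+ (N - j)) (phi mnum ^+ j) (phi _) => x x0 y z c.
by field.
Qed.

Hypothesis Delta0 : al * de - be * ga != 0.
Local Notation Delta := (al * de - be * ga).

Lemma mden_neq0 : mden != 0.
Proof.
apply: contra Delta0 => /eqP E.
have ga0 : ga = 0.
  have := congr1 (fun p : {poly F} => p`_1) E.
  by rewrite coef0 /mden coefD coefZ coefX coefC /= mulr1 addr0.
have de0 : de = 0.
  have := congr1 (fun p : {poly F} => p`_0) E.
  by rewrite coef0 /mden coefD coefZ coefX coefC /= mulr0 add0r.
by rewrite ga0 de0 !mulr0 subrr.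
Qed.

Lemma tofrac_mden_neq0 : mden%:F != 0.
Proof. by rewrite tofrac_eq0 mden_neq0. Qed.

Lemma htrM N M f h : (size f <= N.+1)%N -> (size h <= M.+1)%N ->
  htr (N + M) (f * h) = htr N f * htr M h.
Proof.
move=> sf sh; apply/eqP; rewrite -tofrac_eq tofracM; apply/eqP.
have J0 := tofrac_mden_neq0.
rewrite !(@htr_morph _ (@FracField.tofrac {poly F})) //; last first.
  by apply: leq_trans (size_polyMleq _ _) _; move: sf sh; lia.
by rewrite rmorphM /= hornerM exprD mulrACA.
Qed.

Lemma htr1 N : htr N 1 = mden ^+ N.
Proof.
rewrite /htr big_ord_recl /= coef1 scale1r mul1r subn0 big1 ?addr0 // => j _.
by rewrite coef1 scale0r.
Qed.

Lemma htr_pad N k f : (size f <= N.+1)%N -> htr (N + k) f = htr N f * mden ^+ k.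
Proof. by move=> sf; rewrite -[f in LHS]mulr1 htrM ?size_poly1 // htr1. Qed.

End Moebius.

(** The matrix (de, -be; -ga, al) is Delta times the inverse matrix, and a form of
degree N is homogeneous of degree N. *)
Lemma htrK (F : fieldType) (al be ga de : F) N (f : {poly F}) :
  al * de - be * ga != 0 -> (size f <= N.+1)%N ->
  htr de (- be) (- ga) al N (htr al be ga de N f) =
  (al * de - be * ga) ^+ N *: f.
Proof.
move=> D0 sf; have D0' : de * al - (- be) * (- ga) != 0 by rewrite mulrNN mulrC.
have [tf tfE] : exists tf : {rmorphism {poly F} -> {fraction {poly F}}},
    forall p, tf p = FracField.tofrac p by exists (@FracField.tofrac {poly F}).
apply/eqP; rewrite -tofrac_eq -!tfE; apply/eqP.
have J0 := tofrac_mden_neq0 D0'; rewrite -tfE in J0.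
set Dt := al * de - be * ga in D0 *.
have EN : al *: mnum de (- be) + be *: mden (- ga) al = Dt *: 'X.
  by rewrite /mnum /mden /Dt -!mul_polyC !rmorphB !rmorphN !rmorphM /=; ring.
have EJ' : ga *: mnum de (- be) + de *: mden (- ga) al = Dt%:P.
  by rewrite /mnum /mden /Dt -!mul_polyC !rmorphB !rmorphN !rmorphM /=; ring.
rewrite (@htr_morph _ de (- be) (- ga) al _ tf) ?size_htr //.
move: (mden (- ga) al) (mnum de (- be)) J0 EJ' EN => J' N' J0 EJ' EN.
pose t := tf N' / tf J'.
pose ev : {rmorphism {poly F} -> {fraction {poly F}}} :=
  (horner_eval t \o map_poly (tf \o polyC)).
have evE p : ev p = (map_poly (tf \o polyC) p).[t] by [].
have evl a b : ev (a *: 'X + b%:P) = tf (a *: N' + b *: J') / tf J'.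
  rewrite evE rmorphD /= map_polyZ /= map_polyX map_polyC /= !hornerE.
  by rewrite [tf (_ + _)]rmorphD -!mul_polyC !(rmorphM tf) mulrDl (mulfK J0).
have evJ : ev (mden ga de) = tf Dt%:P / tf J' by rewrite evl EJ'.
have evN : ev (mnum al be) = tf (Dt *: 'X) / tf J' by rewrite evl EN.
have tD0 : tf Dt%:P != 0 by rewrite tfE tofrac_eq0 polyC_eq0.
have evJ0 : ev (mden ga de) != 0.
  by rewrite evJ; apply: mulf_neq0; [exact: tD0 | rewrite invr_eq0; exact: J0].
rewrite -/t -evE (@htr_morph _ al be ga de _ ev) //.
have -> : ev (mnum al be) / ev (mden ga de) = tf 'X.
  rewrite evJ evN -mul_polyC rmorphM.
  have key (A : fieldType) (x y z : A) : x != 0 -> z != 0 -> x * y / z / (x / z) = y.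
    by move=> x0 z0; field; rewrite x0 z0.
  exact: key tD0 J0.
rewrite mulrA -exprMn evJ [tf J' * _]mulrC (divfK J0).
have -> : (map_poly (ev \o polyC) f).[tf 'X] = tf f.
  rewrite (@eq_map_poly _ _ _ (tf \o polyC)); last first.
    by move=> a; rewrite [LHS]evE map_polyC hornerC.
  rewrite map_poly_comp_id0 ?rmorph0 // horner_map.
  by congr (tf _); rewrite -[RHS]comp_polyXr.
by rewrite -mul_polyC rmorphM polyC_exp rmorphXn.
Qed.

Section MoebiusNorm.
Variables (F : finFieldType) (K : closedFieldType) (iota : {rmorphism F -> K}).
Variables al be ga de : F.
Hypothesis Delta0 : al * de - be * ga != 0.
Local Notation Delta := (al * de - be * ga).
Local Notation J := (mden ga de).
Local Notation htr := (htr al be ga de).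
Local Notation lift := (map_poly iota).

(** A linear form with root z goes to one with root the inverse image of z. *)
Lemma lift_htr_roots D (c : {poly F}) : c \is monic -> size c = D.+1 ->
  lift (htr D c) = \prod_(z <- croots iota c)
     ((iota al - iota ga * z) *: 'X + (iota be - iota de * z)%:P).
Proof.
move=> mc sc; have [tf tfE] : exists tf : {rmorphism {poly K} -> {fraction {poly K}}},
    forall p, tf p = FracField.tofrac p by exists (@FracField.tofrac {poly K}).
apply/eqP; rewrite -tofrac_eq -!tfE; apply/eqP.
pose phi : {rmorphism {poly F} -> {fraction {poly K}}} := (tf \o lift).
have phiE p : phi p = tf (lift p) by [].
have J0 : phi J != 0.
  by rewrite phiE tfE tofrac_eq0 map_poly_eq0 (mden_neq0 Delta0).
rewrite -phiE (@htr_morph _ al be _ _ _ _ _ _ J0) ?sc //.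
have -> : map_poly (phi \o polyC) c = map_poly (tf \o polyC) (lift c).
  apply/polyP => i; rewrite coef_map_id0 /=; last by rewrite !rmorph0.
  rewrite [RHS]coef_map_id0 /=; last by rewrite polyC0 rmorph0.
  by rewrite coef_map map_polyC.
have Dr : D = size (croots iota c) by rewrite size_croots ?monic_neq0 // sc.
rewrite lift_croots (monicP mc) rmorph1 scale1r Dr -prod_seq_const.
rewrite [map_poly _ _](_ : _ = \prod_(z <- croots iota c) ('X - (tf z%:P)%:P)); last first.
  rewrite (_ : map_poly _ _ = map_poly tf (map_poly polyC (\prod_(z <- croots iota c) ('X - z%:P)))).
    by rewrite !rmorph_prod; apply: eq_bigr => z _; rewrite /= !map_polyXsubC.
  by rewrite map_poly_comp_id0 // rmorph0.
rewrite horner_prod -big_split rmorph_prod; apply: eq_bigr => z _.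
rewrite hornerXsubC.
transitivity (phi (mnum al be) - phi J * tf z%:P).
  by rewrite -[LHS]/(phi J * (phi (mnum al be) / phi J - tf z%:P)) mulrBr mulrCA (divff J0) mulr1.
rewrite !phiE -rmorphM -rmorphB; congr (tf _).
rewrite /mnum /mden !rmorphD /= !map_polyZ /= !map_polyX !map_polyC /=.
rewrite -!mul_polyC !rmorphB !rmorphM /=; ring.
Qed.

(** The difference of the images of two points z and w under a Moebius transformation is
z - w times a factor that depends on z and a factor that depends on w. *)
Lemma resnorm_htr D N (c xi : {poly F}) : c \is monic -> size c = D.+1 ->
  size (htr D c) = D.+1 -> (size xi <= N.+1)%N ->
  resnorm iota (htr N xi) (htr D c) =
  iota (Delta ^+ D / lead_coef (htr D c)) ^+ N * resnorm iota xi c.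
Proof.
move=> mc sc sc1 sxi; set c1 := htr D c.
have Dr : D = size (croots iota c) by rewrite size_croots ?monic_neq0 // sc.
have lc1 : iota (lead_coef c1) = \prod_(z <- croots iota c) (iota al - iota ga * z).
  rewrite lead_coefE sc1 /= -coef_map lift_htr_roots //.
  have := (coef_linear_prod [seq (iota al - iota ga * z, iota be - iota de * z) | z <- croots iota c]).1.
  by rewrite !big_map size_map -Dr.
have lc0 : lead_coef c1 != 0 by rewrite lead_coef_eq0 -size_poly_eq0 sc1.
have a0 z : z \in croots iota c -> iota al - iota ga * z != 0.
  move=> zc; apply: contra lc0 => /eqP E; rewrite -(fmorph_eq0 iota) lc1.
  by rewrite prodf_seq_eq0; apply/hasP; exists z; rewrite //= E.
have iD0 : iota Delta != 0 by rewrite fmorph_eq0 Delta0.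
pose w z := (iota de * z - iota be) / (iota al - iota ga * z).
rewrite (@resnorm_eq _ _ _ _ _ (iota (lead_coef c1)) [seq w z | z <- croots iota c]); last 2 first.
- by rewrite fmorph_eq0.
- rewrite lift_htr_roots // lc1 big_map -mul_polyC rmorph_prod -big_split /=.
  apply: eq_big_seq => z zc /=.
  have -> : iota be - iota de * z = - ((iota al - iota ga * z) * w z).
    by rewrite /w mulrCA divff ?a0 // mulr1 opprB.
  by rewrite mulrBr mul_polyC polyCN polyCM.
rewrite big_map /resnorm rmorphM rmorphXn fmorphV lc1 Dr -prod_seq_const -prodfV.
rewrite -big_split /= -prodrXl -big_split /=; apply: eq_big_seq => z zc.
pose phi : {rmorphism {poly F} -> K} := (horner_eval (w z) \o lift).
have phiE p : phi p = (lift p).[w z] by [].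
have az := a0 z zc.
have EJ : phi J = iota Delta / (iota al - iota ga * z).
  rewrite phiE /mden rmorphD /= map_polyZ /= map_polyX map_polyC /= !hornerE /w.
  by rewrite !rmorphB !rmorphM /=; field.
have EN : phi (mnum al be) = z * (iota Delta / (iota al - iota ga * z)).
  rewrite phiE /mnum rmorphD /= map_polyZ /= map_polyX map_polyC /= !hornerE /w.
  by rewrite !rmorphB !rmorphM /=; field.
have J0 : phi J != 0 by rewrite EJ mulf_neq0 ?invr_eq0.
rewrite -phiE (@htr_morph _ al be _ _ _ _ _ _ J0) // EN -EJ mulfK //; congr (_ * _).
by congr (_.[_]); apply: eq_map_poly => x; rewrite [LHS]phiE map_polyC hornerC.
Qed.

End MoebiusNorm.

(** * Gauss sums *)

Section GaussSums.
Variables (F : finFieldType) (n : nat).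
Hypotheses (hn : (0 < n)%N) (hq : #|F| = 1 %[mod n]).
(* [ep] is the character of the n-th roots of 1, extended by 0; [em] is the additive character. *)
Variables (C : fieldType) (ep em : F -> C).
Hypotheses (ep0 : ep 0 = 0) (ep1 : ep 1 = 1).
Hypothesis epM : forall x y, x ^+ n = 1 -> y ^+ n = 1 -> ep (x * y) = ep x * ep y.
Hypothesis ep_inj : forall x, x ^+ n = 1 -> ep x = 1 -> x = 1.
Hypothesis emD : forall a b, em (a + b) = em a * em b.
Local Notation q := #|F|.
Local Notation sym := (residue_symbol n).
Local Notation chi := (unit_symbol n).
Implicit Types (xi r c h : {poly F}).

Definition csym xi c : C := ep (sym xi c).
Definition cunit (a : F) : C := ep (chi a).

Definition gsum r c : C :=
  \sum_(xi : {poly_(size c).-1 F}) csym xi c * em (pres (r * xi) c).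

Lemma ep_unity x : x ^+ n = 1 -> ep x != 0.
Proof.
move=> xn; have x0 : x != 0.
  by apply: contra_eq_neq xn => ->; rewrite expr0n gtn_eqF // eq_sym oner_eq0.
have : ep (x * x^-1) = 1 by rewrite divff.
rewrite epM ?exprVn ?xn ?invr1 // => E; apply: contra_eq_neq E => ->.
by rewrite mul0r eq_sym oner_eq0.
Qed.

Lemma epM0 x y : (x != 0 -> x ^+ n = 1) -> (y != 0 -> y ^+ n = 1) ->
  ep (x * y) = ep x * ep y.
Proof.
have [->|x0] := eqVneq x 0; first by rewrite !mul0r ep0 mul0r.
have [->|y0] := eqVneq y 0; first by rewrite !mulr0 ep0 mulr0.
by move=> /(_ isT) xn /(_ isT) yn; rewrite epM.
Qed.

Lemma cunitM a b : cunit (a * b) = cunit a * cunit b.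
Proof. by rewrite /cunit unit_symbolM epM0 // unit_symbol_eq0 //; apply: unit_symbol_unity. Qed.

Lemma cunit1 : cunit 1 = 1.
Proof. by rewrite /cunit unit_symbol1. Qed.

Lemma cunitX a k : cunit (a ^+ k) = cunit a ^+ k.
Proof. by elim: k => [|k IH]; rewrite ?cunit1 // !exprS cunitM IH. Qed.

Lemma cunit_neq0 a : a != 0 -> cunit a != 0.
Proof. by move=> a0; apply/ep_unity/unit_symbol_unity. Qed.

Lemma cunit_unity a : a != 0 -> cunit a ^+ n = 1.
Proof.
move=> a0; rewrite -cunitX /cunit.
have -> : chi (a ^+ n) = 1; last exact: ep1.
by rewrite /unit_symbol exprAC; apply: unit_symbol_unity.
Qed.

Lemma cunitN1 : cunit (-1) * cunit (-1) = 1.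
Proof. by rewrite -cunitM mulrNN mulr1 cunit1. Qed.

Lemma cunitV a : cunit a^-1 = (cunit a)^-1.
Proof.
have [->|a0] := eqVneq a 0.
  by rewrite /cunit invr0 /unit_symbol expr0n gtn_eqF ?exponent_gt0 //= ep0 invr0.
by apply: (mulfI (cunit_neq0 a0)); rewrite -cunitM !divff ?cunit1 ?cunit_neq0.
Qed.

(** The group of units of F is cyclic, and [ep] is injective on the n-th roots of 1. *)
Lemma cunit_primitive : exists2 a, a != 0 &
  forall k, cunit a ^+ k = 1 -> (n %| k)%N.
Proof.
have /cyclicP[g Eg] := field_unit_group_cyclic [set: {unit F}]%G.
have g0 : FinRing.uval g != 0 by rewrite -unitfE; case: g {Eg}.
have og : #[g]%g = (q - 1)%N by rewrite orderE -Eg card_finField_unit subn1.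
exists (FinRing.uval g) => // k; rewrite -cunitX => /ep_inj.
move=> /(_ (unit_symbol_unity hq (expf_neq0 k g0))).
rewrite /unit_symbol -exprM -FinRing.val_unitX -FinRing.val_unit1 => /val_inj/eqP.
rewrite -order_dvdn og -[X in (X %| _)%N](mule_n hq) mulnC.
by rewrite dvdn_pmul2r // exponent_gt0.
Qed.

Lemma cunit_expr_mod a d e : a != 0 -> d = e %[mod n] -> cunit a ^+ d = cunit a ^+ e.
Proof.
by move=> a0 de; rewrite -(expr_mod d (cunit_unity a0)) de expr_mod ?cunit_unity.
Qed.

Lemma cunit_orthogonality d e :
  \sum_(a : F | a != 0) (cunit a ^+ d)^-1 * cunit a ^+ e =
  if d == e %[mod n] then (q - 1)%:R else 0.
Proof.
case: ifP => [/eqP de|nde].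
  rewrite (eq_bigr (fun=> 1)) => [|a a0]; last first.
    by rewrite (cunit_expr_mod a0 de) mulVf // expf_neq0 // cunit_neq0.
  by rewrite sumr_const (cardC1 (0 : F)) subn1.
have [b b0 bP] := cunit_primitive.
set S := \sum_(a | _) _.
have fb : (cunit b ^+ d)^-1 * cunit b ^+ e != 1.
  apply: contraFneq nde => /(canRL (mulVKf (expf_neq0 d (cunit_neq0 b0)))).
  rewrite mulr1 => E; wlog: d e E {S} / (d <= e)%N => [H|de].
    by have [/H->//|/ltnW/H] := leqP d e; rewrite E // eq_sym => ->.
  rewrite eq_sym eqn_mod_dvd //; apply: bP.
  apply: (mulfI (expf_neq0 d (cunit_neq0 b0))).
  by rewrite -exprD subnKC // mulr1.
have : S = (cunit b ^+ d)^-1 * cunit b ^+ e * S.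
  rewrite /S mulr_sumr (reindex_inj (mulfI b0)) /=.
  apply: eq_big => [a|a _]; first by rewrite mulf_eq0 negb_or b0.
  by rewrite cunitM !exprMn invfM mulrACA.
move=> /eqP; rewrite -subr_eq0 -[X in X - _]mul1r -mulrBl mulf_eq0 subr_eq0 eq_sym.
by rewrite (negPf fb) => /eqP.
Qed.

Lemma csymM xi xi' c : c != 0 -> csym (xi * xi') c = csym xi c * csym xi' c.
Proof. by move=> c0; rewrite /csym symbolM // epM0 //; apply: symbol_unity. Qed.

Lemma csym_mod xi xi' c : c != 0 -> c %| xi - xi' -> csym xi c = csym xi' c.
Proof. by move=> c0 h; rewrite /csym (symbol_mod hn hq c0 h). Qed.

Lemma csym_const a c : c != 0 -> csym a%:P c = cunit a ^+ (size c).-1.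
Proof.
move=> c0; rewrite -cunitX /csym /cunit symbol_const //.
by rewrite /unit_symbol exprAC.
Qed.

Lemma csymZ a xi c : c != 0 -> csym (a *: xi) c = cunit a ^+ (size c).-1 * csym xi c.
Proof. by move=> c0; rewrite -mul_polyC csymM // csym_const. Qed.

Lemma csym1 c : c != 0 -> csym 1 c = 1.
Proof. by move=> c0; rewrite csym_const // cunit1 expr1n. Qed.

Lemma csymX xi c k : c != 0 -> csym (xi ^+ k) c = csym xi c ^+ k.
Proof.
by move=> c0; elim: k => [|k IH]; rewrite ?csym1 // !exprS csymM // IH.
Qed.

Lemma csym_scaler xi a c : a != 0 -> c != 0 -> csym xi (a *: c) = csym xi c.
Proof. by move=> a0 c0; rewrite /csym symbol_scaler. Qed.

Lemma csym_eq0 xi c : c != 0 -> (csym xi c == 0) = ~~ coprimep xi c.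
Proof.
move=> c0; rewrite /csym -(symbol_eq0 hn hq) //; have [->|s0] := eqVneq (sym xi c) 0.
  by rewrite ep0 eqxx.
exact: negbTE (ep_unity (symbol_unity s0)).
Qed.

Lemma csym_reciprocity xi c : xi != 0 -> c \is monic ->
  csym xi c = cunit (lead_coef xi) ^+ (size c).-1 *
             cunit (-1) ^+ ((size c).-1 * (size xi).-1) * csym c xi.
Proof.
move=> xi0 mc; have c0 := monic_neq0 mc; rewrite /csym symbol_reciprocity //.
have unit_pow a k : ep (chi a ^+ k) = cunit a ^+ k.
  by rewrite -cunitX /cunit /unit_symbol exprAC.
have chin (a : F) k : a != 0 -> (chi a ^+ k) ^+ n = 1.
  by move=> a0; rewrite exprAC unit_symbol_unity ?expr1n.
rewrite epM0; first by rewrite epM ?unit_pow ?chin // ?lead_coef_eq0 ?oppr_eq0 ?oner_eq0.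
  by rewrite exprMn !chin ?mulr1 ?lead_coef_eq0 ?oppr_eq0 ?oner_eq0.
exact: symbol_unity.
Qed.

Lemma csym_pinv c x : c != 0 -> coprimep x c -> csym (pinv c x) c = (csym x c)^-1.
Proof.
move=> c0 co; have x0 : csym x c != 0 by rewrite csym_eq0 ?co.
apply: (mulfI x0); rewrite -csymM // divff //.
by rewrite (csym_mod c0 (pinvP c0 co)) csym1.
Qed.

Lemma gsumZl a r c : c != 0 -> a != 0 ->
  gsum r c = cunit a ^+ (size c).-1 * gsum (a *: r) c.
Proof.
move=> c0 a0; rewrite /gsum mulr_sumr.
rewrite (@reindex_npoly _ _ _ (fun xi => a *: xi) (fun xi => csym xi c * em (pres (r * xi) c))).
- by apply: eq_bigr => xi _; rewrite csymZ // -scalerAr scalerAl mulrA.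
- by move=> x sx; rewrite size_scale.
- by move=> x y _ _; apply: scalerI.
Qed.

Lemma gsum_opp r c : c != 0 -> gsum (- r) c = cunit (-1) ^+ (size c).-1 * gsum r c.
Proof.
by move=> c0; rewrite (gsumZl _ c0 (_ : -1 != 0)) ?oppr_eq0 ?oner_eq0 // scaleN1r opprK.
Qed.

(** The symbol does not see the factor [a] of the denominator, and in the additive character
it is absorbed by a change of variable. *)
Lemma gsum_scaler a r c : a != 0 -> c != 0 ->
  gsum r (a *: c) = cunit a ^+ (size c).-1 * gsum r c.
Proof.
move=> a0 c0; rewrite [in RHS](@gsumZl a^-1) ?invr_eq0 // mulrA -exprMn -cunitM.
rewrite divff // cunit1 expr1n mul1r /gsum.
rewrite (@sum_npoly_cast _ _ _ (size c).-1 (fun xi => csym xi (a *: c) * em (pres (r * xi) (a *: c)))) ?size_scale //.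
by apply: eq_bigr => xi _; rewrite csym_scaler // pres_scaler // scalerAl.
Qed.

Lemma gsum_coprime r c : c != 0 -> gsum r c =
  \sum_(xi : {poly_(size c).-1 F} | coprimep xi c) csym xi c * em (pres (r * xi) c).
Proof.
move=> c0; rewrite [RHS]big_mkcond; apply: eq_bigr => xi _; case: ifP => // co.
have /eqP-> : csym xi c == 0 by rewrite csym_eq0 ?co.
by rewrite mul0r.
Qed.

(** The term of the Gauss sum of -r modulo [xi] at the inverse of [c]. *)
Definition dual_term r xi c : C := csym (pinv xi c) xi * em (pres (- r * pinv xi c) xi).

(** Since [xi] times its inverse modulo [c] plus [c] times its inverse modulo [xi] is 1 modulo
c xi, the fractions r xi'/c and -r c'/xi differ by r/(c xi) up to a polynomial.
The degree of r is too small for that fraction to have a term in 1/x. *)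
Lemma additive_reciprocity r xi c : c \is monic -> xi != 0 -> coprimep xi c ->
  ((size r).+1 < size c)%N ->
  csym (pinv c xi) c * em (pres (r * pinv c xi) c) =
  (cunit (lead_coef xi) ^+ (size c).-1)^-1 *
   cunit (-1) ^+ ((size c).-1 * (size xi).-1) * dual_term r xi c.
Proof.
move=> mc xi0 co sr; have c0 := monic_neq0 mc.
have co' : coprimep c xi by rewrite coprimep_sym.
have presE : pres (r * pinv c xi) c = pres (- r * pinv xi c) xi.
  apply/eqP; rewrite mulNr presN -subr_eq0 opprK pres_addfrac //.
  have h : c * xi %| xi * pinv c xi + c * pinv xi c - 1.
    rewrite Gauss_dvdp //; apply/andP; split.
      have -> : xi * pinv c xi + c * pinv xi c - 1 =
        xi * pinv c xi - 1 + c * pinv xi c by ring.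
      by rewrite dvdp_add ?pinvP ?dvdp_mulIl.
    have -> : xi * pinv c xi + c * pinv xi c - 1 =
      c * pinv xi c - 1 + xi * pinv c xi by ring.
    by rewrite dvdp_add ?pinvP ?dvdp_mulIl.
  rewrite (@pres_mod _ _ r) ?mulf_neq0 //.
    rewrite pres_small // size_mul //.
    have : (0 < size xi)%N by rewrite size_poly_gt0.
    case: (size c) sr => [|[|k]] //; case: (size xi) => // j.
    by rewrite addnS addSn /= !ltnS => /leq_trans->; rewrite ?leq_addr.
  have -> : r * pinv c xi * xi + r * pinv xi c * c - r = (xi * pinv c xi + c * pinv xi c - 1) * r by ring.
  exact: dvdp_mulr.
rewrite presE /dual_term mulrA; congr (_ * _).
rewrite !csym_pinv // csym_reciprocity // !invfM; congr (_ * _ * _).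
have N0 : cunit (-1) != 0 by rewrite cunit_neq0 ?oppr_eq0 ?oner_eq0.
by rewrite -exprVn; congr (_ ^+ _); apply: (mulfI N0); rewrite divff // cunitN1.
Qed.

Definition msum h r D : C :=
  \sum_(u : {poly_D F} | coprimep h ('X^D + (u : {poly F}))) gsum r ('X^D + (u : {poly F})).

(** One of e and e + 1 is even, and the symbol of -1 squares to 1. *)
Lemma cunitN1_sign d e : d = e %[mod n] -> cunit (-1) ^+ (d * e + e) = 1.
Proof.
have N0 : -1 != 0 :> F by rewrite oppr_eq0 oner_eq0.
move=> de; rewrite -[X in (_ + X)%N]mul1n -mulnDl.
rewrite (@cunit_expr_mod _ _ ((e + 1) * e) N0); last first.
  by rewrite -modnMml -modnDml de modnDml modnMml.
suff /dvdnP[k ->] : (2 %| (e + 1) * e)%N.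
  by rewrite mulnC exprM expr2 cunitN1 expr1n.
by rewrite dvdn2 oddM oddD addbT; case: (odd e).
Qed.

(** Here the roles are exchanged: [xi] is the modulus, and h ('X^(k + e) + u) is
equidistributed among its residue classes, so that the sum over u is a multiple of a
full Gauss sum modulo [xi]. *)
Lemma dual_sum r xi h e k : h \is monic -> size xi = e.+1 ->
  \sum_(u : {poly_(k + e) F})
    (if coprimep xi (h * ('X^(k + e) + (u : {poly F})))
     then dual_term r xi (h * ('X^(k + e) + (u : {poly F}))) else 0) =
  if coprimep h xi then gsum (- r) xi *+ (q ^ k) else 0.
Proof.
move=> mh sxi; have xi0 : xi != 0 by rewrite -size_poly_eq0 sxi.
case: ifP => [co|nco]; last first.
  apply: big1 => u _; rewrite coprimep_sym coprimepMl nco //.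
pose G y := if coprimep xi y then dual_term r xi y else 0.
rewrite (@sum_equidistributed _ _ h xi e k G) //; last first.
  move=> x y xy; rewrite /G /dual_term ![coprimep xi _]coprimep_sym.
  by rewrite (coprimep_congr xy); case: ifP => // co'; rewrite (pinv_mod xi0 co' xy).
congr (_ *+ _); rewrite gsum_coprime // /G.
rewrite (@sum_npoly_cast _ _ _ (size xi).-1 G); last by rewrite sxi.
rewrite -(@sum_pinv _ _ _ (fun y => csym y xi * em (pres (- r * y) xi))) //.
rewrite [RHS]big_mkcond /=; apply: eq_bigr => y _.
by rewrite /G coprimep_sym.
Qed.

(** Expand each Gauss sum over [xi], replace the terms by their duals modulo [xi], and sum
over the denominators first.  The leading coefficients of [xi] then contribute a
character sum over F^*, which keeps only the degrees e = D + t modulo n.  The bound on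
t ensures e <= D, so that the denominators are equidistributed modulo [xi]. *)
Lemma gauss_sum_reciprocity r h t D : h \is monic -> size h = t.+1 -> (t <= 1)%N ->
  (size r < D + t)%N ->
  \sum_(u : {poly_D F}) gsum r (h * ('X^D + (u : {poly F}))) =
  \sum_(e < D + t | e == D + t %[mod n]) ((q - 1) * q ^ (D - e))%:R * msum h r e.
Proof.
move=> mh sh t1 sr; pose c (u : {poly F}) := h * ('X^D + u).
have mc (u : {poly_D F}) : c u \is monic by rewrite monicMl // monic_monic_sum.
have sc (u : {poly_D F}) : size (c u) = (D + t).+1.
  by rewrite size_monicM // ?monic_neq0 ?monic_monic_sum // size_monic_sum sh addSn /= addnC.
pose kappa xi : C := (cunit (lead_coef xi) ^+ (D + t))^-1 *
   cunit (-1) ^+ ((D + t) * (size xi).-1).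
pose T xi u := if coprimep xi (c u) then dual_term r xi (c u) else 0.
transitivity (\sum_(u : {poly_D F}) \sum_(xi : {poly_(D + t) F} | (xi : {poly F}) != 0)
    kappa xi * T xi u).
  apply: eq_bigr => u _; have c0 := monic_neq0 (mc u).
  rewrite -/(c u) gsum_coprime //.
  rewrite -(@sum_pinv _ _ _ (fun y => csym y (c u) * em (pres (r * y) (c u)))) //.
  rewrite big_mkcond [RHS]big_mkcond /=.
  rewrite (@sum_npoly_cast _ _ _ (D + t) (fun y => if coprimep y (c u) then csym (pinv (c u) y) (c u) * em (pres (r * pinv (c u) y) (c u)) else 0)) ?sc //.
  apply: eq_bigr => xi _; rewrite /T; case: ifP => co; last by rewrite mulr0 if_same.
  have xi0 : (xi : {poly F}) != 0.
    apply: contraTneq co => ->; rewrite coprime0p -size_poly_eq1 sc.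
    by rewrite eqSS -lt0n (leq_ltn_trans _ sr).
  by rewrite xi0 additive_reciprocity ?sc.
rewrite exchange_big /=.
rewrite (sum_npoly_by_degree _ (fun xi => \sum_(u : {poly_D F}) kappa xi * T xi u)).
rewrite [RHS]big_mkcond /=; apply: eq_bigr => e _.
have eD : (e <= D)%N by rewrite -ltnS (leq_trans (ltn_ord e)) // -addn1 leq_add2l.
rewrite exchange_big /= /msum.
transitivity (\sum_(v : {poly_e F}) (if coprimep h ('X^e + (v : {poly F})) then gsum r ('X^e + (v : {poly F})) else 0) *
    (q ^ (D - e))%:R * cunit (-1) ^+ ((D + t) * e + e) *
    \sum_(a : F | a != 0) (cunit a ^+ (D + t))^-1 * cunit a ^+ e).
  apply: eq_bigr => v _; rewrite mulr_sumr; apply: eq_bigr => a a0.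
  set xi := a *: _; have sxi : size xi = e.+1 by rewrite size_scale // size_monic_sum.
  have lxi : lead_coef xi = a by rewrite lead_coefZ (monicP (monic_monic_sum v)) mulr1.
  rewrite -mulr_sumr /kappa sxi lxi /=.
  have := @dual_sum r xi h e (D - e) mh sxi; rewrite subnK // => ->.
  have -> : coprimep h xi = coprimep h ('X^e + (v : {poly F})).
    by rewrite coprimepZr.
  case: ifP => _; last by rewrite !mulr0 !mul0r.
  have v0 : 'X^e + (v : {poly F}) != 0 by rewrite -size_poly_eq0 size_monic_sum.
  rewrite gsum_scaler // gsum_opp // size_monic_sum /= -(mulr_natr _ (q ^ _)) [cunit (-1) ^+ (_ + e)]exprD.
  have comm (a1 a2 a3 a4 a5 a6 : C) :
    a2 * a5 * (a3 * (a4 * a1) * a6) = a1 * a6 * (a5 * a4) * (a2 * a3) by ring.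
  exact: comm.
rewrite cunit_orthogonality eq_sym; case: ifP => [/eqP de|_]; last first.
  by rewrite big1 // => v _; rewrite mulr0.
rewrite (cunitN1_sign (esym de)) [\sum_(u | coprimep _ _) _]big_mkcond mulr_sumr.
apply: eq_bigr => v _; rewrite natrM.
have comm (a1 a2 a3 : C) : a1 * a2 * 1 * a3 = a3 * a2 * a1 by ring.
exact: comm.
Qed.

Definition asum r D : C := \sum_(u : {poly_D F}) gsum r ('X^D + (u : {poly F})).

Lemma asum_sum r D : (size r < D)%N ->
  asum r D = \sum_(e < D | e == D %[mod n]) ((q - 1) * q ^ (D - e))%:R * asum r e.
Proof.
move=> sr.
have := @gauss_sum_reciprocity r 1 0 D (monic1 _) (size_poly1 _) isT.
rewrite addn0 => /(_ sr); under eq_bigr => u _ do rewrite mul1r.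
rewrite -/(asum r D) => ->; apply: eq_bigr => e _; congr (_ * _).
by apply: eq_bigl => u; rewrite coprime1p.
Qed.

(** In the recursion [asum_sum] for D + n, the degrees e < D give q^n times the recursion
for D, and among the degrees from D to D + n - 1 only e = D occurs. *)
Lemma asum_step r D : (size r < D)%N -> asum r (D + n) = (q ^ n.+1)%:R * asum r D.
Proof.
move=> sr; rewrite asum_sum ?ltn_addr // big_mkcond /= big_split_ord /=.
have -> : \sum_(e < D) (if (e : nat) == D + n %[mod n]
      then ((q - 1) * q ^ (D + n - e))%:R * asum r e else 0) = (q ^ n)%:R * asum r D.
  rewrite (asum_sum sr) mulr_sumr [RHS]big_mkcond /=; apply: eq_bigr => e _.
  rewrite modnDr; case: ifP => // _; rewrite mulrA -natrM; congr (_%:R * _).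
  by rewrite mulnCA -expnD addnC addnBA // ltnW.
rewrite (bigD1 (Ordinal hn)) //= big1 => [|j /negPf j0]; last first.
  rewrite ifF // modnDr -{2}[D]addn0 eqn_modDl mod0n modn_small //.
rewrite addn0 modnDr eqxx addr0 addKn -mulrDl -natrD -[X in (X + _)%N]mul1n -mulnDl.
by rewrite subnKC ?expnS // ltnW // card_gt1.
Qed.

Lemma asum_split (a : F) r D :
  asum r D.+1 = msum ('X - a%:P) r D.+1 +
    \sum_(u : {poly_D F}) gsum r (('X - a%:P) * ('X^D + (u : {poly F}))).
Proof.
rewrite /asum (bigID (fun u : {poly_D.+1 F} => coprimep ('X - a%:P) ('X^(D.+1) + (u : {poly F})))) /=.
congr (_ + _).
rewrite -(@sum_monic_multiples _ _ _ 1 D (gsum r)) ?monicXsubC ?size_XsubC //.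
apply: eq_bigl => u; rewrite coprimep_sym coprimep_XsubC negbK.
by rewrite dvdp_XsubCl.
Qed.

(** Reciprocity turns the sum over the multiples of X - a into sums over polynomials that are
prime to it; the coefficients do not depend on a. *)
Lemma asum_from_msum (a : F) r D : (size r <= D)%N ->
  asum r D.+1 = msum ('X - a%:P) r D.+1 +
    \sum_(e < D.+1 | e == D.+1 %[mod n]) ((q - 1) * q ^ (D - e))%:R * msum ('X - a%:P) r e.
Proof.
move=> sr; rewrite (asum_split a); congr (_ + _).
rewrite (@gauss_sum_reciprocity r _ 1) ?monicXsubC ?size_XsubC ?addn1 //.
Qed.

(** For n = 1 the symbol is the indicator of coprimality.  This is the sum without the
coprimality condition. *)
Definition full_sum r D : C :=
  \sum_(u : {poly_D F}) \sum_(xi : {poly_D F}) em (pres (r * xi) ('X^D + (u : {poly F}))).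

(** For each denominator, the inner sum is that of a nontrivial additive character: as deg r < D,
a multiple of a power of X gives a prescribed value of the residue. *)
Lemma full_sum_eq0 r D : (exists a, em a != 1) -> r != 0 -> (size r <= D)%N ->
  full_sum r D = 0.
Proof.
move=> [a na] r0 srD; apply: big1 => u _.
set c := 'X^D + _; set S := \sum_(xi : _) _.
have lr : lead_coef r != 0 by rewrite lead_coef_eq0.
(* r y has degree D - 1 and leading coefficient a, which is the residue of r y / c. *)
pose y := (a / lead_coef r) *: 'X^(D - size r) : {poly F}.
have sy : (size y <= D)%N.
  apply: leq_trans (size_scale_leq _ _) _; rewrite size_polyXn -subSn // leq_subLR.
  by rewrite -addn1 addnC leq_add2r size_poly_gt0.
have yE : pres (r * y) c = a.
  have -> : r * y = (a / lead_coef r) *: (r * 'X^(D - size r)) by rewrite /y -scalerAr.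
  rewrite presZ; suff -> : pres (r * 'X^(D - size r)) c = lead_coef r by rewrite divfK.
  have D0 : (0 < D)%N by apply: leq_trans srD; rewrite size_poly_gt0.
  have sz : size (r * 'X^(D - size r)) = D by rewrite size_mulXn // subnK.
  have sc : size c = D.-1.+2 by rewrite size_monic_sum prednK.
  rewrite (pres_top sc) ?sz ?prednK // (monicP (monic_monic_sum u)) divr1.
  by rewrite -{2}sz -lead_coefE lead_coefM lead_coefXn mulr1.
have : S = em a * S.
  rewrite {1}/S (@reindex_npoly _ _ _ (fun xi => y + xi) (fun xi => em (pres (r * xi) c))).
  - by rewrite mulr_sumr; apply: eq_bigr => xi _; rewrite mulrDr presD emD yE.
  - by move=> x sx; apply: leq_trans (size_polyD _ _) _; rewrite geq_max sy.
  - by move=> x x' _ _ /addrI.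
move=> /eqP; rewrite -subr_eq0 -[X in X - _]mul1r -mulrBl mulf_eq0 subr_eq0 eq_sym.
by rewrite (negPf na) => /eqP.
Qed.

Lemma csym_trivial xi c : n = 1%N -> c != 0 -> csym xi c = (coprimep xi c)%:R.
Proof.
move=> n1 c0; have [co|nco] := boolP (coprimep xi c); last by apply/eqP; rewrite csym_eq0.
have : sym xi c ^+ n = 1 by apply: symbol_unity; rewrite (symbol_eq0 hn hq) ?co.
by rewrite [X in _ ^+ X]n1 expr1 /csym => ->.
Qed.

(** The contribution of the pairs with greatest common divisor [h]; dividing both by [h] does
not change the fraction. *)
Lemma sum_common_multiples r h k m D : n = 1%N -> h \is monic -> size h = k.+1 ->
  D = (k + m)%N ->
  \sum_(u : {poly_D F}) \sum_(xi : {poly_D F})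
    (let c := 'X^D + (u : {poly F}) in
     if [&& h %| c, h %| xi & coprimep ((xi : {poly F}) %/ h) (c %/ h)]
     then em (pres (r * xi) c) else 0) = asum r m.
Proof.
move=> n1 mh sh -> {D}; have h0 := monic_neq0 mh.
pose Phi c xi := em (pres (r * xi) c).
transitivity (\sum_(u : {poly_(k + m) F} | h %| 'X^(k + m) + (u : {poly F}))
   \sum_(xi : {poly_(k + m) F} | h %| (xi : {poly F}))
     let c := 'X^(k + m) + (u : {poly F}) in
     if coprimep ((xi : {poly F}) %/ h) (c %/ h) then Phi c xi else 0).
  rewrite [RHS]big_mkcond; apply: eq_bigr => u _ /=.
  case: (h %| _) => /=; last by apply: big1.
  by rewrite [RHS]big_mkcond; apply: eq_bigr => xi _; case: (h %| _).
rewrite (@sum_monic_multiples _ _ h k m (fun c => \sum_(xi : {poly_(k + m) F} | h %| (xi : {poly F}))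
     if coprimep ((xi : {poly F}) %/ h) (c %/ h) then Phi c xi else 0)) //.
apply: eq_bigr => u _; set c := 'X^m + _.
have c0 : c != 0 by rewrite monic_neq0 // monic_monic_sum.
rewrite (@sum_small_multiples _ _ h k m (fun xi => if coprimep (xi %/ h) (h * c %/ h) then Phi (h * c) xi else 0)) //.
rewrite /gsum (@sum_npoly_cast _ _ _ m (fun xi => csym xi c * em (pres (r * xi) c))) ?size_monic_sum //.
apply: eq_bigr => xi _; rewrite csym_trivial // ![h * _]mulrC !mulpK //.
by case: (coprimep _ _); rewrite ?mul0r // mul1r /Phi mulrA pres_frac.
Qed.

(** The pairs (c, xi) are grouped by their monic greatest common divisor. *)
Lemma full_sumE r D : n = 1%N ->
  full_sum r D = \sum_(k < D.+1) asum r (D - k) *+ q ^ k.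
Proof.
move=> n1; pose Phi c xi := em (pres (r * xi) c).
pose Q (h c xi : {poly F}) := [&& h %| c, h %| xi & coprimep (xi %/ h) (c %/ h)].
transitivity (\sum_(u : {poly_D F}) \sum_(xi : {poly_D F})
   \sum_(h : {poly_D.+1 F} | (h : {poly F}) \is monic)
     if Q h ('X^D + (u : {poly F})) xi then Phi ('X^D + (u : {poly F})) xi else 0).
  apply: eq_bigr => u _; apply: eq_bigr => xi _.
  set c := 'X^D + _; have mc : c \is monic by apply: monic_monic_sum.
  have c0 := monic_neq0 mc; pose g := gcdp c xi; pose g1 := (lead_coef g)^-1 *: g.
  have g0 : g != 0 by rewrite gcdp_eq0 negb_and c0.
  have lg : (lead_coef g)^-1 != 0 by rewrite invr_eq0 lead_coef_eq0.
  have mg1 : g1 \is monic by rewrite monicE lead_coefZ mulVf ?lead_coef_eq0.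
  have gg1 : g1 %= g by apply: eqp_scale.
  have sg1 : (size g1 <= D.+1)%N.
    by rewrite size_scale // -(size_monic_sum u) dvdp_leq // dvdp_gcdl.
  have QE (h : {poly F}) : h \is monic -> Q h c xi = (h == g1).
    move=> mh; have h0 := monic_neq0 mh; rewrite -eqp_monic //.
      rewrite (eqp_rtrans gg1) /Q; have [hg|nhg] := boolP (h %| g); last first.
      have -> : (h %= g) = false by apply: contraNF nhg => /eqp_dvdl->.
      by apply: contraNF nhg => /and3P[hc hx _]; rewrite dvdp_gcd hc.
    move: (hg); rewrite dvdp_gcd => /andP[hc hx]; rewrite hc hx /=.
    rewrite -dvdp_size_eqp // coprimep_sym coprimep_def /g.
    rewrite -[in RHS](divpK hc) -[in RHS](divpK hx) (eqp_size (gcdp_mul2r _ _ _)).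
    have G0 : gcdp (c %/ h) (xi %/ h) != 0.
      rewrite gcdp_eq0 negb_and -[c %/ h == 0](mulIr_eq0 _ (mulIf h0)).
      by rewrite divpK ?c0.
    rewrite size_mul //; move: G0 h0; rewrite -!size_poly_gt0.
    by case: (size _) => // i _; case: (size _) => // j _; rewrite addSn /=; lia.
  rewrite -big_mkcondr (big_pred1 (NPoly (sg1 : _ \is a poly_of_size _))) // => h.
  rewrite [RHS]/= -(inj_eq val_inj) /=; case mh : (_ \is monic) => /=; first by rewrite QE.
  by apply/esym; apply: contraFF mh => /eqP->.
under eq_bigr => u _ do rewrite exchange_big.
rewrite exchange_big /=.
rewrite (@sum_monic_by_degree _ _ _ (fun h => \sum_(u : {poly_D F}) \sum_(xi : {poly_D F})
    if Q h ('X^D + (u : {poly F})) xi then Phi ('X^D + (u : {poly F})) xi else 0)).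
apply: eq_bigr => k _.
rewrite -card_npoly -sumr_const; apply: eq_bigr => w _.
set h := 'X^k + _; have mh : h \is monic by apply: monic_monic_sum.
have sh : size h = k.+1 by apply: size_monic_sum.
have h0 := monic_neq0 mh.
by rewrite (@sum_common_multiples r h k (D - k) D) ?subnKC // -ltnS.
Qed.

(** The expansions [full_sumE] of degrees D and D + 1 differ by a factor q and the term
[asum r D.+1], and both full sums vanish. *)
Lemma asum_eq0 r D : n = 1%N -> (exists a, em a != 1) -> r != 0 -> (size r <= D)%N ->
  asum r D.+1 = 0.
Proof.
move=> n1 ha r0 srD; have E := full_sumE r D.+1 n1.
rewrite full_sum_eq0 // in E; last by apply: leqW.
rewrite big_ord_recl subn0 expn0 mulr1n in E.
suff E2 : \sum_(i < D.+1) asum r (D.+1 - lift ord0 i) *+ q ^ lift ord0 i = 0.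
  by rewrite E2 addr0 in E.
rewrite (eq_bigr (fun i : 'I_D.+1 => (asum r (D - i) *+ q ^ i) *+ q)); last first.
  by move=> i _; rewrite lift0 subSS expnSr mulrnA.
by rewrite sumrMnl -full_sumE // full_sum_eq0 // mul0rn.
Qed.

Section Transform.
Variables al be ga de : F.
Hypothesis Delta0 : al * de - be * ga != 0.
Local Notation Delta := (al * de - be * ga).
Local Notation J := (mden ga de).
Local Notation htr := (htr al be ga de).

(** [resnorm_htr], raised to the power (q - 1)/n. *)
Lemma csym_htr D N c xi : c \is monic -> size c = D.+1 ->
  size (htr D c) = D.+1 -> (size xi <= N.+1)%N ->
  csym (htr N xi) (htr D c) =
  cunit (Delta ^+ D / lead_coef (htr D c)) ^+ N * csym xi c.
Proof.
move=> mc sc sc1 sxi; have c0 := monic_neq0 mc.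
have c10 : htr D c != 0 by rewrite -size_poly_eq0 sc1.
have [K [iota]] := closure_exists F.
have l0 : Delta ^+ D / lead_coef (htr D c) != 0.
  by rewrite mulf_neq0 ?invr_eq0 ?lead_coef_eq0 // expf_neq0.
set l := _ / _ in l0 *.
have : sym (htr N xi) (htr D c) = chi (l ^+ N) * sym xi c.
  apply: (fmorph_inj iota); rewrite rmorphM !(residue_symbolE iota hn hq) //.
  by rewrite (resnorm_htr iota Delta0) // exprMn /unit_symbol !rmorphXn.
rewrite /csym => ->; rewrite epM0 -?cunitX //; last exact: symbol_unity.
by move=> _; apply: unit_symbol_unity; rewrite // expf_neq0.
Qed.

(** mden is the transform of the constant 1 seen as a form of degree 1. *)
Lemma csym_mden D c : c \is monic -> size c = D.+1 -> size (htr D c) = D.+1 ->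
  csym J (htr D c) = cunit (Delta ^+ D / lead_coef (htr D c)).
Proof.
move=> mc sc sc1; have := @csym_htr D 1 c 1 mc sc sc1.
by rewrite size_poly1 htr1 !expr1 csym1 ?monic_neq0 // mulr1 => ->.
Qed.

(** The residue at infinity of f/c is minus the sum of the residues of (f/c) dx at the roots
of c.  The substitution multiplies dx by Delta / mden^2 and carries the roots of [c] to
those of its transform, none of them to infinity since the degree does not drop.
The proof reduces f modulo c and compares leading coefficients, without mentioning the
individual residues. *)
Lemma pres_htr D M c (f y : {poly F}) : c \is monic -> size c = D.+2 -> size (htr D.+1 c) = D.+2 ->
  (size f <= (M + D).+1)%N ->
  htr D.+1 c %| J ^+ M.+1 * y - Delta *: htr (M + D) f ->
  pres f c = pres y (htr D.+1 c).
Proof.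
move=> mc sc sc1 sf hy; set c1 := htr D.+1 c in hy *.
have c0 := monic_neq0 mc.
have c10 : c1 != 0 by rewrite -size_poly_eq0 sc1.
have coJ : coprimep c1 J.
  rewrite coprimep_sym -[coprimep _ _]negbK -csym_eq0 // csym_mden //.
  by rewrite cunit_neq0 // mulf_neq0 ?invr_eq0 ?lead_coef_eq0 ?expf_neq0.
pose f0 := f %% c; have sf0 : (size f0 <= D.+1)%N by rewrite -ltnS -sc ltn_modp.
have cf : c %| f - f0 by rewrite {1}(divp_eq f c) addrK dvdp_mulIr.
rewrite (pres_mod c0 cf).
have hf : c1 %| htr (M + D) f - J ^+ M * htr D f0.
  rewrite -[X in _ - X]mulrC -htr_pad // [(D + M)%N]addnC -htrB.
  have [k Ek] := dvdpP _ _ cf; rewrite Ek.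
  have [->|k0] := eqVneq k 0; first by rewrite mul0r /htr big1 // => j _; rewrite coef0 scale0r.
  have sk : (size k + D.+1 <= (M + D).+1)%N.
    have := size_mul k0 c0; rewrite -Ek sc addnS /= addnS => <-.
    apply: leq_trans (size_polyD _ _) _; rewrite size_polyN geq_max sf.
    by rewrite (leq_trans sf0) // ltnS leq_addl.
  have [m Em] : exists m, (M + D)%N = (m + D.+1)%N.
    exists (M + D - D.+1)%N; rewrite subnK //.
    by move: sk k0; rewrite -size_poly_gt0; lia.
  rewrite Em htrM ?sc //; first exact: dvdp_mulIr.
  by move: sk; rewrite Em -addSn leq_add2r.
have hy0 : c1 %| J * y - Delta *: htr D f0.
  have : c1 %| J ^+ M * (J * y - Delta *: htr D f0).
    have -> : J ^+ M * (J * y - Delta *: htr D f0) =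
        (J ^+ M.+1 * y - Delta *: htr (M + D) f) +
        Delta *: (htr (M + D) f - J ^+ M * htr D f0).
      by rewrite -!mul_polyC exprSr; ring.
    by rewrite dvdp_add // dvdpZr.
  by rewrite Gauss_dvdpr // coprimep_expr.
pose t := f0`_D; pose h := f0 * (al%:P - ga *: 'X) + (ga * t) *: c.
have sl : (size (al%:P - ga *: 'X)%R <= 2)%N.
  rewrite (leq_trans (size_polyD _ _)) // geq_max size_polyN.
  by rewrite (leq_trans (size_polyC_leq1 _)) // (leq_trans (size_scale_leq _ _)) ?size_polyX.
have sh : (size h <= D.+1)%N.
  apply/leq_sizeP => j; rewrite /h mulrBr coefD coefB coefMC -scalerAr !coefZ coefMX.
  rewrite leq_eqVlt => /orP[/eqP<-|Dj] /=.
    have -> : c`_D.+1 = 1 by rewrite -[D.+1]/(D.+2.-1) -sc -lead_coefE (monicP mc).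
    by rewrite [f0`_D.+1]nth_default // mul0r add0r mulr1 addNr.
  case: j Dj => // j Dj /=; rewrite !nth_default ?sc ?mul0r ?mulr0 ?subr0 ?addr0 //.
  - exact: leq_trans sf0 _.
  - by apply: leq_trans sf0 _; apply: leqW.
have hl : htr 1 (al%:P - ga *: 'X) = Delta%:P.
  rewrite /htr !big_ord_recl big_ord0 /= !coefB !coefZ !coefX !coefC /= mulr0 mulr1 subr0 sub0r.
  rewrite !expr0 mul1r mulr1 !expr1 addr0 /mnum /mden -!mul_polyC !rmorphB !rmorphN !rmorphM /=.
  ring.
have EJh : J * htr D h = Delta *: htr D f0 + (ga * t) *: c1.
  rewrite mulrC -[J]expr1 -htr_pad // addn1 /h htrD htrZ -addn1 htrM //.
  by rewrite hl mulrC mul_polyC addn1.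
have hyh : c1 %| y - htr D h.
  rewrite -(Gauss_dvdpr _ coJ) mulrBr EJh opprD addrA; apply: dvdp_sub => //.
  by rewrite -mul_polyC dvdp_mulIr.
rewrite (pres_mod c10 hyh) (pres_top sc) // (pres_top sc1) ?size_htr //.
rewrite (monicP mc) divr1 -/t; apply: (canRL (mulfK _)); first by rewrite lead_coef_eq0.
have [ga0|ga0] := eqVneq ga 0.
  rewrite lead_coefE sc1 /= !coef_htr_top_affine //.
  have -> : c`_D.+1 = 1 by rewrite -[D.+1]/(D.+2.-1) -sc -lead_coefE (monicP mc).
  rewrite /h ga0 scale0r subr0 mul0r scale0r addr0 coefMC -/t exprS; ring.
apply: (mulfI ga0).
have := congr1 (fun p : {poly F} => p`_D.+1) EJh.
rewrite /= /mden mulrDl coefD -scalerAl coefZ coefXM coefCM /=.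
rewrite [(htr D h)`_D.+1]nth_default ?size_htr // mulr0 addr0 => ->.
rewrite coefD !coefZ [(htr D f0)`_D.+1]nth_default ?size_htr // mulr0 add0r.
by rewrite lead_coefE sc1 mulrA.
Qed.

(** The polynomial part of the twist: delta stands for Delta^(1-i), and mden^(L + M) for
the power of mden that is left after multiplication by an n-th power. *)
Definition mtwist M L delta s : {poly F} := delta *: (J ^+ L * htr M s).

(** The change of variables in the Gauss sum is xi |-> Delta^i xi(mnum/mden) mden^(D-1-k)
modulo the transform of [c], with k chosen such that the residues match by [pres_htr].
The symbol of this power of mden and of Delta^i then accounts for the leading coefficient
of the transform, because L + M + 2 = 2 i and D = i modulo n. *)
Lemma gsum_htr D M L delta i (s c : {poly F}) : c \is monic -> size c = D.+1 ->
  size (htr D c) = D.+1 -> (size s <= M.+1)%N ->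
  delta * Delta ^+ i = Delta -> D = i %[mod n] -> (L + M + 2 = i + i %[mod n])%N ->
  gsum s c = gsum (mtwist M L delta s) ((lead_coef (htr D c))^-1 *: htr D c).
Proof.
move=> mc sc sc1 ss Hdelta Di HL; have c0 := monic_neq0 mc.
have c10 : htr D c != 0 by rewrite -size_poly_eq0 sc1.
have l0 : lead_coef (htr D c) != 0 by rewrite lead_coef_eq0.
rewrite gsum_scaler ?invr_eq0 // sc1 /= cunitV exprVn.
apply: (canRL (mulKf (expf_neq0 D (cunit_neq0 l0)))).
case: D => [|D] in sc sc1 c10 l0 Di *.
  rewrite expr0 mul1r /gsum; set c1 := htr 0 c in sc1 c10 *; set s' := mtwist M L delta s.
  rewrite (@sum_npoly_cast _ _ _ 0 (fun xi => csym xi c * em (pres (s * xi) c))) ?sc //.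
  rewrite (@sum_npoly_cast _ _ _ 0 (fun xi => csym xi c1 * em (pres (s' * xi) c1))) ?sc1 //.
  apply: eq_bigr => xi _.
  have -> : (xi : {poly F}) = 0 by apply/eqP; rewrite -size_poly_leq0 size_npoly.
  rewrite !mulr0 -[0]polyC0 !csym_const // sc sc1 !expr0.
  by rewrite /pres !mulr0 !div0p.
set c1 := htr D.+1 c in sc1 c10 l0 *; set s' := mtwist M L delta s.
pose NJ := csym J c1.
have ENJ : NJ = cunit (Delta ^+ D.+1 / lead_coef c1) by apply: csym_mden.
have NJ0 : NJ != 0 by rewrite ENJ cunit_neq0 // mulf_neq0 ?invr_eq0 ?expf_neq0.
have coJ : coprimep J c1 by rewrite -[coprimep _ _]negbK -csym_eq0.
(* With this power, s' eta is congruent to Delta times the transform of s xi over mden^(M + 1). *)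
pose k := (L + M).+1.
pose eta (xi : {poly F}) := (Delta ^+ i *: htr D xi * pinv c1 J ^+ k) %% c1.
have etaP xi : c1 %| J ^+ k * eta xi - Delta ^+ i *: htr D xi.
  have h1 : c1 %| (J * pinv c1 J) ^+ k - 1.
    by rewrite subrX1 dvdp_mulr // pinvP.
  set z := Delta ^+ i *: htr D xi.
  have -> : J ^+ k * eta xi - z =
     J ^+ k * (eta xi - z * pinv c1 J ^+ k) + z * ((J * pinv c1 J) ^+ k - 1).
    rewrite exprMn; ring.
  rewrite dvdp_add ?dvdp_mull //.
  rewrite -opprB dvdpNr /eta -/z {1}(divp_eq (z * pinv c1 J ^+ k) c1) addrK.
  exact: dvdp_mulIr.
have csym_eta xi : (size xi <= D.+1)%N -> csym (eta xi) c1 = cunit (lead_coef c1) ^+ D.+1 * csym xi c.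
  move=> sxi; have E : NJ ^+ k * csym (eta xi) c1 =
      cunit (Delta ^+ i) ^+ D.+1 * (NJ ^+ D * csym xi c).
    have := csym_mod c10 (etaP xi).
    by rewrite csymM // csymX // csymZ // sc1 /= -/NJ (csym_htr mc sc sc1 sxi) -ENJ.
  have NJk : NJ ^+ k.+1 = NJ ^+ (D.+1 + D.+1).
    rewrite ENJ; apply: cunit_expr_mod; first by rewrite mulf_neq0 ?invr_eq0 ?expf_neq0.
    by rewrite /k -addn2 HL -modnDm -Di modnDm.
  apply: (mulfI (expf_neq0 (D.+1 + D.+1) NJ0)).
  rewrite -{1}NJk exprS -mulrA E -{1}[Delta ^+ i]mul1r mul1r.
  have -> : cunit (Delta ^+ i) ^+ D.+1 = NJ ^+ D.+1 * cunit (lead_coef c1) ^+ D.+1.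
    rewrite -exprMn ENJ -cunitM divfK // !cunitX; congr (_ ^+ _).
    exact: cunit_expr_mod (esym Di).
  move: (csym xi c) (cunit _ ^+ _) => x y; rewrite exprD exprS; ring.
have seta xi : (size (eta xi) <= D.+1)%N by rewrite -ltnS -sc1 ltn_modp.
rewrite /gsum mulr_sumr.
rewrite (@sum_npoly_cast _ _ _ D.+1 (fun xi => csym xi c1 * em (pres (s' * xi) c1))) ?sc1 //.
rewrite (@sum_npoly_cast _ _ _ D.+1 (fun xi => cunit (lead_coef c1) ^+ D.+1 * (csym xi c * em (pres (s * xi) c)))) ?sc //.
rewrite (@reindex_npoly _ _ D.+1 eta (fun xi => csym xi c1 * em (pres (s' * xi) c1))).
- apply: eq_bigr => xi _; rewrite csym_eta ?size_npoly // -mulrA.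
  congr (_ * (_ * em _)); apply: (@pres_htr D M) => //.
    apply: leq_trans (size_polyMleq _ _) _.
    rewrite -subn1 leq_subLR; apply: leq_trans (leq_add ss (size_npoly xi)) _.
    by rewrite addSn addnS add1n.
  rewrite htrM ?size_npoly //.
  have -> : J ^+ M.+1 * (s' * eta xi) - Delta *: (htr M s * htr D xi) =
      delta *: htr M s * (J ^+ k * eta xi - Delta ^+ i *: htr D xi).
    by rewrite -{1}Hdelta /s' /mtwist /k -addnS exprD -!mul_polyC polyCM; ring.
  by rewrite dvdp_mull.
- by move=> x _; apply: seta.
move=> x y sx sy Exy.
have Di0 : Delta ^+ i != 0 by rewrite expf_neq0.
have h : htr D x = htr D y.
  apply: (@small_congruent_eq F c1); rewrite ?sc1 ?ltnS ?size_htr //.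
  rewrite -(dvdpZr _ _ Di0) scalerBr.
  have -> : Delta ^+ i *: htr D x - Delta ^+ i *: htr D y =
    (J ^+ k * eta y - Delta ^+ i *: htr D y) - (J ^+ k * eta x - Delta ^+ i *: htr D x).
    by rewrite Exy; ring.
  by rewrite dvdp_sub.
have DD0 : Delta ^+ D != 0 by rewrite expf_neq0.
by apply: (scalerI DD0); rewrite -!htrK // h.
Qed.

End Transform.

Section MonicTransform.
Variables al be ga de : F.
Hypothesis Delta0 : al * de - be * ga != 0.
Local Notation Delta := (al * de - be * ga).

Definition mhtr D c := (lead_coef (htr al be ga de D c))^-1 *: htr al be ga de D c.

Lemma size_htr_top D c : (htr al be ga de D c)`_D != 0 -> size (htr al be ga de D c) = D.+1.
Proof.
by move=> h; apply/eqP; rewrite eqn_leq size_htr ltnNge; apply: contra h => /leq_sizeP->.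
Qed.

(** [htrK] says so up to a constant, which making the polynomials monic removes. *)
Lemma mhtrK D c : c \is monic -> size c = D.+1 -> (htr al be ga de D c)`_D != 0 ->
  [/\ mhtr D c \is monic, size (mhtr D c) = D.+1,
     (htr de (- be) (- ga) al D (mhtr D c))`_D != 0 &
     (lead_coef (htr de (- be) (- ga) al D (mhtr D c)))^-1 *:
        htr de (- be) (- ga) al D (mhtr D c) = c].
Proof.
move=> mc sc top; have sc1 := size_htr_top top; set c1 := htr al be ga de D c in top sc1.
have l0 : lead_coef c1 != 0 by rewrite lead_coefE sc1.
have E : htr de (- be) (- ga) al D (mhtr D c) = ((lead_coef c1)^-1 * Delta ^+ D) *: c.
  by rewrite /mhtr htrZ htrK ?sc // scalerA.
have a0 : (lead_coef c1)^-1 * Delta ^+ D != 0.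
  by rewrite mulf_neq0 ?invr_eq0 // expf_neq0.
split.
- by rewrite monicE lead_coefZ mulVf.
- by rewrite size_scale ?invr_eq0.
- by rewrite E coefZ -[c`_D]/(c`_(D.+1.-1)) -sc -lead_coefE (monicP mc) mulr1.
- by rewrite E lead_coefZ (monicP mc) mulr1 scalerA mulVf // scale1r.
Qed.

End MonicTransform.

Section Invariance.
Variables al be ga de : F.
Hypothesis Delta0 : al * de - be * ga != 0.
Local Notation Delta := (al * de - be * ga).
Variables (M L i : nat) (delta : F) (s : {poly F}).
Hypotheses (ss : (size s <= M.+1)%N) (Hdelta : delta * Delta ^+ i = Delta).
Hypothesis HL : (L + M + 2 = i + i %[mod n])%N.
Local Notation s' := (mtwist al be ga de M L delta s).

(** The summation of [gsum_htr] over the denominators whose degree is preserved, a condition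
that reads on the coefficient of degree D. *)
Lemma sum_gsum_htr D : D = i %[mod n] ->
  \sum_(u : {poly_D F} | (htr al be ga de D ('X^D + (u : {poly F})))`_D != 0)
     gsum s ('X^D + (u : {poly F})) =
  \sum_(v : {poly_D F} | (htr de (- be) (- ga) al D ('X^D + (v : {poly F})))`_D != 0)
     gsum s' ('X^D + (v : {poly F})).
Proof.
move=> Di; have D0' : de * al - (- be) * (- ga) != 0 by rewrite mulrNN mulrC.
pose T := mhtr al be ga de D; pose T' := mhtr de (- be) (- ga) al D.
pose f (v : {poly_D F}) : {poly_D F} := npolyp D (T' ('X^D + (v : {poly F})) - 'X^D).
pose f' (u : {poly_D F}) : {poly_D F} := npolyp D (T ('X^D + (u : {poly F})) - 'X^D).
have fE (v : {poly_D F}) : (htr de (- be) (- ga) al D ('X^D + (v : {poly F})))`_D != 0 ->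
    'X^D + (f v : {poly F}) = T' ('X^D + (v : {poly F})).
  move=> /(mhtrK D0' (monic_monic_sum v) (size_monic_sum v))[m1 s1 _ _].
  by rewrite npolypK ?size_monic_subXn // addrC subrK.
have f'E (u : {poly_D F}) : (htr al be ga de D ('X^D + (u : {poly F})))`_D != 0 ->
    'X^D + (f' u : {poly F}) = T ('X^D + (u : {poly F})).
  move=> /(mhtrK Delta0 (monic_monic_sum u) (size_monic_sum u))[m1 s1 _ _].
  by rewrite npolypK ?size_monic_subXn // addrC subrK.
have TK (u : {poly_D F}) : (htr al be ga de D ('X^D + (u : {poly F})))`_D != 0 ->
  (htr de (- be) (- ga) al D ('X^D + (f' u : {poly F})))`_D != 0 /\ f (f' u) = u.
  move=> Pu; have [m1 s1 t1 e1] := mhtrK Delta0 (monic_monic_sum u) (size_monic_sum u) Pu.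
  have t1' : (htr de (- be) (- ga) al D ('X^D + (f' u : {poly F})))`_D != 0 by rewrite f'E.
  by split=> //; apply/val_inj/(addrI 'X^D); rewrite fE // f'E.
have T'K (v : {poly_D F}) : (htr de (- be) (- ga) al D ('X^D + (v : {poly F})))`_D != 0 ->
  (htr al be ga de D ('X^D + (f v : {poly F})))`_D != 0 /\ f' (f v) = v.
  move=> Pv; have := mhtrK D0' (monic_monic_sum v) (size_monic_sum v) Pv.
  rewrite !opprK => -[m1 s1 t1 e1].
  have t1' : (htr al be ga de D ('X^D + (f v : {poly F})))`_D != 0 by rewrite fE.
  by split=> //; apply/val_inj/(addrI 'X^D); rewrite f'E // fE.
rewrite (reindex_onto f f'); last by move=> u /TK[].
apply: eq_big => [v|v /andP[Pu /eqP Ev]].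
  apply/andP/idP => [[Pu /eqP Ev]|/T'K[-> ->]]; last by rewrite eqxx.
  by rewrite -Ev; have [] := TK _ Pu.
rewrite (gsum_htr Delta0 (monic_monic_sum _) (size_monic_sum _) (size_htr_top Pu) ss Hdelta Di HL).
by rewrite -/(mhtr al be ga de D _) -/(T _) -f'E // Ev.
Qed.

(** The degree drops exactly when the polynomial vanishes at the point that goes to
infinity. *)
Lemma top_htr_coprime (a b c d : F) D (u : {poly_D F}) : c != 0 ->
  ((htr a b c d D ('X^D + (u : {poly F})))`_D != 0) =
  coprimep ('X - (a / c)%:P) ('X^D + (u : {poly F})).
Proof.
move=> c0; rewrite coef_htr_top coprimep_sym coprimep_XsubC rootE; congr (~~ _).
have -> : \sum_(j < D.+1) ('X^D + (u : {poly F}))`_j * (a ^+ j * c ^+ (D - j)) =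
   c ^+ D * ('X^D + (u : {poly F})).[a / c].
  rewrite (@horner_coef_wide _ D.+1) ?size_monic_sum // mulr_sumr.
  apply: eq_bigr => j _; rewrite [RHS]mulrCA; congr (_ * _).
  have jD : (j <= D)%N by rewrite -ltnS.
  rewrite expr_div_n [RHS]mulrCA; congr (_ * _).
  have -> : c ^+ D = c ^+ (D - j) * c ^+ j by rewrite -exprD subnK.
  by rewrite mulfK ?expf_neq0.
by rewrite mulf_eq0 expf_eq0 (negPf c0) andbF.
Qed.

(** If the transformation is affine, it preserves all degrees.  Otherwise the sums over the
polynomials that do not vanish at al/ga, resp. at -de/ga, agree in each degree, and they
determine the full sums in the same way. *)
Lemma asum_mtwist D : D = i %[mod n] -> (size s < D)%N -> (size s' < D)%N ->
  asum s D = asum s' D.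
Proof.
move=> Di sD s'D; have [ga0|ga0] := eqVneq ga 0.
  have al0 : al != 0 by apply: contraNneq Delta0 => ->; rewrite ga0 mul0r mulr0 subrr.
  have de0 : de != 0 by apply: contraNneq Delta0 => ->; rewrite ga0 !mulr0 subrr.
  have top (v : {poly_D F}) : ('X^D + (v : {poly F}))`_D = 1.
    by rewrite coefD coefXn eqxx nth_default ?addr0 // size_npoly.
  have := sum_gsum_htr Di; rewrite /asum => E.
  transitivity (\sum_(u : {poly_D F} | (htr al be ga de D ('X^D + (u : {poly F})))`_D != 0)
     gsum s ('X^D + (u : {poly F}))).
    apply: eq_bigl => u.
    by rewrite coef_htr_top_affine // top mul1r expf_neq0.
  rewrite E; apply: eq_bigl => u.
  by rewrite coef_htr_top_affine ?ga0 ?oppr0 // top mul1r expf_neq0.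
have msumE e : e = i %[mod n] ->
    msum ('X - (al / ga)%:P) s e = msum ('X - (de / - ga)%:P) s' e.
  move=> ei; have := sum_gsum_htr ei.
  rewrite (eq_bigl _ _ (fun u => top_htr_coprime al be de u ga0)) /msum => ->.
  by apply: eq_bigl => v; rewrite top_htr_coprime // oppr_eq0.
case: D Di sD s'D => // D Di sD s'D.
rewrite (asum_from_msum (al / ga)) // (asum_from_msum (de / - ga)) // msumE //.
congr (_ + _); apply: eq_bigr => e /eqP ei; rewrite msumE //.
by rewrite ei.
Qed.

End Invariance.
End GaussSums.

(** * Laurent expansions at infinity *)

Section Expansions.
Variable F : finFieldType.
Local Notation "f %:F" := (FracField.tofrac f).
Implicit Types (c p : {poly F}).

Lemma denom_neq0 (f : {fraction {poly F}}) : denom f != 0.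
Proof. exact: denom_ratioP. Qed.

Lemma fraction_numden (f : {fraction {poly F}}) : f = (numer f)%:F / (denom f)%:F.
Proof.
have D0 : (denom f)%:F != 0 by rewrite tofrac_eq0 denom_neq0.
apply: (canRL (mulfK D0)); rewrite -[X in X * _](reprK f) /numer /denom.
move: (repr f) => x; rewrite !piE; apply/eqmodP; rewrite /= FracField.equivfE /FracField.mulf.
by rewrite !numden_Ratio ?mulf_neq0 ?oner_neq0 ?denom_ratioP // !mulr1 mulrC.
Qed.

Lemma divp_cross (a b c d : {poly F}) : b != 0 -> d != 0 -> a * d = c * b -> a %/ b = c %/ d.
Proof.
move=> b0 d0 E; rewrite -[LHS](divp_pmul2r a d0 b0) E.
by rewrite [b * d]mulrC divp_pmul2r.
Qed.

(** The representative of a fraction is known only up to a common factor. *)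
Lemma numden_cross (f : {fraction {poly F}}) p c : c != 0 -> f = p%:F / c%:F ->
  numer f * c = p * denom f.
Proof.
move=> c0 E; apply/eqP; rewrite -tofrac_eq !tofracM; apply/eqP.
have c0' : c%:F != 0 by rewrite tofrac_eq0.
have D0 : (denom f)%:F != 0 by rewrite tofrac_eq0 denom_neq0.
have -> : (numer f)%:F = f * (denom f)%:F.
  by rewrite [X in _ = X * _]fraction_numden (divfK D0).
have fc : f * c%:F = p%:F by rewrite [X in X * _]E (divfK c0').
by rewrite mulrAC fc.
Qed.

Lemma expansion_res p c : c != 0 -> expansion (p%:F / c%:F) (-1) = pres p c.
Proof.
move=> c0; rewrite /pres -[LHS]/((('X^1 * numer (p%:F / c%:F)) %/ denom (p%:F / c%:F))`_0).
rewrite (@divp_cross _ _ ('X * p) c) ?denom_neq0 //.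
by rewrite expr1 -mulrA (numden_cross c0 erefl) mulrA.
Qed.

(** The Laurent series in 1/x with coefficient s k at x^(M - k).  Series of this form are
closed under the product, which becomes the convolution [conv] of sequences. *)
Definition lau (M : int) (s : nat -> F) : int -> F :=
  fun m => if m <= M then s (absz (M - m)%R) else 0.

Definition conv (s t : nat -> F) : nat -> F :=
  fun k => \sum_(j < k.+1) s j * t (k - j)%N.

Definition delta0 (k : nat) : F := (k == 0%N)%:R.

Lemma laurent_mul_lau M N s t : laurent_mul (lau M s) (lau N t) = lau (M + N) (conv s t).
Proof.
apply/funext => m; rewrite /laurent_mul /lau; case: ifP => mMN; last first.
  apply: fsbig1 => j _; case: ifP => jM; last by rewrite mul0r.
  rewrite ifF ?mulr0 //; apply/negP => jN; move: mMN; lia.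
pose k := (absz (M + N - m)%R).
pose r := [seq M - (a%:Z) | a <- iota 0 k.+1].
have ur : uniq r by rewrite map_inj_uniq ?iota_uniq // => a b; lia.
rewrite (fsbigE r _ ur) //; last first.
  move=> j _ jr; case: ifP => jM; last by rewrite mul0r.
  rewrite ifF ?mulr0 //; apply/negP => jN; case/negP: jr.
  by apply/mapP; exists (absz (M - j)%R); [rewrite mem_iota | ]; rewrite /k; lia.
rewrite (eq_bigl xpredT); last by move=> j; apply: mem_set.
rewrite /r big_map -/k /conv -[iota 0 k.+1]/(index_iota 0 k.+1) big_mkord.
apply: eq_bigr => j _; have jk := ltn_ord j.
rewrite ifT; last by lia.
rewrite ifT; last by rewrite /k in jk *; lia.
congr (s _ * t _); rewrite /k in jk *; lia.
Qed.

Lemma laurent_exp_lau n M s :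
  expansion (1 : {fraction {poly F}}) = lau 0 delta0 ->
  laurent_exp (lau M s) n = lau (M *+ n) (iter n (conv s) delta0).
Proof.
move=> E1; rewrite /laurent_exp E1; elim: n => [|n IH]; first by rewrite mulr0n.
by rewrite !iterS IH laurent_mul_lau mulrS.
Qed.

Lemma lau_inj M N s t : s 0%N != 0 -> t 0%N != 0 -> lau M s = lau N t ->
  M = N /\ s = t.
Proof.
move=> s0 t0 E; have MN : M = N.
  apply/eqP; rewrite eq_le; apply/andP; split.
    have := congr1 (fun h => h M) E; rewrite /lau lexx subrr absz0.
    by case: (leP M N) => // _ E0; rewrite E0 eqxx in s0.
  have := congr1 (fun h => h N) E; rewrite /lau lexx subrr absz0.
  by case: (leP N M) => // _ E0; rewrite -E0 eqxx in t0.
split=> //; apply/funext => k.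
have := congr1 (fun h => h (N - k%:Z)) E; rewrite /lau MN.
by rewrite subKr absz_nat gerBl.
Qed.

(** The exponents with a nonzero coefficient are bounded, so there is a largest one. *)
Lemma laurent_lau h : is_laurent h -> (exists m, h m != 0) ->
  exists M s, s 0%N != 0 /\ h = lau M s.
Proof.
move=> [B hB] [m0 hm0].
have m0B : m0 <= B by rewrite leNgt; apply: contra hm0 => /hB->.
have exP : exists k, h (m0 + k%:Z) != 0 by exists 0%N; rewrite addr0.
have bP k : h (m0 + k%:Z) != 0 -> (k <= `|B - m0|)%N.
  move=> hk; have : m0 + k%:Z <= B by rewrite leNgt; apply: contra hk => /hB->.
  by lia.
case: (ex_maxnP exP bP) => k hk kmax.
exists (m0 + k%:Z), (fun j => h (m0 + k%:Z - j%:Z)); rewrite subr0; split=> //.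
apply/funext => m; rewrite /lau; case: leP => mk.
  by congr (h _); lia.
apply/eqP; apply: contraT => hm.
have := kmax (absz (m - m0)%R); have -> : m0 + (absz (m - m0)%R)%:Z = m by lia.
by move=> /(_ hm); lia.
Qed.

(** For a polynomial, the Euclidean quotients that define the expansion are exact. *)
Lemma expansion_poly c D : size c = D.+1 ->
  expansion c%:F = lau D%:Z (fun k => if (k <= D)%N then c`_(D - k) else 0).
Proof.
move=> sc; have E : c%:F = c%:F / (1 : {poly F})%:F :> {fraction {poly F}}.
  by rewrite tofrac1 divr1.
have num m : ('X^m * numer c%:F) %/ denom c%:F = 'X^m * c.
  rewrite -[RHS]divp1; apply: divp_cross; rewrite ?denom_neq0 ?oner_neq0 //.
  by rewrite mulr1 -mulrA -(numden_cross (oner_neq0 _) E) mulr1.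
apply/funext => -[j|j]; rewrite /expansion /lau.
  have := num 0%N; rewrite expr0 !mul1r => ->.
  case: leP => jD; last by rewrite nth_default // sc -ltz_nat.
  have {}jD : (j <= D)%N by rewrite -lez_nat.
  by rewrite subzn // absz_nat leq_subr subKn.
rewrite num coefXnM ltn0Sn NegzE opprK -PoszD absz_nat.
have -> : (D + j.+1 <= D)%N = false by lia.
by [].
Qed.

Lemma expansion1 : expansion (1 : {fraction {poly F}}) = lau 0 delta0.
Proof.
rewrite -tofrac1 (@expansion_poly 1 0) ?size_poly1 //; congr lau; apply/funext => k.
by rewrite leqn0 /delta0 sub0n coef1 eqxx; case: (k == 0%N).
Qed.

Lemma expansion_Xn i : expansion ((fX F)^-1 ^ (- (i%:Z))) = lau i%:Z delta0.
Proof.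
have -> : (fX F)^-1 ^ (- (i%:Z)) = ('X^i)%:F.
  by rewrite exprz_inv opprK -exprnP tofracXn.
rewrite (@expansion_poly _ i) ?size_polyXn //; congr lau; apply/funext => k.
rewrite /delta0 coefXn; case: leqP => ki; last by rewrite gtn_eqF // (leq_ltn_trans _ ki).
by congr (_%:R); case: k ki => [|k] ki; rewrite ?subn0 ?eqxx // ; apply/eqP; lia.
Qed.

End Expansions.

(** * Classes modulo n-th powers *)

Section PowerClass.
Variables (F : finFieldType) (n : nat).
Hypotheses (hn : (0 < n)%N) (hq : #|F| = 1 %[mod n]).
Local Notation "f %:F" := (FracField.tofrac f).
Implicit Types (c p P R : {poly F}).

(** n divides q - 1, which is -1 in F. *)
Lemma natn_neq0 : n%:R != 0 :> F.
Proof.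
have q0 : #|F|%:R = 0 :> F.
  have [p pr_p pF] := finPcharP F.
  by rewrite (card_pprimeChar pF) natrX (pcharf0 pF) expr0n; case: logn (card_pprimeChar pF) (card_gt1 F) => // ->.
have /(congr1 (fun k => k%:R : F)) := mule_n hq.
rewrite natrM natrB ?(ltnW (card_gt1 F)) // q0 sub0r => E.
by apply: contra_eq_neq E => ->; rewrite mulr0 eq_sym oppr_eq0 oner_eq0.
Qed.

Lemma exprD_mod_sqr (P Q : {poly F}) k : exists S,
  (P + Q) ^+ k = P ^+ k + (P ^+ k.-1 * Q) *+ k + Q ^+ 2 * S.
Proof.
elim: k => [|k [S IH]]; first by exists 0; rewrite !expr0 mulr0n mulr0 !addr0.
case: k IH => [|k] IH.
  by exists 0; rewrite !expr1 expr0 mul1r mulr1n mulr0 addr0.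
exists (P * S + (P ^+ k) *+ k.+1 + Q * S); rewrite exprS IH /= !exprS; ring.
Qed.

(** One step of Newton iteration for the equation R P^n = 1; n is invertible in F. *)
Lemma hensel_step R P k : (R * P ^+ n)`_0 = 1 ->
  (forall j, (j <= k)%N -> (R * P ^+ n)`_j = (j == 0%N)%:R) ->
  exists a, forall j, (j <= k.+1)%N -> (R * (P + a *: 'X^(k.+1)) ^+ n)`_j = (j == 0%N)%:R.
Proof.
move=> h0 hk; have u0 : (R * P ^+ n.-1)`_0 *+ n != 0.
  rewrite -mulr_natr mulf_neq0 ?natn_neq0 //.
  apply: contra_eq_neq h0 => E; rewrite -(prednK hn) exprSr mulrA coef0M E mul0r eq_sym.
  exact: oner_neq0.
exists (- (R * P ^+ n)`_k.+1 / ((R * P ^+ n.-1)`_0 *+ n)) => j jk.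
set a := _ / _; have [S ->] := exprD_mod_sqr P (a *: 'X^(k.+1)) n.
have -> : R * (P ^+ n + (P ^+ n.-1 * (a *: 'X^(k.+1))) *+ n + (a *: 'X^(k.+1)) ^+ 2 * S) =
   R * P ^+ n + 'X^(k.+1) * ((a *: (R * P ^+ n.-1)) *+ n + 'X^(k.+1) * (a ^+ 2 *: (R * S))).
  rewrite exprZn -!mul_polyC; ring.
rewrite coefD coefXnM; move: jk; rewrite leq_eqVlt => /orP[/eqP->|jk].
  rewrite ltnn subnn coefD coefXnM ltn0Sn addr0 coefMn coefZ -mulrnAr.
  by rewrite /a divfK // subrr.
by rewrite ltnS in jk; rewrite ltnS jk addr0 hk.
Qed.

(** The successive approximations of an n-th root of 1/R have constant term 1/b and agree up to
the order already reached. *)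
Lemma hensel_approx R b : R`_0 = b ^+ n -> b != 0 ->
  exists P : nat -> {poly F},
   (forall k j, (j <= k)%N -> (R * P k ^+ n)`_j = (j == 0%N)%:R) /\
   (forall k j, (j <= k)%N -> (P k)`_j = (P j)`_j) /\ (P 0%N)`_0 != 0.
Proof.
move=> R0 b0.
pose ok k P := forall j, (j <= k)%N -> (R * P ^+ n)`_j = (j == 0%N)%:R.
have step k P : exists a, ok k P -> ok k.+1 (P + a *: 'X^(k.+1)).
  have [h|h] := pselect (ok k P); last by exists 0.
  by have [a ha] := hensel_step (h 0%N isT) h; exists a.
have [a aP] := boolp.choice (fun kP => step kP.1 kP.2).
pose P := fix P k := if k is k'.+1 then P k' + a (k', P k') *: 'X^k else (b^-1)%:P.
have okP k : ok k (P k).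
  elim: k => [|k IH]; last exact: (aP (k, P k)).
  move=> j; rewrite leqn0 => /eqP->; rewrite /= -polyC_exp coefMC R0 exprVn divff //.
  by rewrite expf_neq0.
exists P; split=> //; split; last by rewrite /= coefC eqxx invr_eq0.
move=> k j; elim: k => [|k IH]; first by rewrite leqn0 => /eqP->.
rewrite leq_eqVlt => /orP[/eqP->//|]; rewrite ltnS => jk.
by rewrite [P k.+1]/= coefD coefZ coefXn ltn_eqF ?ltnS // mulr0 addr0 IH.
Qed.

Lemma conv_coefM (s t : nat -> F) (P Q : {poly F}) k :
  (forall j, (j <= k)%N -> s j = P`_j) -> (forall j, (j <= k)%N -> t j = Q`_j) ->
  forall j, (j <= k)%N -> conv s t j = (P * Q)`_j.
Proof.
move=> sP tQ j jk; rewrite coefM /conv; apply: eq_bigr => a _.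
rewrite sP ?tQ //; first by rewrite (leq_trans (leq_subr _ _)).
by apply: leq_trans jk; rewrite -ltnS.
Qed.

Lemma conv_exp_coef (s : nat -> F) (P : {poly F}) k m :
  (forall j, (j <= k)%N -> s j = P`_j) ->
  forall j, (j <= k)%N -> iter m (conv s) (delta0 F) j = (P ^+ m)`_j.
Proof.
move=> sP; elim: m => [|m IH] j jk; first by rewrite expr0 coef1.
by rewrite iterS exprS; apply: (conv_coefM sP IH).
Qed.

Lemma conv0 (s t : nat -> F) : conv s t 0 = s 0%N * t 0%N.
Proof. by rewrite /conv big_ord_recl big_ord0 addr0 subn0. Qed.

Lemma conv_exp0 (s : nat -> F) m : iter m (conv s) (delta0 F) 0%N = s 0%N ^+ m.
Proof. by elim: m => [|m IH] //; rewrite iterS conv0 IH exprS. Qed.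

(** By Newton iteration, a nonzero Laurent series is an n-th power if and only if its degree is
divisible by n and its leading coefficient is an n-th power. *)
Lemma nth_power_classP c D i : size c = D.+1 ->
  nth_power_class n c (expansion ((fX F)^-1 ^ (- (i%:Z)))) <->
  (D = i %[mod n] /\ exists b, lead_coef c = b ^+ n).
Proof.
move=> sc; have c0 : lead_coef c != 0 by rewrite lead_coef_eq0 -size_poly_eq0 sc.
pose R := \poly_(k < D.+1) c`_(D - k).
have RE k : (if (k <= D)%N then c`_(D - k) else 0) = R`_k.
  by rewrite coef_poly ltnS.
have R0 : R`_0 = lead_coef c by rewrite -RE subn0 lead_coefE sc.
have eqE M s : (expansion ((fX F)^-1 ^ (- (i%:Z))) =
     laurent_mul (expansion c%:F) (laurent_exp (lau M s) n)) <->
    lau i%:Z (delta0 F) = lau (D%:Z + M *+ n) (conv (fun k => R`_k) (iter n (conv s) (delta0 F))).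
  rewrite expansion_Xn (expansion_poly sc) (laurent_exp_lau _ _ _ (expansion1 F)) laurent_mul_lau.
  by rewrite (funext RE).
split.
  move=> [h [hl hnz E]]; have [M [s [s0 hE]]] := laurent_lau hl hnz.
  move: E; rewrite hE => /eqE/lau_inj; rewrite conv0 conv_exp0 R0.
  have t0 : lead_coef c * s 0%N ^+ n != 0 by rewrite mulf_neq0 ?expf_neq0.
  case=> // [|EM Es]; first exact: oner_neq0.
  split; last first.
    exists (s 0%N)^-1; have := congr1 (fun f => f 0%N) Es.
    rewrite conv0 conv_exp0 R0 /delta0 eqxx => E; rewrite exprVn.
    by apply: (mulIf (expf_neq0 n s0)); rewrite mulVf ?expf_neq0 // -E.
  have : (D%:Z = i%:Z %[mod n%:Z])%Z.
    by rewrite EM -mulr_natr natz addrC modzMDl.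
  by rewrite !modz_nat => -[].
move=> [Di [b lb]].
have b0 : b != 0 by apply: contraNneq c0 => b0; rewrite lb b0 expr0n gtn_eqF.
have [P [hP [Pst P0]]] := hensel_approx (etrans R0 lb) b0.
pose s k := (P k)`_k.
have [M EM] : exists M : int, i%:Z = D%:Z + M *+ n.
  have /eqP : (i%:Z = D%:Z %[mod n%:Z])%Z by rewrite !modz_nat Di.
  rewrite eqz_mod_dvd => /dvdzP[M EM]; exists M.
  by rewrite -mulr_natr natz -EM addrC subrK.
exists (lau M s); split.
- by exists M => m Mm; rewrite /lau ifF //; apply/negbTE; rewrite -ltNge.
- by exists M; rewrite /lau lexx subrr absz0.
apply/eqE; rewrite EM; congr lau; apply/funext => k.
have sP j : (j <= k)%N -> s j = (P k)`_j by move=> jk; rewrite (Pst k j jk).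
rewrite (conv_coefM (fun j _ => erefl R`_j) (conv_exp_coef n sP)) //.
by rewrite hP.
Qed.

End PowerClass.

(** * The additive character of the finite field *)

Section Characters.
Variables (R : realType).

Definition cis (t : R) : R[i] := cos t +i* sin t.

Lemma cisD a b : cis (a + b) = cis a * cis b.
Proof. by rewrite /cis cosD sinD; simpc; congr (_ +i* _); rewrite addrC. Qed.

Lemma cis0 : cis 0 = 1.
Proof. by rewrite /cis cos0 sin0. Qed.

Lemma cis_periodic a k : cis (a + pi *+ 2 *+ k) = cis a.
Proof. by rewrite /cis (periodicn (@cosD2pi R)) (periodicn (@sinD2pi R)). Qed.

Lemma cis_neq1 t : 0 < t < pi *+ 2 -> cis t != 1.
Proof.
move=> /andP[t0 tpi]; pose u := t / 2.
have tu : t = u *+ 2 by rewrite /u -mulr_natr divfK ?pnatr_eq0.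
have su : 0 < sin u.
  by apply: sin_gt0_pi; rewrite divr_gt0 // ltr_pdivrMr // mulr_natr tpi.
rewrite /cis eq_complex /= negb_and; apply/orP; left.
rewrite tu cos_mulr2n cos2sin2; apply/negP => /eqP E.
have : sin u ^+ 2 = 0 by lra.
by move/eqP; rewrite sqrf_eq0 gt_eqF.
Qed.

Variables (F : finFieldType) (p : nat) (hp : p \in [pchar F]).

Lemma pchar_prime : prime p. Proof. exact: pcharf_prime hp. Qed.

Lemma abs_traceD a b : abs_trace hp (a + b) = abs_trace hp a + abs_trace hp b.
Proof. exact: (raddfD (@galTrace 'F_p (pPrimeCharType hp) 1%VS fullv)). Qed.

(** The trace is a Galois trace, hence lies in the prime field. *)
Lemma abs_trace_prime a : exists2 j, (j < p)%N & abs_trace hp a = j%:R.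
Proof.
have gal : @galois 'F_p (pPrimeCharType hp) 1%VS fullv.
  exact: (finField_galois (sub1v _)).
have : abs_trace hp a \in (1%VS : {vspace pPrimeCharType hp}).
  exact: (mem_galTrace gal (memvf _)).
move=> /vlineP[k ->]; exists k.
  by have := ltn_ord k; rewrite [X in (_ < X)%N](Fp_cast pchar_prime).
by rewrite -[LHS]/((k : nat)%:R * 1 : F) mulr1.
Qed.

Lemma trace_repP a : (trace_rep hp a < p)%N /\ abs_trace hp a = (trace_rep hp a)%:R.
Proof.
have [j jp Ej] := abs_trace_prime a.
have mem : abs_trace hp a \in [seq j%:R | j <- iota 0 p].
  by apply/mapP; exists j; rewrite ?mem_iota.
have lt : (trace_rep hp a < p)%N.
  by have := mem; rewrite -index_mem size_map size_iota.
split=> //; have := nth_index 0 mem.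
by rewrite (nth_map 0%N) ?size_iota // nth_iota.
Qed.

Lemma natr_pchar_mod j k : j%:R = k%:R :> F -> j = k %[mod p].
Proof.
wlog jk : j k / (j <= k)%N => [H|E].
  by have [/H//|/ltnW/H kj E] := leqP j k; apply/esym/kj.
apply/esym/eqP; rewrite eqn_mod_dvd // (dvdn_pcharf hp) natrB // E subrr.
exact: eqxx.
Qed.

Lemma e_oE a : e_o R hp a = cis (pi *+ 2 * (trace_rep hp a)%:R / p%:R).
Proof. by []. Qed.

Lemma p_neq0 : p%:R != 0 :> R.
Proof. by rewrite pnatr_eq0 -lt0n prime_gt0 // pchar_prime. Qed.

Lemma cis_natr_mod j k : j = k %[mod p] ->
  cis (pi *+ 2 * j%:R / p%:R) = cis (pi *+ 2 * k%:R / p%:R).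
Proof.
have red m : cis (pi *+ 2 * m%:R / p%:R) = cis (pi *+ 2 * (m %% p)%N%:R / p%:R).
  rewrite [in LHS](divn_eq m p) natrD natrM mulrDr mulrDl addrC.
  have -> : pi *+ 2 * ((m %/ p)%:R * p%:R) / p%:R = pi *+ 2 *+ (m %/ p)%N :> R.
    by rewrite mulrA mulfK ?p_neq0 // mulr_natr.
  exact: cis_periodic.
by move=> jk; rewrite red jk -red.
Qed.

Lemma e_oD a b : e_o R hp (a + b) = e_o R hp a * e_o R hp b.
Proof.
rewrite !e_oE -cisD -mulrDl -mulrDr -natrD; apply: cis_natr_mod.
have [_ Ea] := trace_repP a; have [_ Eb] := trace_repP b; have [_ Eab] := trace_repP (a + b).
by apply: natr_pchar_mod; rewrite natrD -Ea -Eb -Eab abs_traceD.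
Qed.

(** The trace is not identically 0, by the linear independence of automorphisms. *)
Lemma e_o_nontrivial : exists a, e_o R hp a != 1.
Proof.
pose L := pPrimeCharType hp.
have [|a _] := @gal_independent_contra 'F_p L fullv [in 'Gal({:L} / 1%VS)%g] (fun=> 1) 1%g (group1 _).
  exact: oner_neq0.
under eq_bigr do rewrite mul1r.
move=> nz; exists a; have [lt E] := trace_repP a.
have t0 : (0 < trace_rep hp a)%N.
  rewrite lt0n; apply/eqP => t0; rewrite t0 in E.
  by move: nz; rewrite -[X in X != 0]/(abs_trace hp a) E eqxx.
have p0 : 0 < p%:R :> R by rewrite ltr0n prime_gt0 // pchar_prime.
have pi2 : 0 < pi *+ 2 :> R by rewrite pmulrn_lgt0 // pi_gt0.
rewrite e_oE; apply: cis_neq1; apply/andP; split.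
  by apply: divr_gt0 => //; apply: mulr_gt0 => //; rewrite ltr0n.
by rewrite ltr_pdivrMr // ltr_pM2l // ltr_nat.
Qed.

End Characters.

(** * Complex powers of q and rational functions of them *)

Section ComplexAnalysis.
Import numFieldNormedType.Exports.
Local Open Scope classical_set_scope.
Variable R : realType.
Local Notation C := (R[i]).
Implicit Types (z w : C).

Lemma norm_i : `|'i : C| = 1.
Proof. by rewrite normc_def /= expr0n /= expr1n add0r sqrtr1. Qed.

Lemma normc_le_sum (a b : R) : `|a +i* b| <= (`|a| + `|b|)%:C.
Proof.
have -> : a +i* b = a%:C + 'i * b%:C by simpc.
apply: le_trans (ler_normD _ _) _; rewrite normrM.
have nr (x : R) : `|x%:C| = `|x|%:C by rewrite normc_def /= expr0n /= addr0 sqrtr_sqr.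
by rewrite norm_i mul1r !nr rmorphD.
Qed.

Lemma ltcR (a b : R) : (a%:C < b%:C :> C) = (a < b).
Proof. by rewrite ltcE /= eqxx. Qed.

Lemma lecR (a b : R) : (a%:C <= b%:C :> C) = (a <= b).
Proof. by rewrite lecE /= eqxx. Qed.

Lemma gt0_real z : 0 < z -> exists2 e : R, 0 < e & z = e%:C.
Proof.
case: z => a b; rewrite ltcE /= => /andP[/eqP b0 a0].
by exists a => //; rewrite b0.
Qed.

Lemma cvg_complex (T : Type) (G : set_system T) {FG : Filter G} (a b : T -> R) (a0 b0 : R) :
  a @ G --> a0 -> b @ G --> b0 ->
  ((fun t => a t +i* b t) : T -> C^o) @ G --> ((a0 +i* b0 : C) : C^o).
Proof.
move=> ca cb; apply/cvgrPdist_lt => e /gt0_real[d d0 ->].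
have d2 : 0 < d / 2 by rewrite divr_gt0.
move/cvgrPdist_lt/(_ _ d2): ca => ca; move/cvgrPdist_lt/(_ _ d2): cb => cb.
near=> t; have -> : (a0 +i* b0 - (a t +i* b t) : C) = (a0 - a t) +i* (b0 - b t) by simpc.
apply: le_lt_trans (normc_le_sum _ _) _; rewrite ltcR [d]splitr ltrD //; near: t.
  exact: ca.
exact: cb.
Unshelve. all: by end_near. Qed.

Lemma cvg_Re (s0 : C^o) : (fun s : C^o => complex.Re (s : C)) @ s0 --> (complex.Re (s0 : C) : R).
Proof.
have FF : Filter (nbhs s0) by exact: nbhs_filter.
apply/(@cvgrPdist_lt _ _ _ _ FF) => e e0.
have e0' : 0 < e%:C :> C by rewrite ltcR.
have hb := @nbhsx_ballx _ C^o s0 _ e0'; apply: filterS hb => s.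
rewrite -ball_normE /= => hs; rewrite -ltcR; apply: le_lt_trans hs.
have -> : complex.Re (s0 : C) - complex.Re (s : C) = complex.Re ((s0 : C) - (s : C)).
  by case: (s0 : C) (s : C) => [? ?] [? ?].
exact: normc_ge_Re.
Qed.

Lemma cvg_Im (s0 : C^o) : (fun s : C^o => complex.Im (s : C)) @ s0 --> (complex.Im (s0 : C) : R).
Proof.
have FF : Filter (nbhs s0) by exact: nbhs_filter.
apply/(@cvgrPdist_lt _ _ _ _ FF) => e e0.
have e0' : 0 < e%:C :> C by rewrite ltcR.
have hb := @nbhsx_ballx _ C^o s0 _ e0'; apply: filterS hb => s.
rewrite -ball_normE /= => hs; rewrite -ltcR; apply: le_lt_trans hs.
have -> : complex.Im (s0 : C) - complex.Im (s : C) = complex.Re (('i : C) * ((s : C) - (s0 : C))).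
  by case: (s0 : C) (s : C) => [? ?] [? ?] /=; ring.
apply: le_trans (normc_ge_Re _) _; rewrite normrM distrC.
by rewrite norm_i mul1r.
Qed.

Lemma cvg_horner (T : Type) (G : set_system T) {FG : Filter G} (u : T -> C^o) (u0 : C) (P : {poly C}) :
  u @ G --> (u0 : C^o) -> ((fun t => P.[u t] : C^o) @ G --> (P.[u0] : C^o)).
Proof.
move=> cu; elim/poly_ind: P => [|P c IH].
  by under eq_fun do rewrite horner0; rewrite horner0; exact: cvg_cst.
under eq_fun do rewrite hornerMXaddC.
rewrite hornerMXaddC.
have cM := @cvgM _ _ G FG _ _ _ _ IH cu.
exact: (@cvgD _ _ _ G FG _ _ _ _ cM (@cvg_cst _ (c : C^o) _ G FG)).
Qed.

End ComplexAnalysis.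

Section QPow.
Import numFieldNormedType.Exports.
Local Open Scope classical_set_scope.
Variables (R : realType) (F : finFieldType).
Local Notation C := (R[i]).
Local Notation q := #|F|.
Local Notation L := (ln (q%:R : R)).
Implicit Types (z w s : C).

Lemma qpowE z : qpow F z = (expR (complex.Re z * L))%:C * cis (complex.Im z * L).
Proof. by []. Qed.

Lemma card_gt1R : 1 < q%:R :> R.
Proof. by rewrite ltr1n; apply: finNzRing_gt1. Qed.

Lemma lnq_gt0 : 0 < L.
Proof. by rewrite ln_gt0 // card_gt1R. Qed.

Lemma qpowD z w : qpow F (z + w) = qpow F z * qpow F w.
Proof.
rewrite !qpowE; case: z w => [a b] [c d] /=.
by rewrite !mulrDl expRD cisD rmorphM /= mulrACA.
Qed.

Lemma qpow0 : qpow F (0 : C) = 1.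
Proof. by rewrite qpowE /= !mul0r expR0 cis0 mulr1. Qed.

Lemma qpowMn k z : qpow F (k%:R * z) = qpow F z ^+ k.
Proof.
elim: k => [|k IH]; first by rewrite mul0r qpow0 expr0.
by rewrite -natr1 mulrDl mul1r qpowD IH exprSr.
Qed.

Lemma qpow_nat k : qpow F (k%:R : C) = (q ^ k)%:R.
Proof.
rewrite -[k%:R]mulr1 qpowMn natrX; congr (_ ^+ _).
rewrite qpowE /= mul0r cis0 mulr1 mul1r lnK ?posrE ?(lt_trans _ card_gt1R) //.
by rewrite rmorph_nat.
Qed.

Lemma norm_cis (t : R) : `|cis t| = 1.
Proof. by rewrite normc_def /= cos2Dsin2 sqrtr1. Qed.

Lemma norm_qpow z : `|qpow F z| = (expR (complex.Re z * L))%:C.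
Proof.
rewrite qpowE normrM norm_cis mulr1 normc_def /= expr0n /= addr0 sqrtr_sqr.
by rewrite gtr0_norm // expR_gt0.
Qed.

Lemma qpow_neq0 z : qpow F z != 0.
Proof. by rewrite -normr_gt0 norm_qpow ltcR expR_gt0. Qed.

Lemma qpow_lt1 z : complex.Re z < 0 -> `|qpow F z| < 1.
Proof.
move=> z0; rewrite norm_qpow; have -> : (1 : C) = (1 : R)%:C by [].
by rewrite ltcR expR_lt1 nmulr_rlt0 // lnq_gt0.
Qed.

Lemma cvg_qpow (s0 : C^o) : (fun s : C^o => qpow F (- (s : C)) : C^o) @ s0 --> (qpow F (- (s0 : C)) : C^o).
Proof.
have FF : Filter (nbhs s0) by exact: nbhs_filter.
have E s : qpow F (- s) = (expR (- (complex.Re s * L)) * cos (- (complex.Im s * L))) +i*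
    (expR (- (complex.Re s * L)) * sin (- (complex.Im s * L))).
  by rewrite qpowE /cis; case: s => [a b]; rewrite /= !mulNr; simpc.
rewrite E; under eq_fun do rewrite E.
have cR : (fun s : C^o => - (complex.Re (s : C) * L)) @ s0 --> - (complex.Re (s0 : C) * L).
  by apply: cvgN; apply: cvgMl; apply: cvg_Re.
have cI : (fun s : C^o => - (complex.Im (s : C) * L)) @ s0 --> - (complex.Im (s0 : C) * L).
  by apply: cvgN; apply: cvgMl; apply: cvg_Im.
have ce : (fun s : C^o => expR (- (complex.Re (s : C) * L))) @ s0 -->
    expR (- (complex.Re (s0 : C) * L)).
  exact: (@continuous_cvg C^o R R (nbhs s0) FF _ (@expR R) _ (@continuous_expR R _) cR).
have cc : (fun s : C^o => cos (- (complex.Im (s : C) * L))) @ s0 -->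
    cos (- (complex.Im (s0 : C) * L)).
  exact: (@continuous_cvg C^o R R (nbhs s0) FF _ (@cos R) _ (@continuous_cos R _) cI).
have cs : (fun s : C^o => sin (- (complex.Im (s : C) * L))) @ s0 -->
    sin (- (complex.Im (s0 : C) * L)).
  exact: (@continuous_cvg C^o R R (nbhs s0) FF _ (@sin R) _ (@continuous_sin R _) cI).
exact: (@cvg_complex R _ _ FF _ _ _ _ (@cvgM _ _ _ FF _ _ _ _ ce cc) (@cvgM _ _ _ FF _ _ _ _ ce cs)).
Qed.

(** The imaginary period of q^z is 2 pi / log q, which is more than 1 / log q. *)
Lemma qpow_eq1 z : qpow F z = 1 -> `|complex.Im z| * L < 1 -> z = 0.
Proof.
move=> E im; have : expR (complex.Re z * L) = expR 0.
  by rewrite expR0; apply: complexI; rewrite -norm_qpow E normr1.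
move=> /expR_inj/eqP; rewrite mulf_eq0 => /orP[/eqP re0|/eqP L0]; last first.
  by have := lnq_gt0; rewrite L0 ltxx.
move: E; rewrite qpowE re0 mul0r expR0 mul1r => E.
have pi2 : 1 < pi *+ 2 :> R by have := pi_ge2 R; rewrite mulr2n; lra.
have im0 : complex.Im z = 0.
  apply/eqP; apply: contraT => im0.
  have : cis (`|complex.Im z| * L) != 1.
    apply: cis_neq1; rewrite mulr_gt0 ?normr_gt0 ?lnq_gt0 //=.
    exact: lt_trans pi2.
  case: (lerP 0 (complex.Im z)) => [i0|i0]; first by rewrite ger0_norm // E eqxx.
  rewrite ltr0_norm // mulNr; move: E; rewrite /cis cosN sinN => -[-> ->].
  by rewrite oppr0 eqxx.
by case: z re0 im0 {im E} => a b /= -> ->.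
Qed.

(** [qpow_eq1] applies to s - s0 as soon as the imaginary parts are close. *)
Lemma near_qpow_neq (s0 : C) : \forall s \near (s0 : C^o)^', qpow F (- (s : C)) != qpow F (- s0).
Proof.
have FF : Filter (nbhs (s0 : C^o)) by exact: nbhs_filter.
have L0 := lnq_gt0; have iL : 0 < L^-1 by rewrite invr_gt0.
have h := @cvgr_dist_lt _ _ _ _ FF _ _ (@cvg_Im R (s0 : C^o)) _ iL.
near=> s; apply/negP => /eqP E.
have : qpow F ((s : C) - s0) = 1.
  apply: (mulIf (qpow_neq0 (- (s : C)))); rewrite -qpowD mul1r E; congr qpow.
  by rewrite addrAC subrr add0r.
move/qpow_eq1 => H.
have : (s : C) != s0 by near: s; apply: (@nbhs_dnbhs_neq C^o s0).
rewrite -subr_eq0 H ?eqxx //.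
have -> : complex.Im ((s : C) - s0) = complex.Im (s : C) - complex.Im s0.
  by case: (s : C) (s0) => [? ?] [? ?].
rewrite distrC -ltr_pdivlMr // mul1r; near: s.
by apply: nbhs_dnbhs; exact: h.
Unshelve. all: by end_near. Qed.

(** Where q^(-s0) is a root of B, the corresponding linear factors do not vanish off s0 by
[near_qpow_neq]. *)
Lemma near_horner_qpow_neq0 (s0 : C) (B : {poly C}) : B != 0 ->
  \forall s \near (s0 : C^o)^', B.[qpow F (- (s : C))] != 0.
Proof.
move=> B0; have FF : Filter (nbhs (s0 : C^o)) by exact: nbhs_filter.
have [m [B1 nB1 EB]] := multiplicity_XsubC B (qpow F (- s0)).
rewrite B0 /= in nB1.
have n0 : 0 < `|B1.[qpow F (- s0)]| by rewrite normr_gt0.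
have cB := @cvg_horner R _ _ FF _ _ B1 (@cvg_qpow (s0 : C^o)).
have h := @cvgr_dist_lt _ _ _ _ FF _ _ cB _ n0.
near=> s; rewrite EB hornerM mulf_neq0 //.
  apply/eqP => E; have : `|B1.[qpow F (- s0)] - B1.[qpow F (- (s : C))]| < `|B1.[qpow F (- s0)]|.
    by near: s; apply: nbhs_dnbhs; exact: h.
  by rewrite E subr0 ltxx.
rewrite horner_exp expf_neq0 // hornerXsubC subr_eq0; near: s.
exact: near_qpow_neq.
Unshelve. all: by end_near. Qed.

End QPow.

(** * Continuation and residues of the Dirichlet series *)

Section Transfer.
Import numFieldNormedType.Exports.
Local Open Scope classical_set_scope.
Variables (R : realType) (F : finFieldType) (n : nat).
Hypothesis hn : (0 < n)%N.
Local Notation C := (R[i]).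
Local Notation q := #|F|.

(** Along each residue class modulo n the sequence is geometric. *)
Lemma cvg_geometric_recursion (E : nat -> C) (w : C) D0 : `|w| < 1 ->
  (forall N, (D0 <= N)%N -> E (N + n)%N = w * E N) ->
  (fun N => E N : C^o) @ \oo --> ((0 : C) : C^o).
Proof.
move=> w1 hE; pose B := \sum_(j < n) `|E (D0 + j)%N|.
have B0 : 0 <= B by apply: sumr_ge0 => j _; apply: normr_ge0.
have Ew k j : E (D0 + j + k * n)%N = w ^+ k * E (D0 + j)%N.
  elim: k => [|k IH]; first by rewrite mul0n addn0 expr0 mul1r.
  rewrite mulSn addnCA addnC hE ?IH ?exprS ?mulrA //.
  by rewrite -addnA leq_addr.
have bound k j : (j < n)%N -> `|E (D0 + j + k * n)%N| <= `|w| ^+ k * B.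
  move=> jn; rewrite Ew normrM normrX ler_wpM2l ?exprn_ge0 //.
  rewrite /B (bigD1 (Ordinal jn)) //= lerDl.
  by apply: sumr_ge0 => i _; apply: normr_ge0.
have [rho Erho] : exists rho : R, `|w| = rho%:C by rewrite normc_def; eexists.
have [b Eb] : exists b : R, B = b%:C.
  by move: B0; case: (B) => x y; rewrite lecE /= => /andP[/eqP-> _]; exists x.
have rho0 : 0 <= rho by rewrite -lecR -Erho normr_ge0.
have rho1 : rho < 1 by rewrite -ltcR -Erho.
apply/cvgrPdist_lt => e /gt0_real[d d0 ->].
have [K HK] : exists K, rho ^+ K * b < d.
  have : (fun k => rho ^+ k * b) @ \oo --> (0 * b : R).
    by apply: cvgMl; apply: cvg_expr; rewrite ger0_norm.
  rewrite mul0r => /cvgrPdist_lt/(_ _ d0)[K _ HK]; exists K.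
  have := HK K (leqnn K); rewrite /= sub0r normrN; apply: le_lt_trans; exact: ler_norm.
exists (D0 + K * n)%N => //= N DN.
have [m EN] : exists m, N = (D0 + m)%N by exists (N - D0)%N; rewrite subnKC // (leq_trans _ DN) ?leq_addr.
rewrite sub0r normrN EN (divn_eq m n) addnA addnAC.
apply: le_lt_trans (bound _ _ (ltn_pmod m hn)) _.
rewrite Erho Eb -rmorphXn -rmorphM ltcR; apply: le_lt_trans HK.
have b0 : 0 <= b by rewrite -lecR -Eb.
rewrite ler_wpM2r // ler_wiXn2l // ?ltW //.
by rewrite leq_divRL // -(leq_add2l D0) -EN.
Qed.

(** The sum l must satisfy l - S_D0 = T + w (l - S_D0), where S_D0 is the sum of the first D0
terms and T that of the n following ones.  With this value of l the remainders satisfy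
a geometric recursion. *)
Lemma cvg_series_recursion (f : nat -> C) (w : C) D0 : `|w| < 1 ->
  (forall d, (D0 <= d)%N -> f (d + n)%N = w * f d) ->
  cvgn (series f : nat -> C^o).
Proof.
move=> w1 hf; pose T := \sum_(j < n) f (D0 + j)%N.
have w1' : 1 - w != 0.
  by rewrite subr_eq0; apply: contraTneq w1 => <-; rewrite normr1 ltxx.
pose l := series f D0 + T / (1 - w).
have hT : series f (D0 + n)%N = series f D0 + T.
  rewrite /series /= /T; elim: (n) => [|k IH]; first by rewrite addn0 big_ord0 addr0.
  by rewrite addnS big_nat_recr //= IH big_ord_recr /= addrA.
have rec N : (D0 <= N)%N -> series f (N + n)%N - l = w * (series f N - l).
  move=> /subnKC <-; elim: (N - D0)%N => [|k IH].
    rewrite addn0 hT /l; field; exact: w1'.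
  have S (M : nat) : series f M.+1 = series f M + f M by rewrite /series /= big_nat_recr.
  rewrite addnS addSn !S hf ?leq_addr //.
  have -> : series f (D0 + k + n) + w * f (D0 + k)%N - l =
     series f (D0 + k + n) - l + w * f (D0 + k)%N by ring.
  by rewrite IH; ring.
have h0 := @cvg_geometric_recursion (fun N => series f N - l) w D0 w1 rec.
apply/cvg_ex; exists l.
have -> : (series f : nat -> C^o) = (fun N => (series f N - l : C^o) + (l : C^o)).
  by apply/funext => N; rewrite subrK.
rewrite -[X in _ --> X](add0r (l : C^o)).
exact: (cvgD h0 (@cvg_cst _ (l : C^o) _ _ _)).
Qed.

Definition dirichlet (a : nat -> C) (s : C) : C :=
  (1 - qpow F (n%:R - n%:R * s))^-1 *
  limn (series (fun d => a d * qpow F (- (d%:R * s))) : nat -> C^o).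

Definition continuation_residue (Psi : C -> C) (v : C) : Prop :=
  exists f, (exists A B : {poly C}, [/\ B != 0,
    forall s, 3%:R / 2%:R < complex.Re s -> B.[qpow F (- s)] * Psi s = A.[qpow F (- s)]
    & forall s, f s = A.[qpow F (- s)] / B.[qpow F (- s)]]) /\
    simple_residue f (1 + n%:R^-1) v.

Lemma Re_nat k : complex.Re (k%:R : C) = k%:R.
Proof. by rewrite -(rmorph_nat (real_complex R)). Qed.

Lemma Re_natM k (s : C) : complex.Re (k%:R * s) = k%:R * complex.Re s.
Proof. by rewrite -(rmorph_nat (real_complex R)); case: s => a b /=; rewrite mul0r subr0. Qed.

Lemma ReB (z w : C) : complex.Re (z - w) = complex.Re z - complex.Re w.
Proof. by case: z w => [? ?] [? ?]. Qed.

Lemma half3_gt1 : 1 < 3%:R / 2%:R :> R.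
Proof. by rewrite ltr_pdivlMr ?ltr0n // mul1r ltr_nat. Qed.

Lemma qpow_zeta (s : C) : qpow F (n%:R - n%:R * s) = (q ^ n)%:R * qpow F (- s) ^+ n.
Proof. by rewrite qpowD qpow_nat -mulrN qpowMn. Qed.

Lemma zeta_neq0 (s : C) : 1 < complex.Re s -> 1 - (q ^ n)%:R * qpow F (- s) ^+ n != 0.
Proof.
move=> s1; rewrite -qpow_zeta subr_eq0.
have : `|qpow F (n%:R - n%:R * s)| < 1.
  apply: qpow_lt1; rewrite ReB Re_natM Re_nat subr_lt0.
  by rewrite -[ltLHS]mulr1 ltr_pM2l ?ltr0n.
by apply: contraTneq => <-; rewrite normr1 ltxx.
Qed.

(** The correction is a rational function of q^(-s) whose denominator 1 - q^(n-ns) does not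
vanish for Re s > 1, so it is continued with the series and adds no residue at 1 + 1/n. *)
Lemma continuation_residue_transfer (Psi Psi' : C -> C) (Q : {poly C}) v :
  (forall s, 3%:R / 2%:R < complex.Re s ->
    Psi' s = Psi s + (1 - qpow F (n%:R - n%:R * s))^-1 * Q.[qpow F (- s)]) ->
  continuation_residue Psi v -> continuation_residue Psi' v.
Proof.
move=> hPsi [f [[A [B [B0 hB hf]]] hres]].
pose Z : {poly C} := 1 - (q ^ n)%:R *: 'X^n.
have ZE s : Z.[qpow F (- s)] = 1 - (q ^ n)%:R * qpow F (- s) ^+ n.
  by rewrite /Z !hornerE.
have Z0 : Z != 0.
  have := @zeta_neq0 2%:R; rewrite Re_nat ltr1n -ZE => /(_ isT).
  by apply: contraNneq => ->; rewrite horner0.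
clearbody Z; pose A' := A * Z + B * Q; pose B' := B * Z.
exists (fun s => A'.[qpow F (- s)] / B'.[qpow F (- s)]); split.
  exists A', B'; split=> // [|s s32]; first by rewrite mulf_neq0.
  have Zs : Z.[qpow F (- s)] != 0.
    by rewrite ZE zeta_neq0 // (lt_trans half3_gt1 s32).
  rewrite hPsi // qpow_zeta -ZE /A' /B' !hornerD !hornerM -hB //.
  have comm (b z y w : C) : z != 0 -> b * z * (y + z^-1 * w) = b * y * z + b * w.
    by move=> z0; field.
  exact: comm.
move: hres; rewrite /simple_residue; set s0 := 1 + n%:R^-1 => hres.
have FF : Filter (nbhs (s0 : C^o)^') by exact: dnbhs_filter.
have FF' : Filter (nbhs (s0 : C^o)) by exact: nbhs_filter.
have Zs0 : Z.[qpow F (- s0)] != 0.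
  rewrite ZE zeta_neq0 // /s0 -(rmorph_nat (real_complex R)) -fmorphV.
  by rewrite /= ltrDl invr_gt0 ltr0n.
have cu := @cvg_qpow R F (s0 : C^o).
have cQ := @cvg_horner R _ _ FF' _ _ Q cu.
have cZ := @cvg_horner R _ _ FF' _ _ Z cu.
have cZV : (fun s : C^o => (Z.[qpow F (- (s : C))])^-1 : C^o) @ (s0 : C^o) --> ((Z.[qpow F (- s0)])^-1 : C^o).
  exact: (@cvgV _ _ _ FF' _ _ Zs0 cZ).
have cQZ := @cvgM _ _ _ FF' _ _ _ _ cQ cZV.
have cs : (fun s : C^o => ((s : C) - s0) : C^o) @ (s0 : C^o) --> ((s0 - s0 : C) : C^o).
  exact: (@cvgB _ _ _ _ FF' _ _ _ _ (@cvg_id _ _) (@cvg_cst _ (s0 : C^o) _ _ FF')).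
have cT := @cvgM _ _ _ FF' _ _ _ _ cs cQZ.
have cT' : (fun s : C^o => (((s : C) - s0) * (Q.[qpow F (- (s : C))] / Z.[qpow F (- (s : C))])) : C^o)
   @ (s0 : C^o)^' --> ((0 : C) : C^o).
  move: cT; rewrite subrr mul0r; exact: cvg_trans (cvg_app _ (@nbhs_dnbhs _ (s0 : C^o))).
have cS := @cvgD _ _ _ _ FF _ _ _ _ hres cT'.
rewrite addr0 in cS.
apply: cvg_trans cS; apply: near_eq_cvg.
have nB := @near_horner_qpow_neq0 R F s0 B B0.
have nZ := @near_horner_qpow_neq0 R F s0 Z Z0.
near=> s; rewrite /=.
have Bs : B.[qpow F (- (s : C))] != 0 by near: s; exact: nB.
have Zs : Z.[qpow F (- (s : C))] != 0 by near: s; exact: nZ.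
rewrite (_ : (_ + _) _ = (s - s0) * f s + (s - s0) * (Q.[qpow F (- s)] / Z.[qpow F (- s)])) //.
rewrite hf /A' /B' hornerD !hornerM.
have comm (x a b c z : C) : b != 0 -> z != 0 ->
  x * (a / b) + x * (c / z) = x * ((a * z + b * c) / (b * z)).
  by move=> b0 z0; field; apply/andP.
exact: comm.
Unshelve. all: by end_near. Qed.

(** The recursion gives convergence only where q^(n+1) q^(-ns) has absolute value
less than 1, that is Re s > 1 + 1/n; for n = 1 this would leave out a part of the half
plane Re s > 3/2, hence the alternative. *)
Lemma residue_eq (a a' : nat -> C) D0 v :
  (forall d, (D0 <= d)%N -> a d = a' d) ->
  (forall d, (D0 <= d)%N -> a d = 0) \/
    ((1 < n)%N /\ forall d, (D0 <= d)%N -> a (d + n)%N = (q ^ n.+1)%:R * a d) ->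
  continuation_residue (dirichlet a) v -> continuation_residue (dirichlet a') v.
Proof.
move=> aa' ha.
pose Q : {poly C} := \poly_(d < D0) (a' d - a d).
apply: (@continuation_residue_transfer _ _ Q) => s s32.
pose u := qpow F (- s).
have uE d : qpow F (- (d%:R * s)) = u ^+ d by rewrite -mulrN qpowMn.
rewrite /dirichlet -mulrDr; congr (_ * _).
have ES N : (D0 <= N)%N -> series (fun d => a' d * qpow F (- (d%:R * s))) N =
    series (fun d => a d * qpow F (- (d%:R * s))) N + Q.[u].
  move=> DN; rewrite /series /= !(big_cat_nat (leq0n D0) DN) //= [RHS]addrAC.
  congr (_ + _); last first.
    by apply: eq_big_nat => d /andP[Dd _]; rewrite aa'.
  rewrite horner_poly !big_mkord -big_split /=; apply: eq_bigr => d _.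
  by rewrite uE -mulrDl addrC subrK.
have cv : cvgn (series (fun d => a d * qpow F (- (d%:R * s))) : nat -> C^o).
  case: ha => [a0|[n1 rec]].
    apply: (@cvg_series_recursion _ 0 D0); first by rewrite normr0.
    by move=> d Dd; rewrite a0 ?mul0r // (leq_trans Dd) // leq_addr.
  apply: (@cvg_series_recursion _ ((q ^ n.+1)%:R * u ^+ n) D0).
    rewrite -(qpow_nat R) -qpowMn -qpowD mulrN; apply: qpow_lt1.
    rewrite ReB Re_natM Re_nat subr_lt0; apply: le_lt_trans (_ : _ <= n%:R * (3%:R / 2%:R)) _.
      rewrite mulrA ler_pdivlMr ?ltr0n // -!natrM ler_nat; move: n1; clear; lia.
    by rewrite ltr_pM2l ?ltr0n.
  move=> d Dd; rewrite rec // !uE exprD; ring.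
move/cvg_ex: cv => [l cl]; have -> := cvg_lim (@norm_hausdorff _ C^o) cl.
apply: (@cvg_lim _ (@norm_hausdorff _ C^o)).
have FO : Filter eventually := eventually_filter.
have cD := @cvgD _ _ _ _ FO _ _ _ _ cl (@cvg_cst _ (Q.[u] : C^o) _ _ FO).
apply: cvg_trans cD; apply: near_eq_cvg.
by exists D0 => // N DN /=; rewrite ES.
Qed.

End Transfer.

(** * The twist of rational functions *)

Section Substitution.
Variables (F : finFieldType) (al be ga de : F).
Hypothesis Delta0 : al * de - be * ga != 0.
Local Notation "f %:F" := (FracField.tofrac f).
Local Notation Delta := (al * de - be * ga).
Local Notation J := (mden ga de).
Local Notation htr := (htr al be ga de).
Local Notation t := ((mnum al be)%:F / J%:F).
Implicit Types P Q : {poly F}.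

Definition meval P : {fraction {poly F}} := (map_poly (@fcst F) P).[t].

Lemma meval_morph : exists ev : {rmorphism {poly F} -> {fraction {poly F}}},
  forall P, ev P = meval P.
Proof.
pose tf : {rmorphism {poly F} -> {fraction {poly F}}} := @FracField.tofrac {poly F}.
by exists (horner_eval t \o map_poly (tf \o polyC)).
Qed.

Lemma mevalM P Q : meval (P * Q) = meval P * meval Q.
Proof. by have [ev evE] := meval_morph; rewrite -!evE rmorphM. Qed.

Lemma mevalX P k : meval (P ^+ k) = meval P ^+ k.
Proof. by have [ev evE] := meval_morph; rewrite -!evE rmorphXn. Qed.

Lemma meval_const (a : F) : meval a%:P = fcst a.
Proof.
pose tf : {rmorphism {poly F} -> {fraction {poly F}}} := @FracField.tofrac {poly F}.
have -> : meval a%:P = (map_poly (tf \o polyC) a%:P).[t] by [].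
by rewrite map_polyC hornerC.
Qed.

Lemma meval_htr k P : (size P <= k.+1)%N -> (htr k P)%:F = J%:F ^+ k * meval P.
Proof.
move=> sP.
exact: (@htr_morph _ al be _ _ _ (@FracField.tofrac {poly F}) k P (tofrac_mden_neq0 Delta0) sP).
Qed.

Lemma htr_neq0 k P : P != 0 -> (size P <= k.+1)%N -> htr k P != 0.
Proof.
move=> P0 sP; apply: contra P0 => /eqP E.
have := htrK Delta0 sP; rewrite E -(scale0r 0) htrZ !scale0r => /esym/eqP.
by rewrite scaler_eq0 expf_eq0 (negPf Delta0) andbF.
Qed.

Lemma meval_eq0 P : P != 0 -> meval P != 0.
Proof.
move=> P0; have h := htr_neq0 P0 (leqnSn (size P)).
rewrite -tofrac_eq0 (meval_htr (leqnSn (size P))) in h.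
by apply: contraNneq h => E; rewrite E mulr0 eqxx.
Qed.

(** A substitution is defined by the chosen numerator and denominator, but any
representation of the fraction gives the same value, as t is not a root of any nonzero
polynomial. *)
Lemma fsubst_frac P Q : Q != 0 -> fsubst (P%:F / Q%:F) t = meval P / meval Q.
Proof.
move=> Q0; have D0 := denom_neq0 (P%:F / Q%:F).
have := congr1 meval (numden_cross Q0 (erefl (P%:F / Q%:F))).
rewrite !mevalM /fsubst -!/(meval _).
move: (meval_eq0 Q0) (meval_eq0 D0).
have key (A : fieldType) (x y z w : A) : y != 0 -> w != 0 -> x * y = z * w -> x / w = z / y.
  by move=> y0 w0 E; apply: (canRL (mulfK y0)); rewrite mulrAC E mulfK.
exact: key.
Qed.

End Substitution.

Section Twist.
Variables (F : finFieldType).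
Local Notation "f %:F" := (FracField.tofrac f).
Implicit Types (P Q : {poly F}) (g : 'M[F]_2) (r : {fraction {poly F}}).

Definition msubst g r := fsubst r ((mnum (g 0 0) (g 0 1))%:F / (mden (g 1 0) (g 1 1))%:F).

(** The derivative of the Moebius transformation. *)
Definition automorphy g : {fraction {poly F}} :=
  fcst (\det g) / (mden (g 1 0) (g 1 1))%:F ^+ 2.

Lemma det2 g : \det g = g 0 0 * g 1 1 - g 0 1 * g 1 0.
Proof. rewrite (expand_det_row _ ord0) !big_ord_recl big_ord0 /cofactor !det_mx11 !mxE /=.
rewrite expr0 expr1 mul1r mulN1r mulrN addr0.
by congr (g _ _ * g _ _ - g _ _ * g _ _); apply/val_inj.
Qed.

Lemma tofrac_linear (a b : F) : fcst a * fX F + fcst b = (a *: 'X + b%:P)%:F.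
Proof. by rewrite /fcst /fX -tofracM -tofracD mul_polyC. Qed.

Lemma mx2_unit g : (g \in unitmx) = (g 0 0 * g 1 1 - g 0 1 * g 1 0 != 0).
Proof. by rewrite unitmxE unitfE det2. Qed.

Lemma automorphy_neq0 g : g \in unitmx -> automorphy g != 0.
Proof.
move=> gU; rewrite /automorphy; apply: mulf_neq0.
  by rewrite /fcst tofrac_eq0 polyC_eq0 -unitfE -unitmxE.
rewrite invr_eq0; apply: expf_neq0; rewrite mx2_unit in gU.
exact: tofrac_mden_neq0 gU.
Qed.

Lemma twistE g r (i : nat) : g \in unitmx ->
  twist g r i%:Z = msubst g r * (automorphy g / automorphy g ^+ i).
Proof.
move=> gU; rewrite /twist !tofrac_linear; congr (_ * _).
have key (A : fieldType) (x : A) : x != 0 -> x ^ (1 - i%:Z) = x / x ^+ i.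
  by move=> x0; rewrite expfzDr // expr1z -exprnN.
exact: key (automorphy_neq0 gU).
Qed.

Lemma fraction_exists r : exists P Q, Q != 0 /\ r = P%:F / Q%:F.
Proof.
exists (numer r), (denom r); split; first exact: denom_neq0.
exact: fraction_numden.
Qed.

Section Action.
Variable g : 'M[F]_2.
Hypothesis gU : g \in unitmx.

Let D0 : g 0 0 * g 1 1 - g 0 1 * g 1 0 != 0.
Proof. by rewrite -mx2_unit. Qed.

Local Notation mev := (meval (g 0 0) (g 0 1) (g 1 0) (g 1 1)).

Lemma msubst_frac P Q : Q != 0 -> msubst g (P%:F / Q%:F) = mev P / mev Q.
Proof. exact: fsubst_frac. Qed.

Lemma msubstM r s : msubst g (r * s) = msubst g r * msubst g s.
Proof.
have [P [Q [Q0 ->]]] := fraction_exists r; have [P' [Q' [Q'0 ->]]] := fraction_exists s.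
have -> : P%:F / Q%:F * (P'%:F / Q'%:F) = (P * P')%:F / (Q * Q')%:F.
  by rewrite mulrACA -invfM -!tofracM.
rewrite (msubst_frac _ (mulf_neq0 Q0 Q'0)) (msubst_frac _ Q0) (msubst_frac _ Q'0).
by rewrite !mevalM invfM mulrACA.
Qed.

Lemma msubst1 : msubst g 1 = 1.
Proof.
have e1 : (1 : {fraction {poly F}}) = 1%:F / 1%:F by rewrite tofrac1 divr1.
rewrite {1}e1 (msubst_frac _ (oner_neq0 _)).
exact: (divff (meval_eq0 D0 (oner_neq0 _))).
Qed.

Lemma msubst_neq0 r : r != 0 -> msubst g r != 0.
Proof.
move=> r0; have := msubstM r r^-1; rewrite (divff r0) msubst1 => E.
by apply: contra_eq_neq E => ->; rewrite mul0r oner_eq0.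
Qed.

Lemma msubst_div r s : s != 0 -> msubst g (r / s) = msubst g r / msubst g s.
Proof.
move=> s0; apply: (canRL (mulfK (msubst_neq0 s0))).
by rewrite -msubstM (divfK s0).
Qed.

Lemma msubstX r k : msubst g (r ^+ k) = msubst g r ^+ k.
Proof. by elim: k => [|k IH]; [exact: msubst1 | rewrite !exprS msubstM IH]. Qed.

End Action.

Lemma adj2E g : [/\ (\adj g) 0 0 = g 1 1, (\adj g) 0 1 = - g 0 1,
  (\adj g) 1 0 = - g 1 0 & (\adj g) 1 1 = g 0 0].
Proof.
have l0 : lift (0 : 'I_2) (0 : 'I_1) = 1 by apply/val_inj.
have l1 : lift (1 : 'I_2) (0 : 'I_1) = 0 by apply/val_inj.
split; rewrite !mxE /cofactor det_mx11 !mxE /= ?l0 ?l1.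
- by rewrite expr0 mul1r.
- by rewrite expr1 mulN1r.
- by rewrite expr1 mulN1r.
- by rewrite -signr_odd expr0 mul1r.
Qed.

Lemma det_adj2 g : \det (\adj g) = \det g.
Proof. by rewrite !det2; have [-> -> -> ->] := adj2E g; rewrite mulrNN mulrC. Qed.

Lemma adj2_unit g : g \in unitmx -> \adj g \in unitmx.
Proof. by rewrite !unitmxE det_adj2. Qed.

(** Numerator and denominator are transformed in a common degree, so that the powers of mden
cancel. *)
Lemma msubst_htr g k P Q : g \in unitmx -> Q != 0 ->
  (size P <= k.+1)%N -> (size Q <= k.+1)%N ->
  msubst g (P%:F / Q%:F) =
  (htr (g 0 0) (g 0 1) (g 1 0) (g 1 1) k P)%:F / (htr (g 0 0) (g 0 1) (g 1 0) (g 1 1) k Q)%:F.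
Proof.
move=> gU Q0 sP sQ; have D0 := gU; rewrite mx2_unit in D0; rewrite (msubst_frac gU _ Q0).
rewrite (meval_htr D0 sP) (meval_htr D0 sQ).
have key (A : fieldType) (j x y : A) : j != 0 -> y != 0 -> x / y = j * x / (j * y).
  by move=> j0 y0; rewrite invfM mulrACA divff // mul1r.
exact: key (expf_neq0 k (tofrac_mden_neq0 D0)) (meval_eq0 D0 Q0).
Qed.

Lemma msubstK g r : g \in unitmx -> msubst (\adj g) (msubst g r) = r.
Proof.
move=> gU; have aU := adj2_unit gU; have D0 := gU; rewrite mx2_unit in D0.
have [P [Q [Q0 ->]]] := fraction_exists r; pose k := maxn (size P) (size Q).
have sP : (size P <= k.+1)%N by rewrite leqW // leq_maxl.
have sQ : (size Q <= k.+1)%N by rewrite leqW // leq_maxr.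
rewrite (msubst_htr gU Q0 sP sQ).
rewrite (msubst_htr aU (htr_neq0 D0 Q0 sQ) (size_htr _ _ _ _ _ _) (size_htr _ _ _ _ _ _)).
have [-> -> -> ->] := adj2E g; rewrite (htrK D0 sP) (htrK D0 sQ).
rewrite -!mul_polyC !tofracM.
have key (A : fieldType) (j x y : A) : j != 0 -> y != 0 -> j * x / (j * y) = x / y.
  by move=> j0 y0; rewrite invfM mulrACA divff // mul1r.
apply: key; last by rewrite tofrac_eq0.
by rewrite tofrac_eq0 polyC_eq0 expf_neq0.
Qed.

(** The chain rule for the composition of the Moebius transformation and its inverse. *)
Lemma automorphyK g : g \in unitmx -> msubst (\adj g) (automorphy g) * automorphy (\adj g) = 1.
Proof.
move=> gU; have aU := adj2_unit gU; have D0 := gU; rewrite mx2_unit in D0.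
have D0' := aU; rewrite mx2_unit in D0'.
have J0 := mden_neq0 D0; have J0' := tofrac_mden_neq0 D0'.
rewrite /automorphy det_adj2 -tofracXn.
rewrite (msubst_frac aU _ (expf_neq0 2 J0)) meval_const mevalX.
have E : fcst (\det g) = (mden ((\adj g) 1 0) ((\adj g) 1 1))%:F *
    meval ((\adj g) 0 0) ((\adj g) 0 1) ((\adj g) 1 0) ((\adj g) 1 1) (mden (g 1 0) (g 1 1)).
  have := meval_htr D0' (size_mden (g 1 0) (g 1 1)); rewrite expr1 => <-.
  have [-> -> -> ->] := adj2E g.
  have -> : mden (g 1 0) (g 1 1) = htr (g 0 0) (g 0 1) (g 1 0) (g 1 1) 1 1.
    by rewrite htr1 expr1.
  rewrite (htrK D0); last by rewrite size_poly1.
  by rewrite expr1 alg_polyC det2.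
have d0 : fcst (\det g) != 0 by rewrite /fcst tofrac_eq0 polyC_eq0 -unitfE -unitmxE.
rewrite {}E in d0 *.
have key (A : fieldType) (x y : A) : x * y != 0 -> x * y / y ^+ 2 * (x * y / x ^+ 2) = 1.
  by rewrite mulf_eq0 negb_or => /andP[x0 y0]; field; rewrite x0 y0.
exact: key d0.
Qed.

Lemma twist_adj g r (i : nat) : g \in unitmx -> twist (\adj g) (twist g r i%:Z) i%:Z = r.
Proof.
move=> gU; have aU := adj2_unit gU; rewrite (twistE _ _ aU) (twistE _ _ gU).
have A0 := expf_neq0 i (automorphy_neq0 gU).
rewrite (msubstM aU) (msubst_div aU _ A0) (msubstX aU) (msubstK _ gU).
have key (A : fieldType) (x y z : A) : y * z = 1 -> x * (y / y ^+ i) * (z / z ^+ i) = x.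
  move=> yz; have yzi : y ^+ i * z ^+ i = 1 by rewrite -exprMn yz expr1n.
  by rewrite -mulrA mulrACA yz mul1r -invfM yzi invr1 mulr1.
exact: key (automorphyK gU).
Qed.

Lemma twist_neq0 g r (i : nat) : g \in unitmx -> r != 0 -> twist g r i%:Z != 0.
Proof.
move=> gU r0; rewrite (twistE _ _ gU); apply: mulf_neq0; first exact: msubst_neq0.
have A0 := automorphy_neq0 gU.
apply: mulf_neq0; first exact: A0.
by rewrite invr_eq0; exact: expf_neq0 i A0.
Qed.

(** If s = r m^n is a polynomial, then for m' = mden^k m(mnum/mden) the product of m'^n and
the twist of r is Delta^(1-i) s(mnum/mden) mden^(nk + 2i - 2), a polynomial for large k. *)
Lemma twist_integral g r (i n : nat) (m s : {poly F}) : g \in unitmx -> (0 < n)%N ->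
  m != 0 -> s%:F = r * m%:F ^+ n ->
  exists M L, exists delta : F, exists m' : {poly F},
    [/\ (size s <= M.+1)%N, delta * \det g ^+ i = \det g,
      (L + M + 2 = i + i %[mod n])%N, m' != 0 &
      (mtwist (g 0 0) (g 0 1) (g 1 0) (g 1 1) M L delta s)%:F =
      twist g r i%:Z * m'%:F ^+ n].
Proof.
move=> gU hn m0 E; have D0 := gU; rewrite mx2_unit in D0.
(* k is at least the degree of m, and nk >= M + 2 makes L nonnegative without truncation. *)
pose M := size s; pose k := (M + 2 + size m)%N; pose L := (n * k + (i + i) - 2 - M)%N.
have HL : (L + M + 2 = n * k + (i + i))%N.
  rewrite /L /k; move: hn; case: (n) => // n' _; rewrite mulSn; lia.
pose Dt := \det g; have Dt0 : Dt != 0 by rewrite -unitfE -unitmxE.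
exists M, L, (Dt / Dt ^+ i), (htr (g 0 0) (g 0 1) (g 1 0) (g 1 1) k m).
have sm : (size m <= k.+1)%N by rewrite /k; lia.
have ss : (size s <= M.+1)%N by rewrite /M.
split.
- exact: ss.
- by rewrite divfK // expf_neq0.
- by rewrite HL mulnC modnMDl.
- exact: (htr_neq0 D0 m0 sm).
rewrite (twistE _ _ gU) /mtwist -mul_polyC !tofracM tofracXn (meval_htr D0 ss) (meval_htr D0 sm).
have mn0 : (m ^+ n)%:F != 0 by rewrite tofrac_eq0 expf_neq0.
have -> : r = s%:F / (m ^+ n)%:F.
  by apply: (canRL (mulfK mn0)); rewrite tofracXn.
rewrite (msubst_frac gU _ (expf_neq0 n m0)) mevalX /automorphy.
have J0 := tofrac_mden_neq0 D0; have e0 := meval_eq0 D0 m0.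
have dE : (Dt / Dt ^+ i)%:P%:F = fcst (\det g) / fcst (\det g) ^+ i.
  have key (A : fieldType) (x y z : A) : z != 0 -> x * z = y -> x = y / z.
    by move=> z0 <-; rewrite mulfK.
  apply: key; first by apply: expf_neq0; rewrite /fcst tofrac_eq0 polyC_eq0.
  by rewrite /fcst -!tofracXn -polyC_exp -tofracM -polyCM divfK ?expf_neq0.
have d0 : fcst (\det g) != 0 by rewrite /fcst tofrac_eq0 polyC_eq0.
rewrite dE.
have key (A : fieldType) (d j x y : A) : d != 0 -> j != 0 -> y != 0 ->
  d / d ^+ i * (j ^+ L * (j ^+ M * x)) =
  x / y ^+ n * ((d / j ^+ 2) / (d / j ^+ 2) ^+ i) * (j ^+ k * y) ^+ n.
  move=> d00 j0 y0; rewrite [(j ^+ k * y) ^+ n]exprMn -[(j ^+ k) ^+ n]exprM [(k * n)%N]mulnC.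
  have E2 : j ^+ L * j ^+ M * j ^+ 2 = j ^+ (n * k) * (j ^+ 2) ^+ i.
    by rewrite -exprM -!exprD HL mul2n addnn.
  have -> : (d / j ^+ 2) / (d / j ^+ 2) ^+ i = d / d ^+ i * ((j ^+ 2) ^+ i / j ^+ 2).
    by rewrite expr_div_n invf_div mulrACA [RHS]mulrACA; congr (_ * _); rewrite mulrC.
  have -> : j ^+ L * (j ^+ M * x) = j ^+ (n * k) * (j ^+ 2) ^+ i / j ^+ 2 * x.
    by rewrite -E2 mulfK ?expf_neq0 // mulrA.
  have yn0 := expf_neq0 n y0; move: (y ^+ n) yn0 => z z0.
  move: (d / d ^+ i) (j ^+ (n * k)) ((j ^+ 2) ^+ i) (j ^- 2) => d1 j1 j2 j3.
  by field.
exact: key d0 J0 e0.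
Qed.

End Twist.

(** * Invariance of the residues *)

Section Residues.
Variables (R : realType) (F : finFieldType) (p n : nat) (hp : p \in [pchar F]).
Hypotheses (hn : (0 < n)%N) (hq : #|F| = 1 %[mod n]).
Variable eps : F -> R[i].
Hypothesis heps : is_mu_embedding n eps.
Local Notation C := (R[i]).
Local Notation q := #|F|.
Local Notation ep := (eps0 eps).
Local Notation em := (e_o R hp).
Local Notation "f %:F" := (FracField.tofrac f).
Local Notation asum := (asum n ep em).
Implicit Types (r s c : {poly F}).

Lemma unity_neq0 (x : F) : x ^+ n = 1 -> x != 0.
Proof.
by move=> xn; apply: contra_eq_neq xn => ->; rewrite expr0n gtn_eqF // eq_sym oner_eq0.
Qed.

Lemma eps0_unity (x : F) : x ^+ n = 1 -> ep x = eps x.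
Proof. by move=> /unity_neq0; rewrite /eps0 => /negPf->. Qed.

Lemma eps0_0 : ep 0 = 0. Proof. by rewrite /eps0 eqxx. Qed.

Lemma eps0_1 : ep 1 = 1.
Proof. by rewrite eps0_unity ?expr1n //; case: heps. Qed.

Lemma eps0M (x y : F) : x ^+ n = 1 -> y ^+ n = 1 -> ep (x * y) = ep x * ep y.
Proof.
move=> xn yn; rewrite !eps0_unity ?exprMn ?xn ?yn ?mulr1 //.
by have [_ M _] := heps; apply: M; rewrite inE; apply/unity_rootP.
Qed.

Lemma eps0_inj (x : F) : x ^+ n = 1 -> ep x = 1 -> x = 1.
Proof.
move=> xn; rewrite eps0_unity // => ex; have [e1 _ I] := heps.
by apply: I; rewrite ?e1 // inE; apply/unity_rootP; rewrite ?expr1n.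
Qed.

Lemma gauss_sumE r c : c != 0 -> gauss_sum hp n eps r c = gsum n ep em r c.
Proof.
move=> c0; apply: eq_bigr => xi _; rewrite /csym /e_k; congr (_ * e_o _ _ _).
exact: expansion_res.
Qed.

Definition nth_power_count : C := \sum_(a : F | (a != 0) && `[< exists b, a = b ^+ n >]) 1.

Definition psi_coef i r d : C :=
  if d == i %[mod n] then nth_power_count * asum r d else 0.

(** A polynomial c of degree d is a times a monic one, and only the a that are n-th
powers contribute; their symbol is 1. *)
Lemma psi_termE r i (s : C) d :
  psi_term hp n eps r (expansion ((fX F)^-1 ^ (- (i%:Z)))) s d =
  psi_coef i r d * qpow F (- (d%:R * s)).
Proof.
rewrite /psi_term /psi_coef.
set eta := expansion _; set Q := qpow F _.
pose G c := if (size c == d.+1) && `[< nth_power_class n c eta >]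
  then gauss_sum hp n eps r c * Q else 0.
rewrite big_mkcond /= (sum_npolyS _ G) (bigID (pred1 0)) /= big_pred1_eq.
rewrite big1 ?add0r => [|u _]; last first.
  by rewrite /G scale0r add0r ltn_eqF // ltnS size_npoly.
have term a : a != 0 -> \sum_(u : {poly_d F}) G (a *: 'X^d + (u : {poly F})) =
   if (d == i %[mod n]) && `[< exists b, a = b ^+ n >] then asum r d * Q else 0.
  move=> a0; rewrite sum_leading_unit //.
  pose cc (u : {poly_d F}) : {poly F} := a *: ('X^d + (u : {poly F})).
  have lc u : size (cc u) = d.+1 /\ lead_coef (cc u) = a.
    rewrite /cc size_scale // size_monic_sum lead_coefZ.
    by rewrite (monicP (monic_monic_sum u)) mulr1.
  have E u : G (cc u) = if (d == i %[mod n]) && `[< exists b, a = b ^+ n >]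
      then gsum n ep em r ('X^d + (u : {poly F})) * Q else 0.
    have [sc lcc] := lc u; rewrite /G sc eqxx /=.
    have -> : `[< nth_power_class n (cc u) eta >] = (d == i %[mod n]) && `[< exists b, a = b ^+ n >].
      apply/asboolP/andP => [/(nth_power_classP hn hq i sc)[/eqP di ex]|[/eqP di /asboolP ex]].
        by split=> //; apply/asboolP; rewrite -lcc.
      by apply/(nth_power_classP hn hq i sc); split; rewrite ?lcc.
    case: ifP => // /andP[_ /asboolP[b ab]].
    have u0 : 'X^d + (u : {poly F}) != 0 by rewrite -size_poly_eq0 size_monic_sum.
    have b0 : b != 0 by apply: contraNneq a0 => b0; rewrite ab b0 expr0n gtn_eqF.
    rewrite gauss_sumE; last by rewrite -size_poly_eq0 sc.
    rewrite /cc (gsum_scaler hn hq em eps0_0 eps0_1 eps0M) // ab.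
    rewrite (cunitX hn hq eps0_0 eps0_1 eps0M) (cunit_unity hn hq eps0_0 eps0_1 eps0M) //.
    by rewrite expr1n mul1r.
  rewrite (eq_bigr _ (fun u _ => E u)); case: ifP => _; first by rewrite -mulr_suml.
  by rewrite big1.
rewrite (eq_bigr _ term) /nth_power_count; case: ifP => di /=; last by rewrite mul0r big1.
rewrite -big_mkcondr /= -mulrA [RHS]mulr_suml; apply: eq_bigr => a _.
by rewrite mul1r.
Qed.

Lemma psiE r i (s : C) : psi hp n eps r (expansion ((fX F)^-1 ^ (- (i%:Z)))) s =
  dirichlet F n (psi_coef i r) s.
Proof.
rewrite /psi /dirichlet; congr (_ * limn (series _ : nat -> C^o)).
by apply/funext => d; rewrite psi_termE.
Qed.

Lemma rho_polyE r i : rho_poly hp n eps r i%:Z =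
  xget 0 [set v | continuation_residue F n (dirichlet F n (psi_coef i r)) v]%classic.
Proof.
rewrite /rho_poly /rho_eta; congr xget; apply/funext => v; rewrite /continuation_residue.
have -> : dirichlet F n (psi_coef i r) = psi hp n eps r (expansion ((fX F)^-1 ^ (- (i%:Z)))).
  by apply/funext => s; rewrite psiE.
by [].
Qed.

Lemma psi_coef_recursion i r : r != 0 ->
  (forall d, ((size r).+1 <= d)%N -> psi_coef i r d = 0) \/
  ((1 < n)%N /\ forall d, ((size r).+1 <= d)%N ->
     psi_coef i r (d + n)%N = (q ^ n.+1)%:R * psi_coef i r d).
Proof.
move=> r0; have [n1|n1] := leqP n 1.
  left=> -[//|d] dr; rewrite /psi_coef.
  have {}n1 : n = 1%N by apply/eqP; rewrite eqn_leq n1.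
  rewrite (asum_eq0 hn hq eps0_0 eps0_1 eps0M (e_oD R hp)) ?mulr0 ?if_same //.
  exact: e_o_nontrivial.
right; split=> // d dr; rewrite /psi_coef modnDr.
by rewrite (asum_step hn hq em eps0_0 eps0_1 eps0M eps0_inj) // mulrCA; case: ifP; rewrite ?mulr0.
Qed.

(** The coefficients of the two Dirichlet series agree in large degrees by [asum_mtwist]. *)
Lemma rho_poly_mtwist (g : 'M[F]_2) M L i (delta : F) s :
  g \in unitmx -> (size s <= M.+1)%N -> delta * \det g ^+ i = \det g ->
  (L + M + 2 = i + i %[mod n])%N ->
  let s' := mtwist (g 0 0) (g 0 1) (g 1 0) (g 1 1) M L delta s in
  s != 0 -> s' != 0 -> rho_poly hp n eps s i%:Z = rho_poly hp n eps s' i%:Z.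
Proof.
rewrite mx2_unit det2 => D0 ss Hdelta HL s' s0 s'0; rewrite !rho_polyE; congr xget.
pose D := (maxn (size s) (size s')).+1.
have E d : (D <= d)%N -> psi_coef i s d = psi_coef i s' d.
  rewrite /D gtn_max => /andP[sd s'd]; rewrite /psi_coef; case: ifP => // /eqP di.
  by rewrite (asum_mtwist hn hq em eps0_0 eps0_1 eps0M eps0_inj D0 ss Hdelta HL di).
have rec (t : {poly F}) : t != 0 -> ((size t).+1 <= D)%N -> (forall d, (D <= d)%N -> psi_coef i t d = 0) \/
  ((1 < n)%N /\ forall d, (D <= d)%N ->
     psi_coef i t (d + n)%N = (q ^ n.+1)%:R * psi_coef i t d).
  move=> t0 tD; have [h|[n1 h]] := psi_coef_recursion i t0.
    by left=> d /(leq_trans tD); apply: h.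
  by right; split=> // d /(leq_trans tD); apply: h.
apply/funext => v; apply/propext; split.
  by apply: (residue_eq hn E); apply: rec; rewrite // ltnS leq_maxl.
apply: (@residue_eq _ _ _ hn _ _ D); first by move=> d /E.
by apply: rec; rewrite // ltnS leq_maxr.
Qed.

(** [twist_integral] provides the representative of the twist, and [rho_poly_mtwist] compares
the two values. *)
Lemma rho_twist_sub (g : 'M[F]_2) (r : {fraction {poly F}}) (i : nat) v :
  g \in unitmx -> r != 0 ->
  (exists m s : {poly F}, [/\ m != 0, s%:F = r * m%:F ^+ n & v = rho_poly hp n eps s i%:Z]) ->
  exists m s : {poly F}, [/\ m != 0, s%:F = twist g r i%:Z * m%:F ^+ n &
    v = rho_poly hp n eps s i%:Z].
Proof.
move=> gU r0 [m [s [m0 Es ->]]].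
have [M [L [delta [m' [ss Hd HL m'0 Es']]]]] := twist_integral i gU hn m0 Es.
have nz (x : {fraction {poly F}}) (a b : {poly F}) : x != 0 -> b != 0 -> a%:F = x * b%:F ^+ n -> a != 0.
  move=> x0 b0 E; rewrite -tofrac_eq0 E; apply: mulf_neq0; first exact: x0.
  by apply: expf_neq0; rewrite tofrac_eq0.
have s0 := nz _ _ _ r0 m0 Es; have s'0 := nz _ _ _ (twist_neq0 i gU r0) m'0 Es'.
exists m', (mtwist (g 0 0) (g 0 1) (g 1 0) (g 1 1) M L delta s); split; [exact: m'0|exact: Es'|].
exact: (rho_poly_mtwist gU ss Hd HL s0 s'0).
Qed.

End Residues.

Theorem theorem1 (R : realType) (F : finFieldType) (p n : nat)
    (hp : p \in [pchar F]) (hn : (0 < n)%N) (hodd : odd #|F|)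
    (hq : #|F| = 1 %[mod n])
    (eps : F -> R[i]) (heps : is_mu_embedding n eps)
    (g : 'M[F]_2) (hg : g \in unitmx)
    (r : {fraction {poly F}}) (hr : r != 0)
    (i : int) (hi0 : 0 <= i) (hin : i < n%:Z) :
  rho hp n eps r i = rho hp n eps (twist g r i) i.
Proof.
case: i hi0 hin => // i _ _; rewrite /rho; congr xget; apply/funext => v; apply/propext.
split; first exact: rho_twist_sub.
(* The reverse inclusion is the same one for the adjugate of g. *)
move/(rho_twist_sub hn hq heps (adj2_unit hg) (twist_neq0 i hg hr)).
by rewrite twist_adj.
Qed.
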